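(* Suppose that $(X,d)$ is a complete and quasiconvex metric space, and let $\Phi:X\to\ell^\infty$ be a weak BLD mapping. Then, for any $k\in\mathbb{N}$ and any Lipschitz map $f:E\to X$ defined on a measurable set $E\subset\mathbb{R}^k$, the following conditions are equivalent: (1) $\mathcal{H}^k(f(E))=0$ in $X$; (2) $\mathcal{H}^k(\Phi(f(E)))=0$ in $\ell^\infty$; (3) $\operatorname{rank}(\operatorname{ap} D(\Phi\circ f))<k$ almost everywhere in $E$.
   Context: $\mathbb{N}=\{1,2,\ldots\}$, measurable means Lebesgue measurable, and $\mathcal{H}^k$ denotes $k$-dimensional Hausdorff measure with respect to the metric of the space in question. $\ell^\infty$ is the Banach space of bounded real sequences with the supremum norm. The length $\ell_X(\gamma)$ of a curve $\gamma:[a,b]\to X$ in a metric space is the supremum of $\sum_i d(\gamma(t_i),\gamma(t_{i+1}))$ over all partitions $a=t_0<\cdots<t_n=b$; a curve is a continuous map from a compact interval, and it is rectifiable if its length is finite. For $\Phi\circ\gamma$ the length is defined by the same supremum over partitions. Weak BLD (weak bounded length distortion): a mapping $\Phi:X\to Y$ between metric spaces is weak BLD if there is a constant $M\geq 1$ such that for all rectifiable curves $\gamma$ in $X$, $$M^{-1}\ell_X(\gamma)\leq \ell_Y(\Phi\circ\gamma)\leq M\,\ell_X(\gamma).$$ Quasiconvex: a metric space $(X,d)$ is quasiconvex if there is a constant $C_q\geq 1$ such that for any $x,y\in X$ there is a rectifiable curve $\gamma:[0,1]\to X$ with $\gamma(0)=x$, $\gamma(1)=y$ and length $\ell(\gamma)\leq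 C_q\,d(x,y)$. If $X$ is quasiconvex, any weak BLD mapping on $X$ with constant $M$ is $MC_q$-Lipschitz, so $\Phi\circ f$ is Lipschitz. Approximate derivative into $\ell^\infty$: if $g=(g_1,g_2,\ldots):E\to\ell^\infty$ is Lipschitz on a measurable set $E\subset\mathbb{R}^k$, then each component $g_i:E\to\mathbb{R}$ is Lipschitz, so for almost every $x\in E$ all the $g_i$ are approximately differentiable at $x$. At such $x$, $\operatorname{ap} Dg(x)$ is the $\infty\times k$ real matrix whose $i$-th row is $\operatorname{ap} Dg_i(x)\in\mathbb{R}^k$. Its rank is the dimension of the span of its rows in $\mathbb{R}^k$ (equivalently, of its $k$ columns), and is at most $k$. *)

(* Defs.v *)
From HB Require Import structures.
From mathcomp Require Import all_boot all_order all_algebra.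
From mathcomp Require Import all_classical all_reals all_analysis.

Set Implicit Arguments.
Unset Strict Implicit.
Unset Printing Implicit Defensive.

Import Order.TTheory GRing.Theory Num.Theory.
Import numFieldNormedType.Exports.

Local Open Scope classical_set_scope.
Local Open Scope ring_scope.

Section curves.
Context {R : realType} {X : metricType R}.
Implicit Types (a b : R) (c : R -> X) (s : seq R).

Definition polygonal_length a b c s : R :=
  \sum_(0 <= i < size s)
    mdist (c (nth b (a :: s) i)) (c (nth b (a :: s) i.+1)).

(* [itv_partition a b s] says that a < s_0 < ... < s_(n-1) = b, the first
   point a of the partition being left out of s. *)
Definition curve_length a b c : \bar R :=
  ereal_sup [set (polygonal_length a b c s)%:E | s in itv_partition a b].

(* Curves on [a, b] are total functions whose values outside [a, b] are
   irrelevant. *)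
Definition rectifiable_curve a b c : Prop :=
  [/\ a <= b, {within `[a, b], continuous c}
    & (curve_length a b c < +oo)%E].

End curves.

Definition weak_BLD (R : realType) (X Y : metricType R) (Phi : X -> Y) : Prop :=
  exists M : R, 1 <= M /\
    forall (a b : R) (c : R -> X), rectifiable_curve a b c ->
      ((M^-1)%:E * curve_length a b c <= curve_length a b (Phi \o c))%E /\
      (curve_length a b (Phi \o c) <= M%:E * curve_length a b c)%E.

Definition quasiconvex (R : realType) (X : metricType R) : Prop :=
  exists C : R, 1 <= C /\
    forall x y : X, exists c : R -> X,
      [/\ rectifiable_curve 0 1 c, c 0 = x, c 1 = y
        & (curve_length 0 1 c <= (C * mdist x y)%:E)%E].

(* This is the axiom of the library's completeType, a structure that is not
   joined with metricType and also carries a base point. *)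
Definition complete_space (R : realType) (X : metricType R) : Prop :=
  forall F : set_system X, ProperFilter F -> cauchy F -> exists x : X, F --> x.

Section hausdorff_measure.
Context {R : realType} {X : metricType R}.
Local Open Scope ereal_scope.
Implicit Types (A U : set X) (k : nat) (delta : R).

(* The singleton makes the diameter of the empty set 0 rather than -oo. *)
Definition diameter U : \bar R :=
  ereal_sup (0 |` [set (mdist p.1 p.2)%:E | p in U `*` U]).

Definition hausdorff_content k delta A : \bar R :=
  ereal_inf [set \sum_(0 <= i <oo) diameter (U i) ^+ k
            | U in [set U : (set X)^nat |
                     (forall i, diameter (U i) <= delta%:E) /\
                     A `<=` \bigcup_i U i]].

(* Hausdorff measure without the factor (volume of the unit ball) / 2 ^ k that
   some authors include. It is meant for k > 0: for k = 0 an empty piece of a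
   cover would contribute 0 ^ 0 = 1. *)
Definition hausdorff_measure k A : \bar R :=
  ereal_sup [set hausdorff_content k delta A
            | delta in [set delta : R | (0 < delta)%R]].

End hausdorff_measure.

Section linfty.
Context (R : realType).

Definition linfty := {x : nat -> R | `[< bounded_fun x >]}.

HB.instance Definition _ := Choice.on linfty.

Definition linfty_dist (x y : linfty) : R :=
  sup (range (fun i => `|val x i - val y i|)).

Lemma linfty_dist_has_sup (x y : linfty) :
  has_sup (range (fun i => `|val x i - val y i|)).
Proof.
split; first by exists `|val x 0%N - val y 0%N|; exists 0%N.
have /asboolP[Mx [_ bx]] := valP x; have /asboolP[My [_ by_]] := valP y.
exists ((Mx + 1) + (My + 1)) => _ [i _ <-].
apply: le_trans (ler_normB _ _) _; apply: lerD.
  by apply: bx; rewrite ?ltrDl.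
by apply: by_; rewrite ?ltrDl.
Qed.

Lemma linfty_dist_ge (x y : linfty) i : `|val x i - val y i| <= linfty_dist x y.
Proof. by apply: sup_ubound; [exact: (linfty_dist_has_sup x y).2 | exists i]. Qed.

Lemma linfty_dist_le (x y : linfty) M :
  (forall i, `|val x i - val y i| <= M) -> linfty_dist x y <= M.
Proof.
move=> xyM; apply: ge_sup; first exact: (linfty_dist_has_sup x y).1.
by move=> _ [i _ <-].
Qed.

Lemma linfty_distxx x : linfty_dist x x = 0.
Proof.
apply/eqP; rewrite eq_le linfty_dist_le => [|i]; last by rewrite subrr normr0.
exact: le_trans (normr_ge0 _) (linfty_dist_ge x x 0).
Qed.

Lemma linfty_dist_eq0 x y : linfty_dist x y = 0 -> x = y.
Proof.
move=> xy0; apply/val_inj/funext => i; apply/eqP.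
by rewrite -subr_eq0 -normr_le0 -xy0 linfty_dist_ge.
Qed.

Lemma linfty_distC x y : linfty_dist x y = linfty_dist y x.
Proof.
by apply/le_anti/andP; split; apply: linfty_dist_le => i;
  rewrite distrC linfty_dist_ge.
Qed.

Lemma linfty_distD y x z : linfty_dist x z <= linfty_dist x y + linfty_dist y z.
Proof.
apply: linfty_dist_le => i; apply: le_trans (ler_distD (val y i) _ _) _.
by rewrite lerD ?linfty_dist_ge.
Qed.

HB.instance Definition _ := @isMetric.Build R linfty linfty_dist
  linfty_distxx linfty_dist_eq0 linfty_distC linfty_distD.

End linfty.

Section euclidean_space.
Context {R : realType} {k : nat}.
Implicit Types (x y : 'rV[R]_k) (A E : set 'rV[R]_k).

(* The norm that the library puts on 'rV[R]_k is the maximum norm. *)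
Definition euclidean_norm x : R := Num.sqrt (\sum_(i < k) x 0 i ^+ 2).

Definition euclidean_ball x (r : R) : set 'rV[R]_k :=
  [set y | euclidean_norm (y - x) < r].

Definition lipschitz_map_on (X : metricType R) E (f : 'rV[R]_k -> X) : Prop :=
  exists L : R, forall x y, E x -> E y ->
    mdist (f x) (f y) <= L * euclidean_norm (x - y).

(* A box is given by its lowest and highest corners. *)
Definition box (c : 'rV[R]_k * 'rV[R]_k) : set 'rV[R]_k :=
  [set x | forall i, c.1 0 i <= x 0 i <= c.2 0 i].

Definition box_volume (c : 'rV[R]_k * 'rV[R]_k) : R :=
  \prod_(i < k) (c.2 0 i - c.1 0 i).

Definition lebesgue_outer A : \bar R :=
  ereal_inf [set (\sum_(0 <= n <oo) (box_volume (c n))%:E)%E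
            | c in [set c : ('rV[R]_k * 'rV[R]_k)^nat |
                     (forall n i, (c n).1 0 i <= (c n).2 0 i) /\
                     A `<=` \bigcup_n box (c n)]].

Definition lebesgue_measurable A : Prop := lebesgue_outer.-caratheodory A.

Definition ae_in E (P : 'rV[R]_k -> Prop) : Prop :=
  lebesgue_outer [set x | E x /\ ~ P x] = 0%E.

Definition density_point A x : Prop :=
  fine (lebesgue_outer (A `&` euclidean_ball x r)) /
    fine (lebesgue_outer (euclidean_ball x r)) @[r --> 0^'+] --> (1 : R).

End euclidean_space.

Section approximate_derivative.
Context {R : realType} {k : nat}.
Implicit Types (x y : 'rV[R]_k) (E : set 'rV[R]_k).

(* The row vector [L] stands for the linear form v |-> \sum_j L_j v_j. When
   [y = x] the quotient below is 0. *)
Definition is_ap_derivative E (g : 'rV[R]_k -> R) x (L : 'rV[R]_k) : Prop :=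
  forall eps : R, 0 < eps ->
    density_point
      [set y | E y /\
         `|g y - g x - \sum_(j < k) L 0 j * (y - x) 0 j|
           / euclidean_norm (y - x) < eps] x.

Definition ap_derivable E (g : 'rV[R]_k -> R) x : Prop :=
  exists L, is_ap_derivative E g x L.

Definition ap_derivative E (g : 'rV[R]_k -> R) x : 'rV[R]_k :=
  xget 0 [set L | is_ap_derivative E g x L].

Definition linfty_ap_derivable E (g : 'rV[R]_k -> linfty R) x : Prop :=
  forall i, ap_derivable E (fun y => val (g y) i) x.

(* An infinite matrix with k columns is the sequence of its rows. *)
Definition linfty_ap_derivative E (g : 'rV[R]_k -> linfty R) x :
    nat -> 'rV[R]_k :=
  fun i => ap_derivative E (fun y => val (g y) i) x.

Definition is_rowspan (D : nat -> 'rV[R]_k) (V : {vspace 'rV[R]_k}) : Prop :=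
  (forall i, D i \in V) /\
  forall W : {vspace 'rV[R]_k}, (forall i, D i \in W) -> (V <= W)%VS.

Lemma is_rowspan_ex D : exists V, is_rowspan D V.
Proof.
pose P n := `[< exists2 V : {vspace 'rV[R]_k},
                 (forall i, D i \in V) & \dim V = n >].
have exP : exists n, P n.
  exists (\dim {: 'rV[R]_k}); apply/asboolP.
  by exists fullv => // i; rewrite memvf.
have [n /asboolP[V DV dimV] n_min] := ex_minnP exP.
exists V; split=> // W DW; suff <- : (V :&: W)%VS = V by exact: capvSr.
apply/eqP; rewrite eqEdim capvSl dimV; apply: n_min; apply/asboolP.
by exists (V :&: W)%VS => // i; rewrite memv_cap DV DW.
Qed.

Definition rowspan (D : nat -> 'rV[R]_k) : {vspace 'rV[R]_k} :=
  xget 0%VS [set V | is_rowspan D V].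

Lemma rowspanP D : is_rowspan D (rowspan D).
Proof. exact: (xgetPex _ (is_rowspan_ex D)). Qed.

Definition rank_rows (D : nat -> 'rV[R]_k) : nat := \dim (rowspan D).

End approximate_derivative.

(* Main.v *)
From HB Require Import structures.
Require Import Defs.
From mathcomp Require Import all_boot all_order all_algebra.
From mathcomp Require Import all_classical all_reals all_analysis.
From mathcomp Require Import measurable_realfun zify ring lra.
Set Implicit Arguments.
Unset Strict Implicit.
Unset Printing Implicit Defensive.
Import Order.TTheory GRing.Theory Num.Theory.
Import numFieldNormedType.Exports.
Local Open Scope classical_set_scope.
Local Open Scope ring_scope.

(** A map of zero Hausdorff measure stays so after composition with the Lipschitz
    map [Phi]. For the rest, two facts about the rows of the approximate derivative
    of [Phi \o f] are needed.

    Rank less than [k] almost everywhere makes [f E] null. At such a point some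
    direction [v] is annihilated by all rows, so each coordinate of [Phi \o f] is infinitesimally
    slow along [v]; the task is to show that [f] itself is slow, although [Phi]
    only controls the lengths of curves and may bring distant points together.
    On a line in direction [v] that lies in the degenerate set [S] up to a small
    measure, the values of [f] on [S] are joined into one Lipschitz curve of [X],
    the gaps being filled by quasiconvexity and completeness
    ([lipschitz_filling]). Every coordinate of its image under [Phi] moves by
    little, because it is slow on [S] and Lipschitz on the small rest
    ([slow_on_subset]), so the image is short and, by the lower weak BLD bound,
    so is the curve ([slow_curve_mdist]). Averaging over parallel lines
    ([exists_good_line]) produces such lines close to any two points of [S] whose
    difference is nearly a multiple of [v], in a cube in which [S] is dense. Hence the image of the part of [S] in a cube of
    radius [r] is covered by about [N ^ (k - 1)] sets of diameter about [r / N],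
    one for each tube in direction [v], and has content at most a constant times
    [r ^ k / N] ([tubes_content]). An efficient cover of [S] by cubes turns this
    into a bound by the measure of [S] over [N] ([slow_content]). Countably many
    rational directions suffice ([degenerate_slow_cover]), and [N] is arbitrary
    ([degenerate_null]).

    A null image [Phi (f E)] forces rank less than [k] almost everywhere. Where the
    rank is [k], finitely many rows span, so that [Phi \o f] expands distances from
    the point by a definite factor on a small ball ([full_rank_expanding]). On
    countably many pieces the inverse of [Phi \o f] is therefore Lipschitz and the
    pieces are null ([expanding_set_null]).

    The approximate derivatives exist almost everywhere by Rademacher's theorem
    for a Lipschitz extension ([rademacher]). In one variable it follows from the
    Radon-Nikodym and Lebesgue differentiation theorems
    ([lipschitz_derivable_ae]). The points without partial derivatives are null
    since at a density point of them some line parallel to the axis would meet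
    them in positive length ([no_slope_null]). Finally, at a density point of a set
    on which the increments along the axes are linear up to a uniform error, adding
    these increments shows that the whole increment is linear up to a comparable
    error ([slopes_density]). Conversely an approximate derivative is a derivative
    of the extension, since a set with a density point has no large holes near it
    ([ap_derivative_extension]). *)

(** * Infima over countable covers *)

Section cover_infimum.
Context {R : realType} {I T : Type}.
Variables (P : I -> Prop) (tau : I -> \bar R) (S : I -> set T).
Hypothesis tau_ge0 : forall i, P i -> (0 <= tau i)%E.
Local Open Scope ereal_scope.

(** The common shape of [lebesgue_outer], [hausdorff_content] and the cube
    covers below, so that subadditivity is proved once. *)
Definition cover_inf (A : set T) : \bar R :=
  ereal_inf [set \sum_(0 <= n <oo) tau (c n)
            | c in [set c : nat -> I | (forall n, P (c n)) /\
                                       A `<=` \bigcup_n S (c n)]].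

Lemma cover_inf_ge0 A : 0 <= cover_inf A.
Proof.
by apply: le_ereal_inf_tmp => _ [c [Pc _] <-]; apply: nneseries_ge0 => n _ _;
  exact: tau_ge0.
Qed.

Lemma le_cover_inf A B : A `<=` B -> cover_inf A <= cover_inf B.
Proof.
move=> AB; apply/ereal_inf_le_tmp => _ [c [Pc Bc] <-].
by exists c => //; split => //; exact: subset_trans Bc.
Qed.

Lemma cover_inf_le A (c : nat -> I) : (forall n, P (c n)) ->
  A `<=` \bigcup_n S (c n) -> cover_inf A <= \sum_(0 <= n <oo) tau (c n).
Proof. by move=> Pc Ac; apply: ereal_inf_lbound; exists c. Qed.

Lemma cover_inf_approx A (e : R) : (0 < e)%R -> cover_inf A < +oo ->
  exists c : nat -> I, [/\ forall n, P (c n), A `<=` \bigcup_n S (c n) &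
    \sum_(0 <= n <oo) tau (c n) <= cover_inf A + e%:E].
Proof.
move=> e0 Aoo; have Afin : cover_inf A \is a fin_num.
  by rewrite ge0_fin_numE// cover_inf_ge0.
have [_ [c [Pc Ac] <-] ce] := lb_ereal_inf_adherent e0 Afin.
by exists c; split => //; exact: ltW.
Qed.

Lemma cover_inf_subadditive (F : nat -> set T) :
  cover_inf (\bigcup_n F n) <= \sum_(0 <= n <oo) cover_inf (F n).
Proof.
have [[i ioo]|Foo] := pselect (exists i, cover_inf (F i) = +oo).
  rewrite (eseries_pinfty _ _ ioo) ?leey// => n _.
  by rewrite -ltNye (lt_le_trans _ (cover_inf_ge0 _)).
apply/lee_addgt0Pr => e e0.
rewrite (le_trans _ (epsilon_trick _ _ (ltW e0)))//; last first.
  by move=> n; exact: cover_inf_ge0.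
have [G PG] : {G : nat -> nat -> I & forall n, [/\ forall m, P (G n m),
    F n `<=` \bigcup_m S (G n m) & \sum_(0 <= m <oo) tau (G n m) <=
      cover_inf (F n) + (e / (2 ^ n.+1)%:R)%:E]}.
  apply: (@choice _ _ (fun n (c : nat -> I) => [/\ forall m, P (c m),
    F n `<=` \bigcup_m S (c m) & \sum_(0 <= m <oo) tau (c m) <=
      cover_inf (F n) + (e / (2 ^ n.+1)%:R)%:E])) => n.
  apply: cover_inf_approx; first by rewrite divr_gt0// ltr0n expn_gt0.
  by rewrite ltey; apply/eqP => Fn; apply: Foo; exists n.
have /card_esym/ppcard_eqP[f] := card_nat2.
pose c n := G (f n).1 (f n).2.
have G0 i j : 0 <= tau (G i j) by apply: tau_ge0; have [] := PG i.
apply: (@le_trans _ _ (\sum_(0 <= n <oo) tau (c n))).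
  apply: cover_inf_le => [n|t [n _ /=]]; first by rewrite /c; have [] := PG (f n).1.
  have [_ + _] := PG n => /[apply] -[m _ Gt].
  exists (f^-1%FUN (n, m)) => //; rewrite /c invK ?inE//.
have -> : \sum_(0 <= n <oo) tau (c n) = \sum_(0 <= i <oo) \sum_(0 <= j <oo) tau (G i j).
  rewrite nneseries_esumT => [|n]; last exact: G0.
  rewrite -(@esum_image _ _ _ setT f (fun ij => tau (G ij.1 ij.2))); last first.
    exact: inj.
  rewrite image_eq nneseries_esumT; last by move=> n; exact: nneseries_ge0.
  rewrite (@eq_esum _ _ _ _ (fun i => \esum_(j in setT) tau (G i j))); last first.
    by move=> i _; rewrite nneseries_esumT.
  rewrite (@esum_esum _ _ _ setT (fun=> setT) (fun i j => tau (G i j)))//.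
  by congr esum; apply/seteqP; split.
apply: lee_nneseries => [i _ _|i _]; first exact: nneseries_ge0.
by have [] := PG i.
Qed.

(** A countably subadditive set function below the gauge on the members of the
    covers is below the infimum over all covers. *)
Lemma le_cover_inf_sub (mu : set T -> \bar R) :
  (forall A B : set T, A `<=` B -> mu A <= mu B) ->
  (forall F : nat -> set T, mu (\bigcup_n F n) <= \sum_(0 <= n <oo) mu (F n)) ->
  (forall A, 0 <= mu A) ->
  (forall i, P i -> mu (S i) <= tau i) -> forall A, mu A <= cover_inf A.
Proof.
move=> mu_le mu_sub mu0 muS A; apply: le_ereal_inf_tmp => _ [c [Pc Ac] <-].
apply: (le_trans (mu_le _ _ Ac)); apply: (le_trans (mu_sub _)).
by apply: lee_nneseries => [n _ _|n _]; [exact: mu0|exact: muS].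
Qed.

Section null_index.
Variable i0 : I.
Hypotheses (Pi0 : P i0) (tau_i0 : tau i0 = 0).

Lemma cover_inf_set0 : cover_inf set0 = 0.
Proof.
apply/eqP; rewrite eq_le cover_inf_ge0 andbT.
have := @cover_inf_le set0 (fun=> i0) (fun=> Pi0) (@sub0set _ _).
by rewrite eseries0.
Qed.

Lemma cover_inf1 i A : P i -> A `<=` S i -> cover_inf A <= tau i.
Proof.
move=> Pi AS.
have := @cover_inf_le A (fun n => if n is 0%N then i else i0).
rewrite nneseries_recl//; last by case=> [|n] _; exact: tau_ge0.
rewrite (@eseries_cond _ _ _ 1)/= eseries0 ?adde0; last by case.
apply; first by case.
by move=> x /AS Sx; exists 0%N.
Qed.

Lemma cover_inf_finite (J : finType) (F : J -> set T) (a : R) :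
  (forall j, cover_inf (F j) <= a%:E) ->
  cover_inf (\bigcup_j F j) <= (#|J|%:R * a)%:E.
Proof.
move=> Fa; pose G n := if insub n is Some m then F (enum_val (m : 'I_#|J|)) else set0.
apply: (@le_trans _ _ (cover_inf (\bigcup_n G n))).
  apply: le_cover_inf => x [j _ Fx]; exists (val (enum_rank j)) => //.
  by rewrite /G valK enum_rankK.
apply: (le_trans (cover_inf_subadditive _)).
rewrite (nneseries_split 0 #|J|); last by move=> n _; exact: cover_inf_ge0.
rewrite add0n [X in _ + X]eseries0 ?adde0; last first.
  by move=> n Jn _; rewrite /G insubN ?cover_inf_set0// -leqNgt.
apply: (@le_trans _ _ (\sum_(0 <= n < #|J|) a%:E)).
  rewrite big_nat [leRHS]big_nat; apply: lee_sum => n /andP[_ nJ].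
  by rewrite /G insubT.
by rewrite sumEFin sumr_const_nat subn0 mulr_natl.
Qed.

End null_index.
End cover_infimum.

(** * Lines with small intersection *)

Lemma exists_le_average d (T : measurableType d) (R : realType)
    (mu : {measure set T -> \bar R}) (D : set T) (F : T -> \bar R) (c : R) :
  measurable D -> (0 < mu D < +oo)%E -> measurable_fun D F ->
  (forall x, D x -> 0 <= F x)%E -> 0 <= c ->
  (\int[mu]_(x in D) F x <= c%:E * mu D)%E ->
  exists2 x, D x & (F x <= c%:E)%E.
Proof.
move=> mD /andP[D0 Doo] mF F0 c0 Fc; apply: contrapT => noF.
have cF x : D x -> (c%:E < F x)%E.
  by move=> Dx; rewrite ltNge; apply/negP => ?; apply: noF; exists x.
pose G x := (F x - c%:E)%E.
have G0 x : D x -> (0 <= G x)%E.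
  by move=> Dx; rewrite /G sube_ge0//; exact/ltW/cF.
have mG : measurable_fun D G by apply: emeasurable_funB => //; exact: measurable_cst.
have FE : (\int[mu]_(x in D) F x = \int[mu]_(x in D) G x + c%:E * mu D)%E.
  rewrite -[in RHS]integral_cst// -ge0_integralD//.
  apply: eq_integral => x _.
  by rewrite /G /cst subeK.
have cD : (c%:E * mu D \is a fin_num)%E.
  by rewrite fin_numM// ge0_fin_numE// ltW.
have : (\int[mu]_(x in D) `|G x| = 0)%E.
  apply/eqP; rewrite eq_le integral_ge0 ?andbT//.
  under eq_integral => x xD do rewrite gee0_abs ?(G0 _ (set_mem xD))//.
  by move: Fc; rewrite FE -[leRHS]add0e leeD2rE.
move=> /(ae_eq_integral_abs mu mD mG)[N [mN N0 DN]].
suff : (mu D <= 0)%E by rewrite leNgt D0.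
rewrite -N0; apply: le_measure; rewrite ?inE// => x Dx; apply: DN => /= /(_ Dx)/eqP.
by apply/negP; rewrite gt_eqF// /G sube_gt0 cF.
Qed.

Section selection.
Context {R : realType}.
Local Notation mu := (@lebesgue_measure R).

Lemma mu_itv_le (a b : R) : a <= b -> (mu `[a, b]%classic <= (b - a)%:E)%E.
Proof.
move=> ab; rewrite lebesgue_measure_itv/= lte_fin -EFinB.
by case: ifPn => // _; rewrite lee_fin subr_ge0.
Qed.

Lemma int_indic (A : set R) : measurable A -> (\int[mu]_t (\1_A t)%:E = mu A)%E.
Proof.
move=> mA; have : (\int[mu]_t (\1_A t)%:E = mu (A `&` setT))%E.
  by apply: integral_indic => //; exact mA.
by rewrite setIT.
Qed.

(** By Fubini, integrating the indicator of an interval at [y + t * v] over [y]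
    gives the length of the interval for every [t]; hence some [y] in an interval
    of length [l] does no worse than the average. *)
Lemma select_coordinate (alpha beta : nat -> R) (w : nat -> R -> R) (v p l : R) :
  0 < l -> (forall n, alpha n <= beta n) ->
  (forall n, measurable_fun setT (w n)) -> (forall n t, 0 <= w n t) ->
  exists y, p <= y <= p + l /\
    (l%:E * \sum_(0 <= n <oo) \int[mu]_t (\1_`[alpha n, beta n] (y + t * v) * w n t)%:E
     <= \sum_(0 <= n <oo) \int[mu]_t ((beta n - alpha n) * w n t)%:E)%E.
Proof.
move=> l0 ab mw w0.
pose h n (x : R * R) := (\1_`[alpha n, beta n] (x.1 + x.2 * v) * w n x.2)%:E.
have h0 n x : (0 <= h n x)%E by rewrite lee_fin mulr_ge0.
have mI n : measurable_fun setT (\1_`[alpha n, beta n] : R -> R).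
  exact: measurable_indic.
have mS : measurable_fun setT (fun x : R * R => x.1 + x.2 * v).
  by apply: measurable_funD => //; exact: measurable_funM.
have mT (t : R) : measurable_fun setT (fun y : R => y + t * v).
  exact: measurable_funD.
have mh n : measurable_fun setT (h n).
  apply/measurable_EFinP; apply: measurable_funM.
    exact: (measurableT_comp (mI n) mS).
  exact: (measurableT_comp (mw n) measurable_snd).
(* The Lebesgue measure lives on the generated sigma-algebra [measurableTypeR R],
   which is convertible to that of [R]. *)
pose GR := measurableTypeR R.
have mh' n : measurable_fun (setT : set (GR * GR)) (h n : GR * GR -> \bar R).
  exact: mh.
pose F y := (\sum_(0 <= n <oo) \int[mu]_t h n (y, t))%E.
have Fn0 n y : (0 <= \int[mu]_t h n (y, t))%E by exact: integral_ge0.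
have mFn n : measurable_fun setT (fun y => \int[mu]_t h n (y, t))%E.
  exact (measurable_fun_fubini_tonelli_F (T1 := GR) (T2 := GR) (m2 := mu)
    (h n) (mh' n) (h0 n)).
have F0 y : (0 <= F y)%E by exact: nneseries_ge0.
have mF : measurable_fun setT F.
  by apply: ge0_emeasurable_sum => // n y _ _; exact: Fn0.
pose rhs := (\sum_(0 <= n <oo)
  \int[mu]_t ((beta n - alpha n) * w n t)%:E)%E.
have rhs0 : (0 <= rhs)%E.
  apply: nneseries_ge0 => n _ _; apply: integral_ge0 => t _.
  by rewrite lee_fin mulr_ge0// subr_ge0.
have mY : measurable (`[p, p + l]%classic : set R) by [].
have muY : mu `[p, p + l]%classic = l%:E.
  by rewrite lebesgue_measure_itv/= lte_fin ltrDl l0 -EFinB addrC addKr.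
have Fint : (\int[mu]_(y in `[p, (p + l)%R]) F y <= rhs)%E.
  rewrite integral_nneseries//; last first.
    by move=> n; apply: measurable_funTS; exact (mFn n).
  apply: lee_nneseries => [n _ _|n _]; first by apply: integral_ge0 => y _; exact: Fn0.
  apply: (@le_trans _ _ (\int[mu]_y \int[mu]_t h n (y, t))%E).
    apply: ge0_subset_integral => //; exact (mFn n).
  rewrite (fubini_tonelli (m1 := mu) (m2 := mu) (h n) (mh' n) (h0 n)).
  apply: ge0_le_integral => //.
  - by move=> t _; exact: integral_ge0.
  - exact (measurable_fun_fubini_tonelli_G (T1 := GR) (T2 := GR) (m1 := mu)
      (h n) (mh' n) (h0 n)).
  - apply/measurable_EFinP; exact (measurable_funM (measurable_cst _) (mw n)).
  - move=> t _; rewrite /h/=.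
    under eq_integral => y _ do rewrite EFinM muleC.
    rewrite ge0_integralZl_EFin//; last first.
      apply/measurable_EFinP.
      exact (measurableT_comp (mI n) (mT t)).
    rewrite (mulrC (beta n - alpha n)) [in leRHS]EFinM lee_wpmul2l ?lee_fin//.
    rewrite (_ : (fun y => _) =
        (fun y => (\1_`[(alpha n - t * v)%R, (beta n - t * v)%R] y)%:E)); last first.
      apply/funext => y; rewrite !indicE; congr (_%:R%:E); congr (nat_of_bool _).
      by apply/idP/idP; rewrite !inE/= !in_itv/= lerBlDr lerBrDr.
    rewrite integral_indic// setIT.
    have := mu_itv_le (lerB (ab n) (lexx (t * v : R))).
    by rewrite opprB addrA subrK; apply.
rewrite -/rhs; have [->|] := eqVneq rhs +oo%E.
  by exists p; rewrite lexx lerDl ltW// leey.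
rewrite -ltey -ge0_fin_numE// => rhsfin.
have muYb : (0 < mu `[p, (p + l)%R]%classic < +oo)%E.
  by rewrite muY lte_fin l0 ltey.
have c0 : 0 <= fine rhs / l by rewrite divr_ge0 ?fine_ge0// ltW.
have Fint' : (\int[mu]_(y in `[p, (p + l)%R]) F y <=
    (fine rhs / l)%:E * mu `[p, (p + l)%R]%classic)%E.
  by rewrite muY -EFinM divfK ?gt_eqF// fineK.
have mFY : measurable_fun `[p, p + l]%classic F by exact: measurable_funTS.
have [y Yy Fy] := @exists_le_average _ GR R mu `[p, p + l]%classic F (fine rhs / l)
  mY muYb mFY (fun y _ => F0 y) c0 Fint'.
exists y; split; first by move: Yy; rewrite /= in_itv.
by rewrite -(fineK rhsfin) muleC -lee_pdivlMr.
Qed.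

(** Choosing the coordinates of the starting point one after the other trades the
    sides of the boxes for indicators of these sides along the line. *)
Lemma select_point k (c : nat -> 'rV[R]_k * 'rV[R]_k) (v p : 'rV[R]_k)
    (l s : R) : 0 < l -> (forall n i, (c n).1 0 i <= (c n).2 0 i) ->
  exists2 y : 'rV[R]_k, forall i, p 0 i <= y 0 i <= p 0 i + l &
  ((l ^+ k)%:E * \sum_(0 <= n <oo) \int[mu]_t
     ((\prod_(i < k) \1_`[(c n).1 0 i, (c n).2 0 i] (y 0 i + t * v 0 i)) *
      \1_`[0%R, s] t)%:E <=
   \sum_(0 <= n <oo) \int[mu]_t (box_volume (c n) * \1_`[0%R, s] t)%:E)%E.
Proof.
move=> l0 cle.
pose fac n (y : 'rV[R]_k) (m : nat) (t : R) (i : 'I_k) : R := if (i < m)%N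
  then \1_`[(c n).1 0 i, (c n).2 0 i] (y 0 i + t * v 0 i)
  else (c n).2 0 i - (c n).1 0 i.
have fac0 n y m t i : 0 <= fac n y m t i.
  by rewrite /fac; case: (i < m)%N; rewrite ?subr_ge0.
have mfac n y m i : measurable_fun setT (fun t => fac n y m t i).
  rewrite /fac; case: (i < m)%N; last by [].
  have mI : measurable_fun setT (\1_`[(c n).1 0 i, (c n).2 0 i] : R -> R).
    exact: measurable_indic.
  apply: (measurableT_comp mI); apply: measurable_funD => //.
  exact: measurable_funM.
have step m : (m <= k)%N ->
    exists2 y : 'rV[R]_k, forall i, p 0 i <= y 0 i <= p 0 i + l &
    ((l ^+ m)%:E * \sum_(0 <= n <oo) \int[mu]_t
       ((\prod_(i < k) fac n y m t i) * \1_`[0%R, s] t)%:E <=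
     \sum_(0 <= n <oo) \int[mu]_t (box_volume (c n) * \1_`[0%R, s] t)%:E)%E.
  elim: m => [_|m IH mk].
    by exists p => [i|]; [rewrite lexx lerDl ltW|rewrite expr0 mul1e].
  have [y yp IHy] := IH (ltnW mk); pose i0 := Ordinal mk.
  pose w n t := (\prod_(i < k) if i != i0 then fac n y m t i else 1) *
    \1_`[0%R, s] t.
  have mw n : measurable_fun setT (w n).
    apply: measurable_funM; last exact: measurable_indic.
    by apply: measurable_prod => i _; case: (i != i0).
  have w0 n t : 0 <= w n t.
    by rewrite mulr_ge0// prodr_ge0// => i _; case: (i != i0).
  have [z [zp Hz]] := select_coordinate (v 0 i0) (p 0 i0) l0
    (fun n => cle n i0) mw w0.
  pose y' : 'rV[R]_k := \row_i (if i == i0 then z else y 0 i).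
  exists y' => [i|]; first by rewrite mxE; case: eqP => [->|_].
  apply: le_trans IHy; rewrite exprSr EFinM -muleA.
  apply: lee_wpmul2l; first by rewrite lee_fin exprn_ge0// ltW.
  apply: le_trans (le_trans _ Hz) _.
    apply: lee_wpmul2l; first by rewrite lee_fin ltW.
    apply: lee_nneseries => [n _ _|n _].
      by apply: integral_ge0 => t _; rewrite lee_fin mulr_ge0// prodr_ge0.
    rewrite le_eqVlt; apply/orP; left; apply/eqP; apply: eq_integral => t _.
    congr EFin; rewrite (bigD1 i0)//= /w -big_mkcond mulrA; congr (_ * _); congr (_ * _).
      by rewrite /fac /= ltnSn !mxE eqxx.
    apply: eq_bigr => i ii0; rewrite /fac !mxE (negbTE ii0) ltnS leq_eqVlt.
    by move: ii0; rewrite -val_eqE /= => /negbTE ->.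
  apply: lee_nneseries => [n _ _|n _].
    by apply: integral_ge0 => t _; rewrite lee_fin mulr_ge0// subr_ge0.
  rewrite le_eqVlt; apply/orP; left; apply/eqP; apply: eq_integral => t _.
  congr EFin; rewrite [in RHS](bigD1 i0)//= /w -big_mkcond mulrA; congr (_ * _ * _).
  by rewrite /fac ltnn.
have [y yp Hy] := step k (leqnn k); exists y => //; apply: le_trans Hy.
rewrite le_eqVlt; apply/orP; left; apply/eqP; congr (_ * _)%E.
apply: eq_eseriesr => n _; apply: eq_integral => t _; congr EFin; congr (_ * _).
by apply: eq_bigr => i _; rewrite /fac ltn_ord.
Qed.

(** Some line in direction [v] starting from the cube with corner [p] and side
    [l] meets [A] in a set no larger than the average over all such lines. *)
Lemma exists_good_line k (A : set 'rV[R]_k) (v p : 'rV[R]_k) (l s e : R) :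
  0 < l -> 0 <= s -> 0 < e -> (lebesgue_outer A < e%:E)%E ->
  exists2 y : 'rV[R]_k, forall i, p 0 i <= y 0 i <= p 0 i + l &
  exists V : set R, [/\ measurable V, V `<=` `[0, s],
    (forall t, 0 <= t <= s -> A (y + t *: v) -> V t) &
    ((l ^+ k)%:E * mu V <= (s * e)%:E)%E].
Proof.
move=> l0 s0 e0 Ae.
have [_ [c [cle Ac] <-] ce] : exists2 x, [set (\sum_(0 <= n <oo) (box_volume (c n))%:E)%E
            | c in [set c : ('rV[R]_k * 'rV[R]_k)^nat |
                     (forall n i, (c n).1 0 i <= (c n).2 0 i) /\
                     A `<=` \bigcup_n box (c n)]] x & (x < e%:E)%E.
  exact: ereal_inf_lt.
have [y yp Hy] := select_point v p s l0 cle.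
exists y => //.
pose g n t : R := (\prod_(i < k) \1_`[(c n).1 0 i, (c n).2 0 i] (y 0 i + t * v 0 i)) *
      \1_`[0%R, s] t.
have mg n : measurable_fun setT (g n).
  apply: measurable_funM; last exact: measurable_indic.
  apply: measurable_prod => i _.
  have mI : measurable_fun setT (\1_`[(c n).1 0 i, (c n).2 0 i] : R -> R).
    exact: measurable_indic.
  apply: (measurableT_comp mI); apply: measurable_funD => //.
  exact: measurable_funM.
pose V n := [set t | 0 <= t <= s /\ box (c n) (y + t *: v)].
have gE n : g n = \1_(V n).
  apply/funext => t; rewrite /g [RHS]indicE.
  have [Vt|nVt] := boolP (t \in V n).
    move: Vt; rewrite inE => -[ts bt].
    rewrite indicE mem_set//= ?in_itv//= mulr1 big1// => i _.
    by rewrite indicE mem_set//= in_itv/=; have := bt i; rewrite !mxE.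
  have [ts|ts] := boolP (0 <= t <= s); last first.
    by rewrite indicE memNset ?mulr0//= in_itv/=; exact/negP.
  have /existsNP[i bi] : ~ box (c n) (y + t *: v).
    by move=> bt; move: nVt; rewrite notin_setE; apply.
  rewrite (bigD1 i)//= indicE memNset ?mul0r//= in_itv/= => bi'; apply: bi.
  by rewrite !mxE.
have mV n : measurable (V n).
  rewrite (_ : V n = g n @^-1` [set 1%R]).
    by rewrite -[X in measurable X]setTI; apply: mg.
  apply/seteqP; rewrite gE; split => t /=; rewrite indicE.
    by move=> Vt; rewrite mem_set.
  by case: (boolP (t \in V n)) => [/set_mem//|_ /esym/eqP]; rewrite oner_eq0.
exists (\bigcup_n V n); split.
- exact: bigcup_measurable.
- by move=> t [n _ [ts _]]; rewrite /= in_itv.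
- by move=> t ts /Ac[n _ cn]; exists n.
apply: le_trans (_ : _ <= (l ^+ k)%:E * \sum_(0 <= n <oo) mu (V n))%E _.
  apply: lee_wpmul2l; first by rewrite lee_fin exprn_ge0// ltW.
  have mVU : measurable (\bigcup_n V n) by exact: bigcup_measurable.
  exact (measure_sigma_subadditive mu mV mVU (@subset_refl _ _)).
apply: le_trans (le_trans _ Hy) _.
  apply: lee_wpmul2l; first by rewrite lee_fin exprn_ge0// ltW.
  apply: lee_nneseries => // n _.
  under eq_integral => t _ do rewrite -/(g n t) gE.
  by rewrite int_indic.
rewrite EFinM (le_trans _ (lee_wpmul2l _ (ltW ce)))// ?lee_fin//.
rewrite -nneseriesZl; last by move=> n _; rewrite lee_fin prodr_ge0// => i _; rewrite subr_ge0.
apply: lee_nneseries => [n _ _|n _].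
  apply: integral_ge0 => t _; rewrite lee_fin mulr_ge0// prodr_ge0// => i _.
  by rewrite subr_ge0.
under eq_integral => t _ do rewrite EFinM.
rewrite ge0_integralZl_EFin//; last 2 first.
  by apply/measurable_EFinP; exact: measurable_indic.
  by rewrite prodr_ge0// => i _; rewrite subr_ge0.
rewrite int_indic// muleC.
apply: lee_wpmul2r; first by rewrite lee_fin prodr_ge0// => i _; rewrite subr_ge0.
by have := mu_itv_le s0; rewrite subr0; apply.
Qed.

End selection.

Lemma not_negligible_meets {R : realType} (W : set R) (a b : R) : measurable W ->
  (lebesgue_measure W < (b - a)%:E)%E -> exists2 t, a <= t <= b & ~ W t.
Proof.
move=> mW Wab; apply: contrapT => noT.
have abW : `[a, b]%classic `<=` W.
  by move=> t; rewrite /= in_itv/= => tab; apply: contrapT => nWt; apply: noT; exists t.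
have : (lebesgue_measure `[a, b]%classic <= lebesgue_measure W)%E by apply: le_measure; rewrite ?inE.
move=> /le_lt_trans/(_ Wab); rewrite lebesgue_measure_itv/= lte_fin.
case: ifPn => [_|]; first by rewrite -EFinB ltxx.
by rewrite -leNgt => ba; rewrite lte_fin subr_gt0 ltNge ba.
Qed.

(** * Lebesgue outer measure of boxes, cubes and open sets *)

Section row_norm.
Context {R : realType} {k : nat}.
Implicit Types (x y : 'rV[R]_k) (r : R).

Lemma row_norm_leP x r : 0 <= r -> reflect (forall i, `|x 0 i| <= r) (`|x| <= r).
Proof.
move=> r0; apply: (iffP idP) => [xr i|xr].
  apply: le_trans xr; rewrite [leRHS]/Num.Def.normr /= mx_normrE.
  by apply/bigmax_geP; right; exists (0, i).
rewrite [leLHS]/Num.Def.normr /= mx_normrE; apply/bigmax_leP; split => // -[a i] _ /=.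
by rewrite (ord1 a).
Qed.

Lemma coord_le_norm x i : `|x 0 i| <= `|x|.
Proof. by have /row_norm_leP : `|x| <= `|x| by []; apply. Qed.

Definition cube x r : set 'rV[R]_k := box (x - const_mx r, x + const_mx r).

Lemma cubeP x r y : cube x r y <-> forall i, `|y 0 i - x 0 i| <= r.
Proof.
split=> H i; have := H i; rewrite !mxE ?ler_norml /=; first by move=> /andP[? ?]; lra.
by move=> /andP[? ?]; apply/andP; split; lra.
Qed.

Lemma cube_normP x r y : 0 <= r -> cube x r y <-> `|y - x| <= r.
Proof.
move=> r0; split=> [/cubeP yx|/row_norm_leP yx].
  by apply/row_norm_leP => // i; rewrite !mxE; exact: yx.
by apply/cubeP => i; have := yx r0 i; rewrite !mxE.
Qed.

Lemma box_volume_cube x r : box_volume (x - const_mx r, x + const_mx r) = (r *+ 2) ^+ k.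
Proof.
rewrite /box_volume (eq_bigr (fun=> r *+ 2)) ?prodr_const ?card_ord// => i _.
by rewrite !mxE mulr2n; lra.
Qed.

End row_norm.

Section lebesgue_outer_theory.
Context {R : realType} {k' : nat}.
Local Notation k := k'.+1.
Local Notation V := 'rV[R]_k.
Local Notation leb := (@lebesgue_outer R k).
Implicit Types (A B : set V) (x y : V) (r : R).

Let proper_box (c : V * V) : Prop := forall i, c.1 0 i <= c.2 0 i.
Let vol (c : V * V) : \bar R := (box_volume c)%:E.

Let vol_ge0 c : proper_box c -> (0 <= vol c)%E.
Proof. by move=> c0; rewrite lee_fin prodr_ge0// => i _; rewrite subr_ge0. Qed.

Lemma lebesgue_outerE : leb = cover_inf proper_box vol box.
Proof. by []. Qed.

Let vol_point : vol (0, 0) = 0%E.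
Proof. by rewrite /vol /box_volume big_ord_recl !mxE subrr mul0r. Qed.

Let lebesgue_outer0 : leb set0 = 0%E.
Proof. by apply: (@cover_inf_set0 _ _ _ _ _ _ vol_ge0 (0, 0)) => // i; rewrite lexx. Qed.

Let lebesgue_outer_ge0 A : (0 <= leb A)%E.
Proof. exact: (cover_inf_ge0 box vol_ge0). Qed.

Let le_lebesgue_outer : {homo leb : A B / A `<=` B >-> (A <= B)%E}.
Proof. by move=> A B AB; rewrite lebesgue_outerE; exact: le_cover_inf. Qed.

Let lebesgue_outer_sigma_subadditive : sigma_subadditive leb.
Proof. exact: (cover_inf_subadditive box vol_ge0). Qed.

HB.instance Definition _ := isOuterMeasure.Build R V leb lebesgue_outer0
  lebesgue_outer_ge0 le_lebesgue_outer lebesgue_outer_sigma_subadditive.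

Lemma lebesgue_outer_box (c : V * V) A : (forall i, c.1 0 i <= c.2 0 i) ->
  A `<=` box c -> (leb A <= (box_volume c)%:E)%E.
Proof.
by move=> c0 Ac; apply: (@cover_inf1 _ _ _ _ _ _ vol_ge0 (0, 0)).
Qed.

Lemma lebesgue_outer_finite (J : finType) (F : J -> set V) (a : R) :
  (forall j, (leb (F j) <= a%:E)%E) ->
  (leb (\bigcup_j F j) <= (#|J|%:R * a)%:E)%E.
Proof.
by move=> Fa; apply: (@cover_inf_finite _ _ _ _ _ _ vol_ge0 (0, 0)).
Qed.

Lemma lebesgue_outer_cube_le x r A : 0 <= r -> A `<=` cube x r ->
  (leb A <= ((r *+ 2) ^+ k)%:E)%E.
Proof.
move=> r0 Ax; rewrite -(box_volume_cube x); apply: lebesgue_outer_box => // i.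
by rewrite !mxE /=; lra.
Qed.

(** The lower bound comes from lines in direction 0: those that start in the cube
    stay in it, whereas a smaller outer measure would make one of them miss it for
    some parameters. *)
Lemma lebesgue_outer_cube x r : 0 <= r -> leb (cube x r) = ((r *+ 2) ^+ k)%:E.
Proof.
move=> r0; apply/eqP; rewrite eq_le (lebesgue_outer_cube_le (x := x))//=.
have [r0E|r0'] := eqVneq 0 r.
  by rewrite -r0E mul0rn expr0n/= outer_measure_ge0.
have {}r0 : 0 < r by rewrite lt_neqAle r0'.
rewrite leNgt; apply/negP => lebx.
have lebfin : leb (cube x r) \is a fin_num.
  by rewrite ge0_fin_numE ?outer_measure_ge0// (lt_trans lebx)// ltry.
pose e := (fine (leb (cube x r)) + (r *+ 2) ^+ k) / 2.
have lebxr : fine (leb (cube x r)) < (r *+ 2) ^+ k by rewrite -lte_fin fineK.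
have e0 : 0 < e.
  by rewrite divr_gt0// ltr_wpDl ?fine_ge0 ?outer_measure_ge0// exprn_gt0// mulrn_wgt0.
have lebe : (leb (cube x r) < e%:E)%E by rewrite -(fineK lebfin) lte_fin /e; lra.
have r20 : 0 < r *+ 2 by rewrite mulrn_wgt0.
have [y yx [W [mW W01 AW lW]]] :=
  exists_good_line 0 (x - const_mx r) r20 ler01 e0 lebe.
have WE : W = `[0, 1]%classic.
  apply/seteqP; split => // t; rewrite /= in_itv => /= t01; apply: AW => //.
  rewrite scaler0 addr0; apply/cubeP => i; have := yx i; rewrite !mxE.
  by move=> /andP[? ?]; rewrite ler_norml; apply/andP; split; lra.
move: lW; rewrite WE lebesgue_measure_itv/= lte_fin ltr01 sube0 mule1 mul1r.
by rewrite lee_fin; apply/negP; rewrite -ltNge /e; lra.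
Qed.

Lemma box_volumeD1 i (c : V * V) : box_volume c =
  (c.2 0 i - c.1 0 i) * \prod_(j < k | j != i) (c.2 0 j - c.1 0 j).
Proof. by rewrite /box_volume (bigD1 i). Qed.

(** A half-space cuts every box into two boxes whose volumes add up. *)
Lemma measurable_halfspace i a : lebesgue_measurable [set x : V | x 0 i <= a].
Proof.
apply: le_caratheodory_measurable => X; set H := [set x | _].
suff : (leb (X `&` H) + leb (X `&` ~` H) <= leb X)%E by [].
have [->|Xoo] := eqVneq (leb X) +oo%E; first by rewrite leey.
apply/lee_addgt0Pr => e e0; have [|c [c0 Xc ce]] :=
  @cover_inf_approx R _ V proper_box vol box vol_ge0 X e e0.
  by rewrite -lebesgue_outerE ltey.
pose cut (n : nat) := Num.max ((c n).1 0 i) (Num.min a ((c n).2 0 i)).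
have cutP n : (c n).1 0 i <= cut n <= (c n).2 0 i.
  rewrite /cut le_max lexx/= ge_max ge_min lexx orbT andbT; exact: c0.
pose cl n := ((c n).1, \row_j (if j == i then cut n else (c n).2 0 j)).
pose cr n := (\row_j (if j == i then cut n else (c n).1 0 j), (c n).2).
have cl0 n : proper_box (cl n).
  move=> j; rewrite /cl/= mxE; case: eqP => [->|_]; last exact: c0.
  by have /andP[] := cutP n.
have cr0 n : proper_box (cr n).
  move=> j; rewrite /cr/= mxE; case: eqP => [->|_]; last exact: c0.
  by have /andP[] := cutP n.
have volE n : vol (c n) = (vol (cl n) + vol (cr n))%E.
  rewrite /vol -EFinD; congr EFin; rewrite !(box_volumeD1 i) /= !mxE eqxx.
  rewrite [X in _ = _ * X + _](eq_bigr (fun j => (c n).2 0 j - (c n).1 0 j)); last first.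
    by move=> j ji; rewrite mxE (negbTE ji).
  rewrite [X in _ = _ + _ * X](eq_bigr (fun j => (c n).2 0 j - (c n).1 0 j)); last first.
    by move=> j ji; rewrite mxE (negbTE ji).
  by rewrite -mulrDl; congr (_ * _); ring.
apply: le_trans ce; rewrite (eq_eseriesr (fun n _ => volE n)).
rewrite nneseriesD; [|by move=> n _ _; exact: vol_ge0..].
apply: leeD; [apply: (@cover_inf_le R _ V proper_box vol box _ cl cl0)
  |apply: (@cover_inf_le R _ V proper_box vol box _ cr cr0)].
  move=> x [/Xc[n _ cx] Hx]; exists n => // j; rewrite /cl/= mxE.
  have /andP[cx1 cx2] := cx j; case: eqP => [ji|_]; last by rewrite cx1 cx2.
  by rewrite cx1/= ji /cut le_max le_min -!ji cx2 ji Hx orbT.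
move=> x [/Xc[n _ cx] Hx]; exists n => // j; rewrite /cr/= mxE.
have /andP[cx1 cx2] := cx j; case: eqP => [ji|_]; last by rewrite cx1 cx2.
rewrite cx2 andbT ji /cut ge_max -!ji cx1 ge_min ji; apply/orP; left.
by rewrite ltW// ltNge; exact/negP.
Qed.

Lemma lebesgue_measurable_bigcap (I : Type) (F : I -> set V) (s : seq I) :
  (forall i, lebesgue_measurable (F i)) ->
  lebesgue_measurable (\big[setI/setT]_(i <- s) F i).
Proof.
move=> mF; elim/big_ind : _ => //.
  rewrite -setC0; apply: caratheodory_measurable_setC.
  exact: caratheodory_measurable_set0.
exact: caratheodory_measurable_setI.
Qed.

Lemma measurable_halfspace_ge i a : lebesgue_measurable [set x : V | a <= x 0 i].
Proof.
rewrite (_ : [set _ | _] = ~` \bigcup_n [set x : V | x 0 i <= a - n.+1%:R^-1]).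
  apply: caratheodory_measurable_setC; apply: caratheodory_measurable_bigcup => n.
  exact: measurable_halfspace.
apply/seteqP; split => x /=.
  move=> ax [n _ /=]; apply/negP; rewrite -ltNge; apply: lt_le_trans ax.
  by rewrite ltrBlDr ltrDl invr_gt0 ltr0n.
move=> nx; rewrite leNgt; apply/negP => xa; apply: nx.
have xa0 : 0 < a - x 0 i by rewrite subr_gt0.
have [n nx] := ltr_add_invr xa0; exists n => //=.
by rewrite add0r in nx; rewrite lerBrDr addrC -lerBrDr ltW.
Qed.

Lemma measurable_box (c : V * V) : lebesgue_measurable (box c).
Proof.
rewrite (_ : box c = \big[setI/setT]_(i <- index_enum 'I_k)
   ([set x : V | c.1 0 i <= x 0 i] `&` [set x | x 0 i <= c.2 0 i])).
  apply: lebesgue_measurable_bigcap => i; apply: caratheodory_measurable_setI.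
    exact: measurable_halfspace_ge.
  exact: measurable_halfspace.
rewrite -bigcap_seq; apply/seteqP; split => x H i /=.
  by move=> _; have /andP[] := H i.
by have [|-> ->] := H i; rewrite //= mem_index_enum.
Qed.

Lemma lebesgue_measurable_countable (I : countType) (F : I -> set V) :
  (forall i, lebesgue_measurable (F i)) -> lebesgue_measurable (\bigcup_i F i).
Proof.
move=> mF; rewrite (_ : \bigcup_i F i =
    \bigcup_n (if unpickle n is Some i then F i else set0)).
  apply: caratheodory_measurable_bigcup => n; case: unpickle => // .
  exact: caratheodory_measurable_set0.
apply/seteqP; split => [x [i _ Fx]|x [n _]].
  by exists (pickle i) => //; rewrite pickleK.
by case: unpickle => // i Fx; exists i.
Qed.

Lemma lebesgue_outer_countable (I : countType) (F : I -> set V) :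
  (forall i, leb (F i) = 0%E) -> leb (\bigcup_i F i) = 0%E.
Proof.
move=> F0; apply/eqP; rewrite eq_le outer_measure_ge0 andbT.
apply: (@le_trans _ _ (leb (\bigcup_n (if unpickle n is Some i then F i else set0)))).
  apply: le_outer_measure => x [i _ Fx].
  by exists (pickle i) => //; rewrite pickleK.
apply: (le_trans (outer_measure_sigma_subadditive _ _)).
rewrite eseries0// => n _ _; case: unpickle => [i|]; [exact: F0|].
exact: outer_measure0.
Qed.

Lemma lebesgue_outer_subset0 A B : A `<=` B -> leb B = 0%E -> leb A = 0%E.
Proof.
move=> AB B0; apply/eqP; rewrite eq_le outer_measure_ge0 andbT -B0.
exact: le_outer_measure.
Qed.

(** An open set is the union of the rational cubes that it contains. *)
Lemma measurable_open A : open A -> lebesgue_measurable A.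
Proof.
move=> oA; pose F (z : 'rV[rat]_k * nat) : set V :=
  [set x | cube (map_mx ratr z.1) z.2.+1%:R^-1 x /\
           cube (map_mx ratr z.1) z.2.+1%:R^-1 `<=` A].
rewrite (_ : A = \bigcup_z F z).
  apply: lebesgue_measurable_countable => z.
  have [zA|zA] := pselect (cube (map_mx ratr z.1) z.2.+1%:R^-1 `<=` A).
    rewrite (_ : F z = cube (map_mx ratr z.1) z.2.+1%:R^-1).
      exact: measurable_box.
    by apply/seteqP; split => x //= [].
  rewrite (_ : F z = set0); first exact: caratheodory_measurable_set0.
  by apply/seteqP; split => x //= [].
apply/seteqP; split => [x Ax|x [z _ [zx]]]; last by apply.
have /nbhs_ballP[e /= e0 xA] : nbhs x A by exact: open_nbhs_nbhs.
have e20 : 0 < e / 3 by rewrite divr_gt0.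
have [n ne] := ltr_add_invr e20; rewrite add0r in ne.
have n0 : 0 < n.+1%:R^-1 :> R by rewrite invr_gt0 ltr0n.
pose d : R := n.+1%:R^-1; rewrite -/d in ne n0.
have /choice[q qx] : forall i, exists q : rat, `|x 0 i - ratr q| <= d.
  move=> i; have [|q] := @rat_in_itvoo R (x 0 i - d) (x 0 i + d).
    lra.
  rewrite in_itv/= => /andP[q1 q2]; exists q.
  by rewrite ler_norml; apply/andP; split; lra.
exists (\row_i q i, n) => //; split => /=.
  by apply/cubeP => i; rewrite !mxE; exact: qx.
move=> y /cubeP yx; apply: xA; rewrite mx_norm_ball /ball_ /=.
apply: (@le_lt_trans _ _ (e / 3 + e / 3)); last lra.
apply/row_norm_leP => [|i]; first lra.
rewrite !mxE (le_trans (ler_distD (ratr (q i)) _ _))// lerD//.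
  exact: le_trans (qx i) (ltW ne).
by have := yx i; rewrite !mxE distrC => /le_trans; apply; exact: ltW.
Qed.

Lemma measurable_closed A : closed A -> lebesgue_measurable A.
Proof.
move=> cA; rewrite -(setCK A); apply: caratheodory_measurable_setC.
by apply: measurable_open; exact: closed_openC.
Qed.

End lebesgue_outer_theory.

(** * Covers by small cubes and outer regularity *)

Lemma prod_add_le (R : realFieldType) (I : Type) (s : seq I) (x : I -> R) :
  (forall i, 0 <= x i) -> exists2 C, 0 <= C & forall h, 0 <= h <= 1 ->
  \prod_(i <- s) (x i + h) <= \prod_(i <- s) x i + h * C.
Proof.
move=> x0; elim: s => [|i s [C C0 HC]].
  by exists 0 => // h _; rewrite !big_nil mulr0 addr0.
have P0 : 0 <= \prod_(j <- s) x j by exact: prodr_ge0.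
exists (\prod_(j <- s) x j + (x i + 1) * C) => [|h /andP[h0 h1]].
  by rewrite addr_ge0// mulr_ge0// addr_ge0.
rewrite !big_cons.
apply: (@le_trans _ _ ((x i + h) * (\prod_(j <- s) x j + h * C))).
  by rewrite ler_wpM2l ?addr_ge0// HC ?h0.
have : h * h * C <= h * C by rewrite -mulrA ler_piMl// mulr_ge0.
lra.
Qed.

Lemma prod_add_approx (R : realFieldType) (I : Type) (s : seq I) (x : I -> R) e :
  (forall i, 0 <= x i) -> 0 < e -> exists2 h0, 0 < h0 & forall h, 0 <= h <= h0 ->
  \prod_(i <- s) (x i + h) <= \prod_(i <- s) x i + e.
Proof.
move=> x0 e0; have [C C0 HC] := prod_add_le s x0.
exists (Num.min 1 (e / (C + 1))) => [|h].
  by rewrite lt_min ltr01/= divr_gt0// ltr_wpDl.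
rewrite le_min => /andP[h0 /andP[h1 he]].
apply: (le_trans (HC h _)); first by rewrite h0.
rewrite lerD2l; apply: (@le_trans _ _ (h * (C + 1))); first by rewrite ler_wpM2l// lerDl.
by rewrite -ler_pdivlMr// ltr_wpDl.
Qed.

Section cube_covers.
Context {R : realType} {k' : nat}.
Local Notation k := k'.+1.
Local Notation V := 'rV[R]_k.
Local Notation leb := (@lebesgue_outer R k).
Implicit Types (A B : set V) (x y : V) (r : R).

Section small_cubes.
Variable delta : R.
Hypothesis delta0 : 0 < delta.

Let P (z : V * R) : Prop := 0 <= z.2 <= delta.
Let tau (z : V * R) : \bar R := ((z.2 *+ 2) ^+ k)%:E.
Let S (z : V * R) := cube z.1 z.2.

Let tau_ge0 z : P z -> (0 <= tau z)%E.
Proof. by move=> /andP[z0 _]; rewrite lee_fin exprn_ge0// mulrn_wge0. Qed.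

(** A fine grid of equal cubes covers a box with an excess that tends to 0. *)
Let cube_content_box (c : V * V) : (forall i, c.1 0 i <= c.2 0 i) ->
  (cover_inf P tau S (box c) <= (box_volume c)%:E)%E.
Proof.
move=> c0; apply/lee_addgt0Pr => e e0.
have l0 i : 0 <= c.2 0 i - c.1 0 i by rewrite subr_ge0.
have [h0 h00 Hh] := prod_add_approx (index_enum 'I_k) l0 e0.
pose h := Num.min h0 delta.
have hp : 0 < h by rewrite lt_min h00.
pose m (i : 'I_k) := Num.truncn ((c.2 0 i - c.1 0 i) / h).
pose J := {dffun forall i : 'I_k, 'I_(m i).+1}.
pose ctr (p : J) : V := \row_i (c.1 0 i + (p i)%:R * h + h / 2).
apply: (@le_trans _ _ (cover_inf P tau S (\bigcup_p cube (ctr p) (h / 2)))).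
  apply: le_cover_inf => x cx.
  have xm (i : 'I_k) : (Num.truncn ((x 0 i - c.1 0 i) / h)%R < (m i).+1)%N.
    rewrite ltnS; apply: le_truncn; rewrite ler_pM2r ?invr_gt0// lerD2r.
    by have /andP[] := cx i.
  exists [ffun i => Ordinal (xm i)] => //; apply/cubeP => i; rewrite !mxE ffunE /=.
  have /andP[cx1 cx2] := cx i.
  have := @truncn_itv _ ((x 0 i - c.1 0 i) / h).
  rewrite divr_ge0 ?subr_ge0 ?(ltW hp)// => /(_ isT) /andP[].
  rewrite ler_pdivlMr// ltr_pdivrMr// -natr1 [(_ + 1) * h]mulrDl mul1r => t1 t2.
  rewrite ler_norml; apply/andP; split; lra.
have := @cover_inf_finite _ _ _ P tau S tau_ge0 (0, 0) _ _ J
  (fun p => cube (ctr p) (h / 2)) (h ^+ k).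
have -> : #|J| = (\prod_(i < k) (m i).+1)%N.
  rewrite card_dep_ffun foldrE big_map big_enum/=.
  by apply: eq_bigr => i _; rewrite card_ord.
have h2 : h / 2 *+ 2 = h by rewrite mulr2n -splitr.
move=> Hfin; apply: le_trans (Hfin _ _ _) _.
- by rewrite /P lexx ltW.
- by rewrite /tau /= mul0rn expr0n.
- move=> p; apply: (@le_trans _ _ (tau (ctr p, h / 2))); last by rewrite /tau /= h2.
  apply: (@cover_inf1 _ _ _ _ _ _ tau_ge0 (0, 0)) => //.
  + by rewrite /P lexx ltW.
  + by rewrite /tau /= mul0rn expr0n.
  + rewrite /P/= divr_ge0 ?(ltW hp)//=; apply: (@le_trans _ _ h); last by rewrite ge_min lexx orbT.
    by rewrite ler_pdivrMr// ler_peMr ?(ltW hp)// ler1n.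
rewrite -EFinD lee_fin; apply: le_trans (Hh h _); last by rewrite (ltW hp) ge_min lexx.
rewrite natr_prod -[X in _ * h ^+ X](card_ord k) -prodr_const -big_split/=.
apply: ler_prod => i _; rewrite mulr_ge0 ?(ltW hp)//= -natr1 mulrDl mul1r lerD2r.
by rewrite -ler_pdivlMr// truncn_le divr_ge0// ltW.
Qed.

(** Covers by arbitrary boxes can be refined to covers by small cubes, to which
    estimates at a single scale [r] apply. *)
Lemma small_cube_cover A e : (leb A < e%:E)%E ->
  exists c : nat -> V * R, [/\ forall n, 0 <= (c n).2 <= delta,
    A `<=` \bigcup_n cube (c n).1 (c n).2 &
    (\sum_(0 <= n <oo) (((c n).2 *+ 2) ^+ k)%:E < e%:E)%E].
Proof.
move=> Ae; have le_leb : (cover_inf P tau S A <= leb A)%E.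
  rewrite lebesgue_outerE; apply: le_cover_inf_sub.
  - by move=> B C BC; exact: le_cover_inf.
  - exact: (cover_inf_subadditive S tau_ge0).
  - by move=> B; exact: (cover_inf_ge0 S tau_ge0).
  - exact: cube_content_box.
have [_ [c [Pc Ac] <-] ce] := ereal_inf_lt (le_lt_trans le_leb Ae).
by exists c.
Qed.

End small_cubes.

Lemma lebesgue_outer_setD A B : (leb B < +oo)%E -> A `<=` B ->
  lebesgue_measurable A -> (leb (B `\` A) = leb B - leb A)%E.
Proof.
move=> Boo AB mA; have := mA B; rewrite (setIidr AB) -setDE => ->.
rewrite addeAC subee ?add0e// ge0_fin_numE ?outer_measure_ge0//.
exact: le_lt_trans (le_outer_measure _ _ _ AB) Boo.
Qed.

Lemma outer_regular_fin A e : (leb A < +oo)%E -> 0 < e ->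
  lebesgue_measurable A ->
  exists U, [/\ open U, A `<=` U & (leb (U `\` A) <= e%:E)%E].
Proof.
move=> Aoo e0 mA.
have Afin : leb A \is a fin_num by rewrite ge0_fin_numE// outer_measure_ge0.
have e20 : 0 < e / 2 by rewrite divr_gt0.
have Ae : (leb A < (fine (leb A) + e / 2)%:E)%E.
  by rewrite EFinD fineK// lteDl.
have [c [c0 Ac ce]] := small_cube_cover ltr01 Ae.
have /choice[h Hh] : forall n, exists h, 0 < h /\
    (((c n).2 + h) *+ 2) ^+ k <= ((c n).2 *+ 2) ^+ k + e / 2 / (2 ^ n.+1)%:R.
  move=> n; have en : 0 < e / 2 / (2 ^ n.+1)%:R by rewrite divr_gt0// ltr0n expn_gt0.
  have cn0 (i : 'I_k) : 0 <= (c n).2 *+ 2 by rewrite mulrn_wge0//; have /andP[] := c0 n.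
  have [h0 h00 /(_ h0)] := prod_add_approx (index_enum 'I_k) cn0 en.
  rewrite ltW// lexx !prodr_const !card_ord => /(_ isT) Hn.
  exists (h0 / 2); split; first by rewrite divr_gt0.
  by rewrite mulrnDl -[_ / 2 *+ 2]mulr_natr divfK.
exists (\bigcup_n ball (c n).1 ((c n).2 + h n)).
have AU : A `<=` \bigcup_n ball (c n).1 ((c n).2 + h n).
  move=> x /Ac[n _]; have /andP[cn0 _] := c0 n; move=> /cube_normP xc.
  exists n => //; rewrite mx_norm_ball /ball_ /= distrC.
  by apply: le_lt_trans (xc _) _ => //; rewrite ltrDl; have [] := Hh n.
split => //.
  by apply: bigcup_open => n _; apply: ball_open; have [? _] := Hh n;
    rewrite ltr_wpDl//; have /andP[] := c0 n.
have Ule : (leb (\bigcup_n ball (c n).1 ((c n).2 + h n)) <= leb A + e%:E)%E.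
  apply: (le_trans (outer_measure_sigma_subadditive _ _)).
  apply: (@le_trans _ _ (\sum_(0 <= n <oo) ((((c n).2 *+ 2) ^+ k)%:E +
      (e / 2 / (2 ^ n.+1)%:R)%:E))%E).
    apply: lee_nneseries => [n _ _|n _]; first exact: outer_measure_ge0.
    rewrite -EFinD; apply: (@le_trans _ _ (((((c n).2 + h n) *+ 2) ^+ k)%:E)); last first.
      by rewrite lee_fin; have [] := Hh n.
    have h0 : 0 <= (c n).2 + h n.
      by rewrite addr_ge0//; [have /andP[] := c0 n|have [/ltW] := Hh n].
    apply: (lebesgue_outer_cube_le (x := (c n).1)) => // x.
    rewrite mx_norm_ball /ball_ /= => xc; apply/cube_normP => //.
    by rewrite distrC ltW.
  apply: (le_trans (epsilon_trick _ _ _)).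
  - by move=> n; rewrite lee_fin exprn_ge0// mulrn_wge0//; have /andP[] := c0 n.
  - exact: ltW.
  have -> : (e%:E = (e / 2)%:E + (e / 2)%:E)%E by rewrite -EFinD -splitr.
  rewrite addeA leeD2r//.
  by apply: (le_trans (ltW ce)); rewrite EFinD fineK.
rewrite lebesgue_outer_setD//.
  by rewrite leeBlDr// addeC.
by apply: le_lt_trans Ule _; rewrite lte_add_pinfty// ltry.
Qed.

Lemma outer_regular A e : 0 < e -> lebesgue_measurable A ->
  exists U, [/\ open U, A `<=` U & (leb (U `\` A) <= e%:E)%E].
Proof.
move=> e0 mA; pose An n := A `&` cube 0 n%:R.
have mAn n : lebesgue_measurable (An n).
  by apply: caratheodory_measurable_setI => //; exact: measurable_box.
have /choice[U HU] : forall n, exists U, [/\ open U, An n `<=` U &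
    (leb (U `\` An n) <= (e / (2 ^ n.+1)%:R)%:E)%E].
  move=> n; apply: outer_regular_fin => //; last by rewrite divr_gt0// ltr0n expn_gt0.
  apply: (@le_lt_trans _ _ (((n%:R : R) *+ 2) ^+ k)%:E); last exact: ltry.
  by apply: (lebesgue_outer_cube_le (x := 0)) => // x [].
exists (\bigcup_n U n); split.
- by apply: bigcup_open => n _; have [] := HU n.
- move=> x Ax; exists (Num.truncn `|x|).+1 => //.
  have [_ + _] := HU (Num.truncn `|x|).+1; apply; split => //.
  by apply/cube_normP => //; rewrite subr0 ltW// truncnS_gt.
apply: (@le_trans _ _ (leb (\bigcup_n (U n `\` An n)))).
  apply: le_outer_measure => x [[n _ Ux] nAx]; exists n => //; split => //.
  by move=> [].
apply: (le_trans (outer_measure_sigma_subadditive _ _)).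
apply: (@le_trans _ _ (\sum_(0 <= n <oo) (0%:E + (e / (2 ^ n.+1)%:R)%:E))%E).
  apply: lee_nneseries => [n _ _|n _]; first exact: outer_measure_ge0.
  by rewrite add0e; have [] := HU n.
apply: (le_trans (epsilon_trick _ _ (ltW e0))) => //.
by rewrite eseries0// add0e.
Qed.

End cube_covers.

(** * Density points *)

Section dyadic_cells.
Context {R : realType} {k' : nat}.
Local Notation k := k'.+1.
Local Notation V := 'rV[R]_k.
Local Notation leb := (@lebesgue_outer R k).
Implicit Types (z : nat * 'rV[int]_k) (x y : V).

Definition dyadic_cell z : set V :=
  [set x | forall i, Num.floor (2 ^+ z.1 * x 0 i) = z.2 0 i].

Definition dyadic_center z : V := \row_i (((z.2 0 i)%:~R + 2^-1) / 2 ^+ z.1).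

Let pow2_gt0 n : 0 < 2 ^+ n :> R. Proof. exact: exprn_gt0. Qed.

Lemma measurable_dyadic_cell z : lebesgue_measurable (dyadic_cell z).
Proof.
rewrite (_ : dyadic_cell z = \big[setI/setT]_(i <- index_enum 'I_k)
   ([set x : V | (z.2 0 i)%:~R / 2 ^+ z.1 <= x 0 i] `&`
    ~` [set x | (z.2 0 i + 1)%:~R / 2 ^+ z.1 <= x 0 i])).
  apply: lebesgue_measurable_bigcap => i; apply: caratheodory_measurable_setI.
    exact: measurable_halfspace_ge.
  by apply: caratheodory_measurable_setC; exact: measurable_halfspace_ge.
have E (a : R) (q : int) (n : nat) : (Num.floor (2 ^+ n * a) = q) <->
    q%:~R / 2 ^+ n <= a /\ ~ (q + 1)%:~R / 2 ^+ n <= a.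
  rewrite !ler_pdivrMr// [a * _]mulrC; split => [<-|[qa /negP]].
    by have /andP[-> /lt_geF ->] := floor_itv (2 ^+ n * a).
  by rewrite -ltNge => aq; apply: floor_def; rewrite qa.
rewrite -bigcap_seq; apply/seteqP; split => x H i /=.
  by move=> _; apply/E; exact: H.
by apply/E; apply: H; rewrite //= mem_index_enum.
Qed.

Let int_near (p q : int) : (q - 1 < p + 1)%R -> (p - 1 < q + 1)%R ->
  (absz (p - q + 1)%R < 3)%N /\ (0 <= p - q + 1)%R.
Proof. lia. Qed.

Lemma floor_near (a b : R) : `|a - b| <= 1 ->
  (absz (Num.floor a - Num.floor b + 1)%R < 3)%N /\
  (0 <= Num.floor a - Num.floor b + 1)%R.
Proof.
have /andP[a1 a2] := floor_itv a; have /andP[b1 b2] := floor_itv b.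
rewrite ler_norml => /andP[ab1 ab2]; rewrite !intrD in a2 b2.
by apply: int_near; rewrite -(ltr_int R) intrB intrD; lra.
Qed.

(** Coarser dyadic indices are functions of finer ones. *)
Lemma dyadic_floor_coarsen (a b : R) m n : (m <= n)%N ->
  Num.floor (2 ^+ n * a) = Num.floor (2 ^+ n * b) ->
  Num.floor (2 ^+ m * a) = Num.floor (2 ^+ m * b).
Proof.
move=> /subnKC <-; elim: (n - m)%N => [|j IH]; first by rewrite addn0.
rewrite addnS exprS => H; apply: IH; move: H; rewrite -!mulrA.
move: (2 ^+ _ * a) (2 ^+ _ * b) => {}a {}b.
wlog ab : a b / Num.floor a <= Num.floor b.
  move=> H abE; have [|/ltW] := leP (Num.floor a) (Num.floor b); first by move/H; apply.
  by move/H => /(_ (esym abE)).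
move=> abE; apply/eqP; rewrite eq_le ab /= leNgt; apply/negP => ltab.
have /andP[_ a2] := floor_itv a; have /andP[b1 _] := floor_itv b.
have {}ltab : (Num.floor a + 1)%:~R <= (Num.floor b)%:~R :> R.
  by rewrite ler_int lezD1.
have /andP[_] := floor_itv (2 * a); rewrite abE.
have : (2 * Num.floor b <= Num.floor (2 * b))%R.
  by rewrite floor_ge_int intrM ler_pM2l.
have : (Num.floor (2 * a) < 2 * (Num.floor a + 1))%R.
  by rewrite floor_lt_int intrM ltr_pM2l.
rewrite abE => h1 h2; have := le_lt_trans h2 h1.
rewrite ltr_pM2l// => h3.
by move: ltab; rewrite ler_int leNgt h3.
Qed.

Lemma dyadic_cell_nested z z' x : (z'.1 <= z.1)%N ->
  dyadic_cell z x -> dyadic_cell z' x -> dyadic_cell z `<=` dyadic_cell z'.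
Proof.
move=> zz' zx z'x y zy i; rewrite -(z'x i); apply: (dyadic_floor_coarsen zz').
by rewrite zx zy.
Qed.

Lemma dyadic_cell_sub z : dyadic_cell z `<=` cube (dyadic_center z) (2^-1 / 2 ^+ z.1).
Proof.
move=> x zx; apply/cubeP => i; rewrite !mxE -(zx i).
have /andP[] := floor_itv (2 ^+ z.1 * x 0 i).
rewrite intrD; set F := (Num.floor _)%:~R => h1 h2.
have P0 := pow2_gt0 z.1.
have -> : x 0 i - (F + 2^-1) / 2 ^+ z.1 = (2 ^+ z.1 * x 0 i - F - 2^-1) / 2 ^+ z.1.
  by field; rewrite gt_eqF.
rewrite normrM [X in _ * X]gtr0_norm ?invr_gt0// ler_pM2r ?invr_gt0//.
rewrite ler_norml; apply/andP; split; lra.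
Qed.

Lemma dyadic_center_in z : dyadic_cell z (dyadic_center z).
Proof.
move=> i; rewrite mxE mulrCA divff ?gt_eqF// mulr1; apply: floor_def.
by rewrite intrD; apply/andP; split; lra.
Qed.

End dyadic_cells.

Section density.
Context {R : realType} {k' : nat}.
Local Notation k := k'.+1.
Local Notation V := 'rV[R]_k.
Local Notation leb := (@lebesgue_outer R k).
Implicit Types (A B : set V) (x y : V) (r c : R).

(** Density with respect to centred cubes, with the measure of the complement
    so that no quotient appears. *)
Definition cube_density_point A x := forall c, 0 < c ->
  exists2 r0, 0 < r0 & forall r, 0 < r < r0 ->
    (leb (cube x r `\` A) <= (c * r ^+ k)%:E)%E.

Let low_density A c : set V := [set x | A x /\ forall r0, 0 < r0 ->
  exists2 r, 0 < r < r0 & ((c * r ^+ k)%:E < leb (cube x r `\` A))%E].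

(** The cells in which the complement of [A] is not small, and which lie in an
    open [U] barely larger than [A], have small total measure since the maximal
    ones are disjoint; the points of low density lie close to them. *)
Let low_density_null A c : lebesgue_measurable A -> 0 < c ->
  leb (low_density A c) = 0%E.
Proof.
move=> mA c0; apply/eqP; rewrite eq_le outer_measure_ge0 andbT.
apply/lee_addgt0Pr => e e0; rewrite add0e.
(* a cube of radius [r] is covered by [3 ^ k] cells of side less than [2 * r], so
   one of these cells has a share [c'] of the defect *)
pose c' := c / 6 ^+ k.
have c'0 : 0 < c' by rewrite divr_gt0// exprn_gt0.
pose d := e * c' / 4 ^+ k.
have d0 : 0 < d by rewrite divr_gt0// ?mulr_gt0// exprn_gt0.
have [U [oU AU UAd]] := outer_regular d0 mA.
pose side (z : nat * 'rV[int]_k) : R := (2 ^+ z.1)^-1.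
have side0 z : 0 < side z by rewrite invr_gt0 exprn_gt0.
pose bad (z : nat * 'rV[int]_k) := dyadic_cell z `<=` U /\
  ((c' * side z ^+ k)%:E < leb (dyadic_cell z `\` A))%E.
pose maxbad (z : nat * 'rV[int]_k) := bad z /\ forall z', bad z' -> (z'.1 < z.1)%N ->
  dyadic_cell z `&` dyadic_cell z' = set0 :> set V.
have bad_max z : bad z -> exists z', [/\ maxbad z', (z'.1 <= z.1)%N &
    (dyadic_cell z : set V) `<=` dyadic_cell z'].
  move=> zbad; pose P n := `[< exists z', [/\ bad z', z'.1 = n, (n <= z.1)%N &
    (dyadic_cell z : set V) `<=` dyadic_cell z'] >].
  have exP : exists n, P n.
    by exists z.1; apply/asboolP; exists z; split => //; exact: subset_refl.
  have [n /asboolP[z' [z'bad z'n nz zz']] nmin] := ex_minnP exP.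
  exists z'; split; [split => //|by rewrite z'n|by []] => z'' z''bad ltz''.
  rewrite -subset0 => x [z'x z''x].
  have : P z''.1.
    apply/asboolP; exists z''; split => //.
      by apply: leq_trans nz; rewrite -z'n ltnW.
    apply: subset_trans zz' _; apply: dyadic_cell_nested z'x z''x; exact: ltnW.
  by move/nmin; rewrite leqNgt -z'n ltz''.
pose T (z : nat * 'rV[int]_k) := cube (dyadic_center z) (2 * side z) : set V.
pose G n : set V := if pickle_inv n is Some z then
  if `[< maxbad z >] then dyadic_cell z else set0 else set0.
pose H n : set V := if pickle_inv n is Some z then
  if `[< maxbad z >] then T z else set0 else set0.
have BH : low_density A c `<=` \bigcup_n H n.
  move=> x [Ax xlow].
  have /nbhs_ballP[r0 /= r00 xU] : nbhs x U by apply: open_nbhs_nbhs; split => //; exact: AU.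
  have m0 : 0 < Num.min 1 (r0 / 4) by rewrite lt_min ltr01 divr_gt0.
  have [r /andP[r_gt0]] := xlow _ m0; rewrite lt_min => /andP[r1 rr0] xr.
  have [n rn nr] : exists2 n, r <= (2 ^+ n)^-1 & (2 ^+ n)^-1 < 2 * r.
    pose Q n := (2 ^+ n)^-1 < r.
    have exQ : exists n, Q n.
      exists (Num.truncn r^-1).+1; rewrite /Q invf_plt ?posrE ?exprn_gt0//.
      apply: lt_trans (truncnS_gt _) _.
      by rewrite -natrX ltr_nat ltn_expl.
    have [[|n] Qn nmin] := ex_minnP exQ.
      by move: Qn; rewrite /Q expr0 invr1 ltNge (ltW r1).
    exists n; first by rewrite leNgt; apply/negP => /nmin; rewrite ltnn.
    move: Qn; rewrite /Q exprS invfM; set t := (2 ^+ n)^-1; lra.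
  pose q : 'rV[int]_k := \row_i Num.floor (2 ^+ n * x 0 i).
  pose w (u : {ffun 'I_k -> 'I_3}) : nat * 'rV[int]_k :=
    (n, \row_i (q 0 i + (u i)%:Z - 1)).
  have sidew u : side (w u) = (2 ^+ n)^-1 by [].
  have cubeU : cube x r `<=` \bigcup_u dyadic_cell (w u).
    move=> y /cubeP yx.
    have yxn i : `|2 ^+ n * y 0 i - 2 ^+ n * x 0 i| <= 1.
      rewrite -mulrBr normrM gtr0_norm ?exprn_gt0// mulrC -ler_pdivlMr ?exprn_gt0//.
      by rewrite div1r (le_trans (yx i)).
    have ub (i : 'I_k) : (absz (Num.floor (2 ^+ n * y 0 i) - Num.floor (2 ^+ n * x 0 i) + 1)%R
        < 3)%N /\ (0 <= Num.floor (2 ^+ n * y 0 i) - Num.floor (2 ^+ n * x 0 i) + 1)%R.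
      exact: floor_near.
    exists [ffun i => Ordinal (ub i).1] => //= i; rewrite !mxE ffunE /=.
    by have [_ u0] := ub i; rewrite gez0_abs// addrA addrK addrC subrK.
  have [u ubad] : exists u, ((c' * side (w u) ^+ k)%:E < leb (dyadic_cell (w u) `\` A))%E.
    apply: contrapT => /forallNP nou.
    have {}nou u : (leb (dyadic_cell (w u) `\` A) <= (c' * (2 ^+ n)^-1 ^+ k)%:E)%E.
      by rewrite leNgt; apply/negP; exact: nou.
    move: xr; apply/negP; rewrite -leNgt.
    apply: (@le_trans _ _ (leb (\bigcup_u (dyadic_cell (w u) `\` A)))).
      by apply: le_outer_measure => y [/cubeU[u _ wy] nAy]; exists u.
    apply: (le_trans (lebesgue_outer_finite nou)).
    rewrite card_ffun !card_ord lee_fin /c' natrX.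
    apply: (@le_trans _ _ (3 ^+ k * (c / 6 ^+ k * (2 * r) ^+ k))).
      rewrite ler_pM2l ?exprn_gt0// ler_pM2l ?c'0//.
      have r20 : 0 <= 2 * r by rewrite mulr_ge0// ltW.
      by apply: lerXn2r; rewrite ?nnegrE ?invr_ge0 ?exprn_ge0// ltW.
    rewrite [6](_ : _ = 3 * 2) ?exprMn; last by rewrite -natrM.
    rewrite le_eqVlt; apply/orP; left; apply/eqP.
    by field; rewrite !gt_eqF ?exprn_gt0.
  have xw i : `|x 0 i - dyadic_center (w u) 0 i| <= 3 / 2 * (2 ^+ n)^-1.
    have P0 : 0 < 2 ^+ n :> R by exact: exprn_gt0.
    rewrite !mxE /= intrB intrD.
    have /andP[] := floor_itv (2 ^+ n * x 0 i).
    rewrite intrD; set F := (Num.floor _)%:~R => h1 h2.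
    have : (u i <= 2)%N by rewrite -ltnS.
    rewrite -(ler_nat R) => u2; have u0 : 0 <= (u i)%:R :> R by [].
    rewrite -pmulrn.
    have -> : x 0 i - (F + (u i)%:R - 1%:~R + 2^-1) / 2 ^+ n =
        (2 ^+ n * x 0 i - F - (u i)%:R + 1 / 2) / 2 ^+ n.
      by field; rewrite gt_eqF.
    rewrite normrM [X in _ * X <= _]gtr0_norm ?invr_gt0// ler_pM2r ?invr_gt0//.
    rewrite ler_norml; apply/andP; split; lra.
  have wU : dyadic_cell (w u) `<=` U.
    move=> y /dyadic_cell_sub/cubeP yw; apply: xU; rewrite mx_norm_ball /ball_ /=.
    apply: (@le_lt_trans _ _ (2 * (2 ^+ n)^-1)); last first.
      by move: nr rr0; set t := (2 ^+ n)^-1; lra.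
    apply/row_norm_leP => [|i]; first by rewrite mulr_ge0// invr_ge0 exprn_ge0.
    rewrite mxE [(- y) _ _]mxE.
    apply: le_trans (ler_distD (dyadic_center (w u) 0 i) _ _) _.
    rewrite [X in _ + X]distrC; have := yw i; have := xw i => /=.
    set t := (2 ^+ n)^-1; lra.
  have [z' [z'max z'w wz']] := bad_max _ (conj wU ubad).
  exists (pickle z') => //; rewrite /H pickleK_inv asboolT//.
  apply/cubeP => i.
  apply: le_trans (ler_distD (dyadic_center (w u) 0 i) _ _) _.
  have /cubeP/(_ i) := dyadic_cell_sub (wz' _ (dyadic_center_in (w u))).
  have := xw i; rewrite /side.
  have : (2 ^+ n)^-1 <= (2 ^+ z'.1)^-1 :> R.
    by rewrite lef_pV2 ?posrE ?exprn_gt0// ler_eXn2l// ltr1n.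
  set t := (2 ^+ n)^-1; set t' := (2 ^+ z'.1)^-1; lra.
have mG n : lebesgue_measurable (G n).
  rewrite /G; case: pickle_inv => [z|]; last exact: caratheodory_measurable_set0.
  case: ifP => _; first exact: measurable_dyadic_cell.
  exact: caratheodory_measurable_set0.
have tG : trivIset setT G.
  apply/trivIsetP => m n _ _ mn; rewrite /G.
  case Em : (pickle_inv m : option (nat * 'rV[int]_k)) => [z|]; last by rewrite set0I.
  case En : (pickle_inv n : option (nat * 'rV[int]_k)) => [z'|]; last by rewrite setI0.
  case: ifPn => [/asboolP[zbad zmax]|_]; last by rewrite set0I.
  case: ifPn => [/asboolP[z'bad z'max]|_]; last by rewrite setI0.
  have [zz'|z'z|zz'] := ltngtP z.1 z'.1.
  - by rewrite setIC; exact: z'max.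
  - exact: zmax.
  - rewrite -subset0 => x [zx z'x]; case/eqP: mn.
    suff zE : z = z'.
      have mE : pickle z = m by have := @pickle_invK (nat * 'rV[int]_k)%type m; rewrite Em.
      have nE : pickle z' = n by have := @pickle_invK (nat * 'rV[int]_k)%type n; rewrite En.
      by rewrite -mE -nE zE.
    rewrite [z]surjective_pairing [z']surjective_pairing -zz'; congr pair.
    by apply/rowP => i; rewrite -(zx i) -(z'x i) zz'.
have C0 : 0 < 4 ^+ k / c' by rewrite divr_gt0// exprn_gt0.
apply: le_trans (le_outer_measure _ _ _ BH) _.
apply: (le_trans (outer_measure_sigma_subadditive _ _)).
apply: (@le_trans _ _ ((4 ^+ k / c')%:E *
    \sum_(0 <= n <oo) leb ((U `\` A) `&` G n))%E); last first.
  apply: (@le_trans _ _ ((4 ^+ k / c')%:E * d%:E)%E); last first.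
    rewrite -EFinM lee_fin /d le_eqVlt; apply/orP; left; apply/eqP.
    by field; rewrite gt_eqF// gt_eqF// exprn_gt0.
  apply: lee_wpmul2l; first by rewrite lee_fin ltW.
  apply: le_trans UAd; apply: le_trans (caratheodory_lime_le mG tG _).
  by rewrite leeDl// outer_measure_ge0.
rewrite -nneseriesZl; last by move=> n _; exact: outer_measure_ge0.
apply: lee_nneseries => [n _ _|n _]; first exact: outer_measure_ge0.
rewrite /H /G; case: pickle_inv => [z|]; last by rewrite setI0 !outer_measure0 mule0.
case: ifPn => [/asboolP[[zU zbad] _]|_]; last by rewrite setI0 !outer_measure0 mule0.
have -> : (U `\` A) `&` dyadic_cell z = dyadic_cell z `\` A.
  apply/seteqP; split => y [] => [[_ nA] zy//|zy nA]; split => //; split => //.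
  exact: zU.
apply: (@le_trans _ _ ((4 ^+ k / c')%:E * (c' * side z ^+ k)%:E)%E).
  have := @lebesgue_outer_cube_le _ _ (dyadic_center z) (2 * side z) (T z).
  move=> /(_ _ _)/le_trans; apply => //; first by rewrite mulr_ge0// ltW.
  rewrite -EFinM lee_fin mulrA divfK ?gt_eqF// -exprMn -[_ *+ 2]mulr_natr mulrAC.
  by rewrite -natrM.
by apply: lee_wpmul2l; [rewrite lee_fin ltW|exact: ltW].
Qed.

(** Lebesgue's density theorem for cubes: a failure of density has a rate, and
    countably many rates suffice. *)
Lemma cube_density_ae A : lebesgue_measurable A ->
  leb [set x | A x /\ ~ cube_density_point A x] = 0%E.
Proof.
move=> mA; apply: (@lebesgue_outer_subset0 _ _ _ (\bigcup_n low_density A n.+1%:R^-1)).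
  move=> x [Ax] /existsNP[c /not_implyP[c0 nx]].
  have [n nc] := ltr_add_invr c0; rewrite add0r in nc.
  exists n => //; split => // r0 r00; apply: contrapT => H; apply: nx.
  exists r0 => // r rr0; rewrite leNgt; apply/negP => cr; apply: H; exists r => //.
  apply: le_lt_trans cr; rewrite lee_fin ler_wpM2r ?exprn_ge0 ?(ltW nc)//.
  by have /andP[/ltW] := rr0.
by apply: lebesgue_outer_countable => n; apply: low_density_null.
Qed.

End density.

(** * Hausdorff measure zero and Lipschitz maps *)

Section hausdorff_theory.
Context {R : realType} {X : metricType R}.
Implicit Types (A U : set X) (k : nat) (delta D : R).
Local Open Scope ereal_scope.

Lemma diameter_ge0 U : 0 <= diameter U.
Proof. by apply: ereal_sup_ubound; left. Qed.

Lemma diameter_le U D : (0 <= D)%R ->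
  (forall x y, U x -> U y -> (mdist x y <= D)%R) -> diameter U <= D%:E.
Proof.
move=> D0 UD; apply: ge_ereal_sup => _ [->|[[x y] [/= Ux Uy] <-]].
  by rewrite lee_fin.
by rewrite lee_fin; exact: UD.
Qed.

Lemma mdist_le_diameter U x y : U x -> U y -> (mdist x y)%:E <= diameter U.
Proof. by move=> Ux Uy; apply: ereal_sup_ubound; right; exists (x, y). Qed.

Lemma diameter0 : diameter (set0 : set X) = 0.
Proof. by apply/eqP; rewrite eq_le diameter_ge0 andbT; apply: diameter_le. Qed.

Lemma diameter_exp_le U D k : diameter U <= D%:E -> diameter U ^+ k <= (D ^+ k)%:E.
Proof.
move=> UD; have : diameter U \is a fin_num.
  by rewrite ge0_fin_numE ?diameter_ge0// (le_lt_trans UD) ?ltry.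
move/fineK => UE; rewrite -UE -EFin_expe lee_fin; apply: lerXn2r.
- by rewrite nnegrE -lee_fin UE diameter_ge0.
- by rewrite nnegrE -lee_fin (le_trans _ UD)// diameter_ge0.
- by rewrite -lee_fin UE.
Qed.

Let small delta (U : set X) : Prop := diameter U <= delta%:E.
Let power k (U : set X) : \bar R := diameter U ^+ k.

Let power_ge0 k delta U : small delta U -> 0 <= power k U.
Proof. by move=> _; rewrite expe_ge0// diameter_ge0. Qed.

Lemma hausdorff_contentE k delta :
  hausdorff_content k delta = cover_inf (small delta) (power k) id.
Proof. by []. Qed.

Lemma hausdorff_content_ge0 k delta A : 0 <= hausdorff_content k delta A.
Proof. exact: (cover_inf_ge0 id (@power_ge0 k delta)). Qed.

Lemma le_hausdorff_content k delta A B : A `<=` B ->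
  hausdorff_content k delta A <= hausdorff_content k delta B.
Proof. by move=> AB; rewrite hausdorff_contentE; exact: le_cover_inf. Qed.

Lemma hausdorff_content_subadditive k delta (F : nat -> set X) :
  hausdorff_content k delta (\bigcup_n F n) <=
  \sum_(0 <= n <oo) hausdorff_content k delta (F n).
Proof. exact: (cover_inf_subadditive id (@power_ge0 k delta)). Qed.

Lemma hausdorff_content_diam k delta D A : (0 <= D <= delta)%R ->
  (forall x y, A x -> A y -> (mdist x y <= D)%R) ->
  hausdorff_content k.+1 delta A <= (D ^+ k.+1)%:E.
Proof.
move=> /andP[D0 Dd] AD; have AD' := diameter_le D0 AD.
apply: le_trans (diameter_exp_le _ AD').
apply: (@cover_inf1 _ _ _ (small delta) (power k.+1) id (@power_ge0 k.+1 delta) set0).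
- by rewrite /small diameter0 lee_fin (le_trans D0).
- by rewrite /power diameter0 expeS mul0e.
- by rewrite /small (le_trans AD') ?lee_fin.
- by [].
Qed.

Lemma hausdorff_content_finite k delta (J : finType) (F : J -> set X) (a : R) :
  (0 <= delta)%R ->
  (forall j, hausdorff_content k.+1 delta (F j) <= a%:E) ->
  hausdorff_content k.+1 delta (\bigcup_j F j) <= (#|J|%:R * a)%:E.
Proof.
move=> d0 Fa.
apply: (@cover_inf_finite _ _ _ (small delta) (power k.+1) id (@power_ge0 k.+1 delta) set0) => //.
- by rewrite /small diameter0 lee_fin.
- by rewrite /power diameter0 expeS mul0e.
Qed.

Lemma hausdorff_measure_eq0P k A : hausdorff_measure k A = 0 <->
  forall delta, (0 < delta)%R -> hausdorff_content k delta A = 0.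
Proof.
split=> [A0 delta delta0|A0].
  apply/eqP; rewrite eq_le hausdorff_content_ge0 andbT -A0.
  by apply: ereal_sup_ubound; exists delta.
apply/eqP; rewrite eq_le; apply/andP; split.
  by apply: ge_ereal_sup => _ [delta d0 <-]; rewrite A0.
apply: le_trans (hausdorff_content_ge0 k 1 A) _.
by apply: ereal_sup_ubound; exists 1%R => //=.
Qed.

Lemma hausdorff_measure0_sub k A B : A `<=` B ->
  hausdorff_measure k B = 0 -> hausdorff_measure k A = 0.
Proof.
move=> AB /hausdorff_measure_eq0P B0; apply/hausdorff_measure_eq0P => d d0.
apply/eqP; rewrite eq_le hausdorff_content_ge0 andbT -(B0 d d0).
exact: le_hausdorff_content.
Qed.

Lemma hausdorff_measure0_bigcup k (F : nat -> set X) :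
  (forall n, hausdorff_measure k (F n) = 0) ->
  hausdorff_measure k (\bigcup_n F n) = 0.
Proof.
move=> F0; apply/hausdorff_measure_eq0P => d d0.
apply/eqP; rewrite eq_le hausdorff_content_ge0 andbT.
apply: le_trans (hausdorff_content_subadditive _ _ _) _.
rewrite eseries0// => n _ _; have /hausdorff_measure_eq0P := F0 n; exact.
Qed.

(** Real bounds of the diameters, extracted once and for all from the extended-real
    sums in the content. *)
Lemma hausdorff_measure0_cover k A delta e : (0 < delta)%R -> (0 < e)%R ->
  hausdorff_measure k A = 0 ->
  exists (U : nat -> set X) (D : nat -> R), [/\ A `<=` \bigcup_n U n,
    forall n, (0 <= D n <= delta)%R,
    forall n x y, U n x -> U n y -> (mdist x y <= D n)%R &
    \sum_(0 <= n <oo) (D n ^+ k)%:E <= e%:E].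
Proof.
move=> d0 e0 /hausdorff_measure_eq0P/(_ _ d0) A0.
have A0' : cover_inf (small delta) (power k) id A < e%:E.
  by rewrite -hausdorff_contentE A0 lte_fin.
have [_ [U [Usmall AU] <-] Ue] := ereal_inf_lt A0'.
have Ufin n : diameter (U n) \is a fin_num.
  by rewrite ge0_fin_numE ?diameter_ge0// (le_lt_trans (Usmall n)) ?ltry.
exists U, (fun n => fine (diameter (U n))); split => //.
- by move=> n; rewrite fine_ge0 ?diameter_ge0//= -lee_fin fineK//; exact: Usmall.
- by move=> n x y Ux Uy; rewrite -lee_fin fineK// mdist_le_diameter.
- apply: le_trans (ltW Ue); apply: lee_nneseries => [n _ _|n _].
    by rewrite lee_fin exprn_ge0// fine_ge0// diameter_ge0.
  by rewrite EFin_expe fineK.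
Qed.

End hausdorff_theory.

Lemma hausdorff_measure0_image (R : realType) (X Y : metricType R) k (A : set X)
    (phi : X -> Y) (C : R) :
  0 < C -> (forall x y, A x -> A y -> mdist (phi x) (phi y) <= C * mdist x y) ->
  hausdorff_measure k.+1 A = 0%E -> hausdorff_measure k.+1 (phi @` A) = 0%E.
Proof.
move=> C0 phiC A0; apply/hausdorff_measure_eq0P => d d0.
apply/eqP; rewrite eq_le hausdorff_content_ge0 andbT.
apply/lee_addgt0Pr => e e0; rewrite add0e.
have [|U [D [AU D01 UD De]]] := @hausdorff_measure0_cover _ _ k.+1 A (d / C)
  (e / C ^+ k.+1) (divr_gt0 d0 C0) _ A0.
  by rewrite divr_gt0// exprn_gt0.
apply: (@le_trans _ _ (hausdorff_content k.+1 d (\bigcup_n (phi @` (A `&` U n))))).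
  apply: le_hausdorff_content => _ [x Ax <-].
  by have [n _ Ux] := AU x Ax; exists n => //; exists x.
apply: le_trans (hausdorff_content_subadditive _ _ _) _.
apply: (@le_trans _ _ ((C ^+ k.+1)%:E * \sum_(0 <= n <oo) (D n ^+ k.+1)%:E)%E); last first.
  apply: le_trans (lee_wpmul2l _ De) _; first by rewrite lee_fin exprn_ge0// ltW.
  by rewrite -EFinM lee_fin mulrC divfK// gt_eqF// exprn_gt0.
rewrite -nneseriesZl; last first.
  by move=> n _; rewrite lee_fin exprn_ge0//; have /andP[] := D01 n.
apply: lee_nneseries => [n _ _|n _]; first exact: hausdorff_content_ge0.
rewrite -EFinM -exprMn; have /andP[D0 Dd] := D01 n.
apply: hausdorff_content_diam.
  by rewrite mulr_ge0 ?(ltW C0)//= mulrC -ler_pdivlMr.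
move=> _ _ [x [Ax Ux] <-] [y [Ay Uy] <-].
apply: le_trans (phiC _ _ Ax Ay) _; rewrite ler_pM2l//; exact: UD Ux Uy.
Qed.

Section lebesgue_hausdorff.
Context {R : realType} {k' : nat} {X : metricType R}.
Local Notation k := k'.+1.
Local Notation V := 'rV[R]_k.
Local Notation leb := (@lebesgue_outer R k).
Implicit Types (S : set V).

(** A cube of radius [r] has measure [(2 * r) ^ k] and an image of diameter at most
    [2 * C * r], so efficient covers are mapped to efficient covers. *)
Lemma lebesgue0_hausdorff0 S (f : V -> X) (C : R) : 0 < C ->
  (forall x y, S x -> S y -> mdist (f x) (f y) <= C * `|x - y|) ->
  leb S = 0%E -> hausdorff_measure k (f @` S) = 0%E.
Proof.
move=> C0 fC S0; apply/hausdorff_measure_eq0P => d d0.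
apply/eqP; rewrite eq_le hausdorff_content_ge0 andbT.
apply/lee_addgt0Pr => e e0; rewrite add0e.
have d2C : 0 < d / C / 2 by rewrite !divr_gt0.
have Se : (leb S < (e / C ^+ k)%:E)%E by rewrite S0 lte_fin divr_gt0// exprn_gt0.
have [c [c0 Sc ce]] := small_cube_cover d2C Se.
apply: (@le_trans _ _ (hausdorff_content k d
    (\bigcup_n (f @` (S `&` cube (c n).1 (c n).2))))).
  apply: le_hausdorff_content => _ [x Sx <-].
  by have [n _ cx] := Sc x Sx; exists n => //; exists x.
apply: le_trans (hausdorff_content_subadditive _ _ _) _.
apply: (@le_trans _ _ ((C ^+ k)%:E *
    \sum_(0 <= n <oo) (((c n).2 *+ 2) ^+ k)%:E)%E); last first.
  apply: le_trans (lee_wpmul2l _ (ltW ce)) _; first by rewrite lee_fin exprn_ge0// ltW.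
  by rewrite -EFinM lee_fin mulrC divfK// gt_eqF// exprn_gt0.
rewrite -nneseriesZl; last first.
  by move=> n _; rewrite lee_fin exprn_ge0// mulrn_wge0//; have /andP[] := c0 n.
apply: lee_nneseries => [n _ _|n _]; first exact: hausdorff_content_ge0.
rewrite -EFinM -exprMn; have /andP[r0 rd] := c0 n.
apply: hausdorff_content_diam.
  rewrite mulr_ge0 ?(ltW C0) ?mulrn_wge0//= mulrC -ler_pdivlMr// -mulr_natr.
  by rewrite -ler_pdivlMr.
move=> _ _ [x [Sx /(cube_normP _ _ r0) xc] <-] [y [Sy /(cube_normP _ _ r0) yc] <-].
apply: le_trans (fC _ _ Sx Sy) _; rewrite ler_pM2l// mulr2n.
apply: le_trans (ler_distD (c n).1 _ _) _.
by rewrite lerD// distrC.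
Qed.

(** The preimage of a set of diameter [D] lies in a cube of radius [C * D]. *)
Lemma hausdorff0_lebesgue0 S (g : V -> X) (C : R) : 0 < C ->
  (forall x y, S x -> S y -> `|x - y| <= C * mdist (g x) (g y)) ->
  hausdorff_measure k (g @` S) = 0%E -> leb S = 0%E.
Proof.
move=> C0 gC S0; apply/eqP; rewrite eq_le outer_measure_ge0 andbT.
apply/lee_addgt0Pr => e e0; rewrite add0e.
have e'0 : 0 < e / (C * 2) ^+ k by rewrite divr_gt0// exprn_gt0// mulr_gt0.
have [U [D [AU D01 UD De]]] := hausdorff_measure0_cover ltr01 e'0 S0.
apply: (@le_trans _ _ (leb (\bigcup_n (S `&` g @^-1` U n)))).
  by apply: le_outer_measure => x Sx; have [|n _ Ux] := AU (g x); [exists x|exists n].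
apply: (le_trans (outer_measure_sigma_subadditive _ _)).
apply: (@le_trans _ _ (((C * 2) ^+ k)%:E * \sum_(0 <= n <oo) (D n ^+ k)%:E)%E); last first.
  apply: le_trans (lee_wpmul2l _ De) _.
    by rewrite lee_fin exprn_ge0// mulr_ge0// ltW.
  by rewrite -EFinM lee_fin mulrC divfK// gt_eqF// exprn_gt0// mulr_gt0.
rewrite -nneseriesZl; last first.
  by move=> n _; rewrite lee_fin exprn_ge0//; have /andP[] := D01 n.
apply: lee_nneseries => [n _ _|n _]; first exact: outer_measure_ge0.
rewrite -EFinM -exprMn; have /andP[D0 _] := D01 n.
have [[x [Sx Ux]]|noS] := pselect (exists x, S x /\ U n (g x)); last first.
  rewrite (_ : _ `&` _ = set0) ?outer_measure0 ?lee_fin ?exprn_ge0 ?mulr_ge0// ?(ltW C0)//.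
  by rewrite -subset0 => x [Sx Ux]; apply: noS; exists x.
have CD0 : 0 <= C * D n by rewrite mulr_ge0// ltW.
rewrite mulrAC mulr_natr; apply: (lebesgue_outer_cube_le (x := x)) => //.
move=> y [Sy Uy]; apply/cube_normP => //.
by apply: le_trans (gC _ _ Sy Sx) _; rewrite ler_pM2l//; exact: UD Uy Ux.
Qed.

End lebesgue_hausdorff.

Section euclidean_norm_theory.
Context {R : realType} {k : nat}.
Implicit Types x : 'rV[R]_k.

Lemma coord_le_euclidean x i : `|x 0 i| <= euclidean_norm x.
Proof.
rewrite -sqrtr_sqr ler_wsqrtr// (bigD1 i)//= lerDl.
by apply: sumr_ge0 => j _; exact: sqr_ge0.
Qed.

Lemma euclidean_norm_ge0 x : 0 <= euclidean_norm x.
Proof. exact: sqrtr_ge0. Qed.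

Lemma norm_le_euclidean x : `|x| <= euclidean_norm x.
Proof.
by apply/row_norm_leP => [|i]; [exact: euclidean_norm_ge0|exact: coord_le_euclidean].
Qed.

Lemma euclidean_le_norm x : euclidean_norm x <= k%:R * `|x|.
Proof.
rewrite -(ger0_norm (mulr_ge0 (ler0n R k) (normr_ge0 x))) -sqrtr_sqr ler_wsqrtr//.
apply: (@le_trans _ _ (\sum_(i < k) `|x| ^+ 2)).
  apply: ler_sum => i _; rewrite -real_normK ?num_real//.
  by apply: lerXn2r; rewrite ?nnegrE//; exact: coord_le_norm.
rewrite sumr_const card_ord exprMn -[leLHS]mulr_natl ler_wpM2r ?sqr_ge0//.
by rewrite -natrX ler_nat; case: k => // n; rewrite leq_pmulr.
Qed.

End euclidean_norm_theory.

(** * Curves, their length, and Lipschitz reparametrizations *)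

Section curve_length_theory.
Context {R : realType} {X : metricType R}.
Implicit Types (a b s t : R) (c : R -> X).

Let polygonal_length_cons a b c x p :
  polygonal_length a b c (x :: p) = mdist (c a) (c x) + polygonal_length x b c p.
Proof. by rewrite /polygonal_length /= big_nat_recl. Qed.

Let polygonal_length_le a b c (F : R -> R) p :
  (forall s t, a <= s -> s <= t -> t <= b -> mdist (c s) (c t) <= F t - F s) ->
  itv_partition a b p -> polygonal_length a b c p <= F b - F a.
Proof.
elim: p a => [a H /itv_partition_nil ->|x p IH a H abp].
  by rewrite /polygonal_length big_geq// subrr.
have [xbp ax] : itv_partition x b p /\ a < x.
  by split; [exact: itv_partition_cons abp|case: abp => /= /andP[]].
have xb := itv_partition_le xbp.
have -> : F b - F a = (F x - F a) + (F b - F x) by ring.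
rewrite polygonal_length_cons lerD//.
  by apply: H => //; exact: ltW.
by apply: IH => // s t xs; apply: H; exact: le_trans (ltW ax) xs.
Qed.

Lemma curve_length_le a b c (F : R -> R) :
  (forall s t, a <= s -> s <= t -> t <= b -> mdist (c s) (c t) <= F t - F s) ->
  (curve_length a b c <= (F b - F a)%:E)%E.
Proof.
move=> H; apply: ge_ereal_sup => _ [p abp <-].
by rewrite lee_fin; exact: polygonal_length_le.
Qed.

Let polygonal_length_rcons a b b' c p x : last a p = b ->
  polygonal_length a b' c (rcons p x) = polygonal_length a b c p + mdist (c b) (c x).
Proof.
elim: p a => [a /= ->|y p IH a /= yb].
  by rewrite /polygonal_length /= big_nat1 big_geq// add0r.
by rewrite !polygonal_length_cons IH// addrA.
Qed.

Lemma curve_length_ge0 a b c : a <= b -> (0 <= curve_length a b c)%E.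
Proof.
rewrite le_eqVlt => /orP[/eqP <-|ab].
  apply: ereal_sup_ubound; exists [::]; first by split => /=.
  by rewrite /polygonal_length big_geq.
apply: le_trans (_ : (polygonal_length a b c [:: b])%:E <= _)%E.
  by rewrite lee_fin /polygonal_length sumr_ge0// => i _; exact: mdist_ge0.
by apply: ereal_sup_ubound; exists [:: b] => //; exact: itv_partition1.
Qed.

Lemma curve_lengthD_mdist a s t c : a <= s -> s <= t ->
  (curve_length a s c + (mdist (c s) (c t))%:E <= curve_length a t c)%E.
Proof.
move=> as_; rewrite le_eqVlt => /orP[/eqP <-|st]; first by rewrite mdistxx adde0.
rewrite -leeBrDr//; apply: ge_ereal_sup => _ [p asp <-].
rewrite leeBrDr// -EFinD; have [pp /eqP ps] := asp.
rewrite -(@polygonal_length_rcons a s t c p t ps).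
apply: ereal_sup_ubound; exists (rcons p t) => //; split.
  by rewrite rcons_path pp ps.
by rewrite last_rcons.
Qed.

Lemma mdist_le_curve_length a b c : a <= b ->
  ((mdist (c a) (c b))%:E <= curve_length a b c)%E.
Proof.
move=> ab; apply: le_trans (curve_lengthD_mdist c (lexx a) ab).
by rewrite leeDr// curve_length_ge0.
Qed.

(** Parametrizing by the last point where the length from [0] is at most a given
    value avoids showing that the length function is continuous. *)
Lemma lipschitz_reparametrization c (D : R) :
  {within `[0, 1], continuous c} -> (curve_length 0 1 c <= D%:E)%E ->
  exists g : R -> X, [/\ g 0 = c 0, g 1 = c 1 &
    forall s t, 0 <= s -> s <= t -> t <= 1 -> mdist (g s) (g t) <= D * (t - s)].
Proof.
move=> cc cD.
have D0 : 0 <= D by rewrite -lee_fin; apply: le_trans cD; rewrite curve_length_ge0.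
have c_near x e : 0 <= x <= 1 -> 0 < e -> exists2 d, 0 < d & forall y,
    0 <= y <= 1 -> `|x - y| < d -> mdist (c x) (c y) < e.
  move=> x01 e0; have xI : `[0, 1]%classic x by rewrite /= in_itv.
  have /subspace_continuousP/(_ x xI) := cc.
  move=> /(_ (ball (c x) e) (nbhsx_ballx (c x) _ e0)).
  rewrite /nbhs /= /within => /nbhs_ballP[d /= d0 H]; exists d => // y y01 xy.
  have := H y xy; rewrite ballEmdist /=; apply.
  by rewrite /= in_itv.
have len_fin t : 0 <= t <= 1 -> curve_length 0 t c \is a fin_num.
  move=> /andP[t0 t1]; rewrite ge0_fin_numE ?curve_length_ge0//.
  apply: (@le_lt_trans _ _ D%:E); last exact: ltry.
  apply: le_trans cD; apply: le_trans (curve_lengthD_mdist c t0 t1).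
  by rewrite leeDl// lee_fin mdist_ge0.
pose l t := fine (curve_length 0 t c).
have l_dist s t : 0 <= s -> s <= t -> t <= 1 -> mdist (c s) (c t) <= l t - l s.
  move=> s0 st t1; have t0 := le_trans s0 st; have s1 := le_trans st t1.
  rewrite lerBrDr -lee_fin EFinD /l !fineK ?len_fin ?s0 ?t0// addeC.
  exact: curve_lengthD_mdist.
have l_mono s t : 0 <= s -> s <= t -> t <= 1 -> l s <= l t.
  by move=> s0 st t1; rewrite -subr_ge0; apply: le_trans (l_dist _ _ s0 st t1); exact: mdist_ge0.
have l0 : l 0 = 0.
  rewrite /l (_ : curve_length 0 0 c = 0%E)//; apply/eqP.
  rewrite eq_le curve_length_ge0// andbT.
  have := @curve_length_le 0 0 c (fun=> 0); rewrite subr0; apply => s t s0 st t0.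
  have -> : s = t by apply: le_anti; rewrite st (le_trans t0).
  by rewrite mdistxx.
have l1 : l 1 <= D by rewrite -lee_fin /l fineK// len_fin// lexx ler01.
pose B u := [set t | 0 <= t <= 1 /\ l t <= D * u].
pose T u := sup (B u).
have B0 u : 0 <= u -> B u 0 by move=> u0; split; rewrite ?lexx ?ler01// l0 mulr_ge0.
have supB u : 0 <= u -> has_sup (B u).
  by move=> u0; split; [exists 0; exact: B0|exists 1 => t [/andP[]]].
have T01 u : 0 <= u -> 0 <= T u <= 1.
  move=> u0; apply/andP; split.
    by apply: ub_le_sup; [have [] := supB u u0|exact: B0].
  by apply: ge_sup => [|t [/andP[]]//]; exists 0; exact: B0.
(* points just below [T u] have length at most [D * u] *)
have T_low u e : 0 <= u -> 0 < e -> exists2 t, B u t & t <= T u /\ mdist (c (T u)) (c t) < e.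
  move=> u0 e0; have [d d0 Hd] := c_near _ e (T01 u u0) e0.
  have [t Bt tT] := sup_adherent d0 (supB u u0).
  have tleT : t <= T u by apply: ub_le_sup => //; have [] := supB u u0.
  exists t => //; split => //; apply: Hd; first by case: Bt.
  by rewrite ger0_norm ?subr_ge0//; move: tT; rewrite -/(T u); lra.
exists (fun u => c (T u)); split.
- apply/esym/mdist_positivity/eqP; rewrite eq_le mdist_ge0 andbT.
  apply/ler_addgt0Pr => e e0; rewrite add0r.
  have [t [t01 lt] [tT Tt]] := T_low 0 e (lexx 0) e0.
  apply: le_trans (metric_triangle _ (c t) _) _; have /andP[t0 t1] := t01.
  have := l_dist _ _ (lexx 0) t0 t1; rewrite l0 subr0; rewrite mulr0 in lt.
  by rewrite [mdist (c t) _]metric_sym; lra.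
- congr c; apply: le_anti; have /andP[_ ->] := T01 1 ler01.
  apply: ub_le_sup; first by have [] := supB 1 ler01.
  by split; [rewrite ler01 lexx|rewrite mulr1].
move=> s t s0 st t1; have t0 := le_trans s0 st.
have TsTt : T s <= T t.
  apply: sup_le => [x [x01 lx]| |]; last exact: supB.
    exists x; split => //; split => //; apply: le_trans lx _; exact: ler_wpM2l.
  by exists 0; exact: B0.
move: TsTt; rewrite le_eqVlt => /orP[/eqP ->|TsTt].
  by rewrite mdistxx mulr_ge0// subr_ge0.
apply/ler_addgt0Pr => e e0; have e20 : 0 < e / 2 by rewrite divr_gt0.
have /andP[Ts0 Ts1] := T01 s s0; have /andP[Tt0 Tt1] := T01 t t0.
have [d d0 Hd] := c_near (T s) _ (T01 s s0) e20.
pose x := Num.min (T s + d / 2) ((T s + T t) / 2).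
have xTs : T s < x by rewrite lt_min; apply/andP; split; lra.
have xd : x <= T s + d / 2 by rewrite ge_min lexx.
have xTt : x <= (T s + T t) / 2 by rewrite ge_min lexx orbT.
have x01 : 0 <= x <= 1 by apply/andP; split; lra.
have lx : D * s < l x.
  rewrite ltNge; apply/negP => lx; move: xTs; apply/negP; rewrite -leNgt.
  by apply: ub_le_sup; [have [] := supB s s0|split].
have Tsx : mdist (c (T s)) (c x) < e / 2.
  by apply: Hd => //; rewrite distrC ger0_norm; lra.
have m0 : 0 < Num.min (e / 2) 1 by rewrite lt_min e20 ltr01.
have [d' d'0 Hd'] := c_near (T t) _ (T01 t t0) e20.
have g0 : 0 < Num.min d' ((T t - T s) / 2) by rewrite lt_min d'0; lra.
have [y By yT] := sup_adherent g0 (supB t t0).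
have yleT : y <= T t by apply: ub_le_sup => //; have [] := supB t t0.
have xy : x <= y.
  apply: le_trans xTt _; move: yT; rewrite -/(T t).
  have : Num.min d' ((T t - T s) / 2) <= (T t - T s) / 2 by rewrite ge_min lexx orbT.
  lra.
have Tty : mdist (c (T t)) (c y) < e / 2.
  apply: Hd'; first by case: By.
  rewrite ger0_norm ?subr_ge0//; move: yT; rewrite -/(T t).
  have : Num.min d' ((T t - T s) / 2) <= d' by rewrite ge_min lexx.
  lra.
have [/andP[y0 y1] ly] := By; have /andP[x0 _] := x01.
have := l_dist _ _ x0 xy y1.
have := metric_triangle (c (T s)) (c x) (c (T t)).
have := metric_triangle (c x) (c y) (c (T t)).
by rewrite [mdist (c y) (c (T t))]metric_sym; lra.
Qed.

End curve_length_theory.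

(** * Lipschitz curves through a subset of a line *)

Section lipschitz_filling.
Context {R : realType} {X : metricType R}.
Hypothesis X_complete : complete_space X.

Let closure_near (K : set R) t e : closure K t -> 0 < e ->
  exists2 s, K s & `|s - t| < e.
Proof.
move=> /(_ _ (nbhsx_ballx t _ _)) Kt e0; have [s [Ks]] := Kt e e0.
by rewrite /ball /= distrC; exists s.
Qed.

(** The values along points of [K] tending to a limit point form a Cauchy filter. *)
Let extend_to_closure (K : set R) (phi : R -> X) L : 0 <= L ->
  (forall s t, K s -> K t -> mdist (phi s) (phi t) <= L * `|s - t|) ->
  exists psi : R -> X, (forall t, K t -> psi t = phi t) /\
    forall s t, closure K s -> closure K t -> mdist (psi s) (psi t) <= L * `|s - t|.
Proof.
move=> L0 phiL.
have lim t : closure K t -> exists x, forall s, K s -> mdist (phi s) x <= L * `|s - t|.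
  move=> Kt; pose F : set_system X := phi @ within K (nbhs t).
  have PW : ProperFilter (within K (nbhs t)) by exact: within_nbhs_proper.
  have PF : ProperFilter F by exact: fmap_proper_filter.
  have F_near e : 0 < e -> F [set x | exists s, [/\ K s, `|s - t| < e & x = phi s]].
    move=> e0; rewrite /F /= /fmap /within /=; apply/nbhs_ballP; exists e => //= s.
    by rewrite /ball /= distrC => ts Ks; exists s.
  have L10 : 0 < L + 1 by rewrite ltr_wpDl.
  have cF : cauchy F.
    apply: (@cauchy_exP R) => e e0.
    have e10 : 0 < e / (L + 1) / 2 by rewrite !divr_gt0.
    have [s0 Ks0 s0t] := closure_near Kt e10.
    exists (phi s0); apply: filterS (F_near _ e10) => _ [s [Ks st ->]].
    rewrite ballEmdist /=; apply: le_lt_trans (phiL _ _ Ks0 Ks) _.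
    apply: (@le_lt_trans _ _ ((L + 1) * `|s0 - s|)); first by rewrite ler_wpM2r// lerDl.
    rewrite -ltr_pdivlMl// mulrC (splitr (e / _)).
    by apply: le_lt_trans (ler_distD t _ _) _; rewrite ltrD// distrC.
  have [x Fx] := X_complete PF cF; exists x => s Ks.
  apply/ler_addgt0Pr => e e0.
  have e10 : 0 < e / (L + 1) / 2 by rewrite !divr_gt0.
  have e20 : 0 < e / 2 by rewrite divr_gt0.
  have xF : F (ball x (e / 2)) by apply: Fx; exact: nbhsx_ballx.
  have [y [xe [s' [Ks' s't yE]]]] := filter_ex (filterI xF (F_near _ e10)).
  rewrite ballEmdist /= yE in xe.
  have := metric_triangle (phi s) (phi s') x; rewrite [mdist (phi s') x]metric_sym.
  have := phiL _ _ Ks Ks'.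
  have : L * `|s - s'| <= L * `|s - t| + L * `|s' - t|.
    by rewrite -mulrDr ler_wpM2l// (le_trans (ler_distD t _ _))// [`|t - s'|]distrC.
  have : L * `|s' - t| <= e / 2.
    apply: (@le_trans _ _ ((L + 1) * `|s' - t|)); first by rewrite ler_wpM2r// lerDl.
    by rewrite -ler_pdivlMl// mulrC mulrAC ltW.
  lra.
have /choice[psi psiP] : forall t, exists x, closure K t ->
    forall s, K s -> mdist (phi s) x <= L * `|s - t|.
  move=> t; have [/lim[x Hx]|nK] := pselect (closure K t); first by exists x.
  by exists (phi t) => /nK.
exists psi; split=> [t Kt|s t Ks Kt].
  have := psiP t (subset_closure Kt) t Kt; rewrite subrr normr0 mulr0 => tt.
  by apply/esym/mdist_positivity/eqP; rewrite eq_le tt mdist_ge0.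
apply/ler_addgt0Pr => e e0.
have e10 : 0 < e / (L + 1) / 2 by rewrite !divr_gt0// ltr_wpDl.
have [r Kr rs] := closure_near Ks e10.
have := metric_triangle (psi s) (phi r) (psi t); rewrite [mdist (psi s) (phi r)]metric_sym.
have := psiP s Ks r Kr; have := psiP t Kt r Kr.
have : L * `|r - t| <= L * `|s - t| + L * `|r - s|.
  by rewrite -mulrDr ler_wpM2l// (le_trans (ler_distD s _ _))// addrC.
have : L * `|r - s| <= e / 2.
  apply: (@le_trans _ _ ((L + 1) * `|r - s|)); first by rewrite ler_wpM2r// lerDl.
  by rewrite -ler_pdivlMl ?ltr_wpDl// mulrC mulrAC ltW.
lra.
Qed.

Variable C : R.
Hypothesis C1 : 1 <= C.
Hypothesis X_path : forall x y : X, exists g : R -> X, [/\ g 0 = x, g 1 = y &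
  forall s t, 0 <= s -> s <= t -> t <= 1 ->
    mdist (g s) (g t) <= C * mdist x y * (t - s)].

(** The gaps of the closure of the domain are filled by short paths; completeness
    provides the values at the ends of the gaps. *)
Lemma lipschitz_filling (K : set R) (a b : R) (phi : R -> X) L :
  0 <= L -> K `<=` `[a, b]%classic -> K a -> K b ->
  (forall s t, K s -> K t -> mdist (phi s) (phi t) <= L * `|s - t|) ->
  exists g : R -> X, (forall t, K t -> g t = phi t) /\
    forall s t, a <= s -> s <= t -> t <= b -> mdist (g s) (g t) <= C * L * (t - s).
Proof.
move=> L0 Kab Ka Kb phiL; have C0 : 0 <= C by exact: le_trans C1.
have [psi [psiK psiL]] := extend_to_closure L0 phiL.
have cK : closed (closure K) by exact: closed_closure.
have cKa : closure K a by exact: subset_closure.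
have cKb : closure K b by exact: subset_closure.
pose lo t : set R := closure K `&` [set s | s <= t].
pose hi t : set R := closure K `&` [set s | t <= s].
(* the ends of the gap around [t] *)
pose p t := sup (lo t); pose q t := inf (hi t).
have lo_sup t : a <= t -> has_sup (lo t) by move=> t_a; split; [exists a|exists t => s []].
have hi_inf t : t <= b -> has_inf (hi t) by move=> t_b; split; [exists b|exists t => s []].
have p_ub t s : a <= t -> closure K s -> s <= t -> s <= p t.
  by move=> t_a Ks st; apply: ub_le_sup; [have [] := lo_sup t t_a|].
have q_lb t s : t <= b -> closure K s -> t <= s -> q t <= s.
  by move=> t_b Ks st; apply: ge_inf; [have [] := hi_inf t t_b|].
have p_le t : a <= t -> p t <= t.
  by move=> t_a; apply: ge_sup; [have [] := lo_sup t t_a|move=> s []].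
have q_ge t : t <= b -> t <= q t.
  by move=> t_b; apply: lb_le_inf; [have [] := hi_inf t t_b|move=> s []].
have Kp t : a <= t -> closure K (p t).
  move=> t_a; apply: cK => B /nbhs_ballP[e /= e0 eB].
  have [s los sp] := sup_adherent e0 (lo_sup t t_a).
  exists s; split; first by case: los.
  apply: eB; rewrite /ball /= ger0_norm ?subr_ge0; last by apply: p_ub => //; case: los.
  by rewrite -/(p t) in sp; lra.
have Kq t : t <= b -> closure K (q t).
  move=> t_b; apply: cK => B /nbhs_ballP[e /= e0 eB].
  have [s his sq] := inf_adherent e0 (hi_inf t t_b).
  exists s; split; first by case: his.
  apply: eB; rewrite /ball /= distrC ger0_norm ?subr_ge0; last by apply: q_lb => //; case: his.
  by rewrite -/(q t) in sq; lra.
have /choice[w wP] : forall xy : X * X, exists g : R -> X, [/\ g 0 = xy.1, g 1 = xy.2 &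
  forall s t, 0 <= s -> s <= t -> t <= 1 ->
    mdist (g s) (g t) <= C * mdist xy.1 xy.2 * (t - s)].
  by move=> [x y]; exact: X_path.
pose u t := (t - p t) / (q t - p t).
pose g t := w (psi (p t), psi (q t)) (u t).
have pq t : a <= t -> t <= b -> p t <= q t.
  by move=> t_a t_b; exact: le_trans (p_le t t_a) (q_ge t t_b).
have uE t : a <= t -> t <= b -> u t * (q t - p t) = t - p t.
  move=> t_a t_b; rewrite /u; have [pqE|pqN] := eqVneq (q t - p t) 0.
    by rewrite pqE mulr0; have := p_le t t_a; have := q_ge t t_b; lra.
  by rewrite divfK.
have u0 t : a <= t -> t <= b -> 0 <= u t.
  by move=> t_a t_b; rewrite divr_ge0// subr_ge0 ?p_le// pq.
have u1 t : a <= t -> t <= b -> u t <= 1.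
  move=> t_a t_b; have := pq t t_a t_b; rewrite le_eqVlt => /orP[/eqP pqE|pqlt].
    by rewrite /u pqE subrr invr0 mulr0 ler01.
  by rewrite ler_pdivrMr ?subr_gt0// mul1r lerD2r q_ge.
clearbody u.
have psipq t : a <= t -> t <= b -> mdist (psi (p t)) (psi (q t)) <= L * (q t - p t).
  move=> t_a t_b; apply: le_trans (psiL _ _ (Kp t t_a) (Kq t t_b)) _.
  by rewrite distrC ger0_norm// subr_ge0 pq.
have gp t : a <= t -> t <= b -> mdist (psi (p t)) (g t) <= C * L * (t - p t).
  move=> t_a t_b; have [w0 w1 wL] := wP (psi (p t), psi (q t)).
  have := wL 0 (u t) (lexx 0) (u0 t t_a t_b) (u1 t t_a t_b); rewrite w0 /= subr0 => /le_trans.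
  apply; rewrite -(uE t)// -!mulrA ler_wpM2l// mulrC [leRHS]mulrCA ler_wpM2l ?u0//.
  exact: psipq.
have gq t : a <= t -> t <= b -> mdist (g t) (psi (q t)) <= C * L * (q t - t).
  move=> t_a t_b; have [w0 w1 wL] := wP (psi (p t), psi (q t)).
  have := wL (u t) 1 (u0 t t_a t_b) (u1 t t_a t_b) (lexx 1); rewrite w1 /= => /le_trans.
  have -> : q t - t = (1 - u t) * (q t - p t) by have := uE t t_a t_b; lra.
  apply; rewrite -!mulrA ler_wpM2l// mulrC [leRHS]mulrCA.
  by rewrite ler_wpM2l ?subr_ge0 ?u1//; exact: psipq.
exists g; split=> [t Kt|s t s_a st t_b].
  have /andP[t_a t_b] : a <= t <= b by have := Kab t Kt; rewrite /= in_itv.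
  have pt : p t = t by apply: le_anti; rewrite p_le//= p_ub//; exact: subset_closure.
  rewrite -psiK//; apply/esym/mdist_positivity/eqP.
  rewrite eq_le mdist_ge0 andbT -[in psi t]pt.
  by apply: le_trans (gp t t_a t_b) _; rewrite pt subrr mulr0.
have s_b := le_trans st t_b; have t_a := le_trans s_a st.
have CL : L <= C * L by rewrite ler_peMl.
have CL0 : 0 <= C * L by rewrite mulr_ge0.
have [qp|qp] := leP (q s) (p t).
  have h1 := gq s s_a s_b; have h2 := gp t t_a t_b.
  have h3 := psiL _ _ (Kq s s_b) (Kp t t_a).
  rewrite distrC ger0_norm ?subr_ge0// in h3.
  have h4 : L * (p t - q s) <= C * L * (p t - q s) by rewrite ler_wpM2r// subr_ge0.
  have := metric_triangle (g s) (psi (q s)) (g t).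
  have := metric_triangle (psi (q s)) (psi (p t)) (g t).
  lra.
have qst : t < q s.
  rewrite ltNge; apply/negP => qt; move: qp; apply/negP; rewrite -leNgt.
  exact: p_ub (Kq s s_b) qt.
have qE : q s = q t.
  apply: le_anti; apply/andP; split.
    by apply: q_lb => //; [exact: Kq|exact: le_trans (q_ge t t_b)].
  by apply: q_lb => //; [exact: Kq|exact: ltW].
have pts : p t < s.
  rewrite ltNge; apply/negP => sp; move: qp; apply/negP; rewrite -leNgt.
  exact: q_lb (Kp t t_a) sp.
have pE : p s = p t.
  apply: le_anti; apply/andP; split.
    by apply: p_ub => //; [exact: Kp|exact: le_trans (p_le s s_a) st].
  by apply: p_ub => //; [exact: Kp|exact: ltW].
have qp0 : 0 < q t - p t by rewrite subr_gt0 -qE.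
have ust : u s <= u t.
  by rewrite -(ler_pM2r qp0) uE// -{1}pE -{1}qE uE// pE lerD2r.
rewrite /g pE qE; have [_ _ wL] := wP (psi (p t), psi (q t)).
apply: le_trans (wL _ _ (u0 s s_a s_b) ust (u1 t t_a t_b)) _ => /=.
have -> : t - s = (u t - u s) * (q t - p t).
  by have := uE t t_a t_b; have := uE s s_a s_b; rewrite pE qE; lra.
rewrite -!mulrA ler_wpM2l// mulrC [leRHS]mulrCA ler_wpM2l ?subr_ge0//.
exact: psipq.
Qed.

End lipschitz_filling.

(** * Curves whose image is slow on a large set of parameters *)

Section slow_functions.
Context {R : realType}.
Local Notation mu := (@lebesgue_measure R).
Variables (a b : R) (U K : set R).
Hypotheses (oU : open U) (KU : forall t, a <= t <= b -> ~ K t -> U t).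

Let u t := fine (mu (U `&` `[a, t])).

Let mU t : measurable (U `&` `[a, t] : set R).
Proof. by apply: measurableI => //; exact: open_measurable. Qed.

Let mu_le (A B : set R) : measurable A -> measurable B -> A `<=` B ->
  (mu A <= mu B)%E.
Proof. by move=> mA mB AB; apply: le_measure; rewrite ?inE. Qed.

Let u_fin t : mu (U `&` `[a, t]) \is a fin_num.
Proof.
rewrite ge0_fin_numE//; apply: (@le_lt_trans _ _ (mu `[a, t]%classic)).
  by apply: mu_le => //; exact: subIsetr.
by rewrite lebesgue_measure_itv/=; case: ifPn => // _; rewrite -EFinB ltry.
Qed.

Let u_incr s t : a <= s -> s <= t -> u s <= u t.
Proof.
move=> as_ st; apply: fine_le => //; apply: mu_le => //.
move=> x [Ux]; rewrite /= !in_itv/= => /andP[-> xs]; split => //.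
exact: le_trans xs st.
Qed.

Let u_incr_sub s t : a <= s -> s <= t -> `]s, t]%classic `<=` U -> t - s <= u t - u s.
Proof.
move=> as_ st stU; rewrite lerBrDr -lee_fin EFinD /u !fineK//.
have -> : ((t - s)%:E = mu `]s, t]%classic)%E.
  rewrite lebesgue_measure_itv/= lte_fin -EFinB.
  case: ifPn => //; rewrite -leNgt => ts.
  by rewrite (_ : s = t) ?subrr//; apply: le_anti; rewrite st.
have <- : (mu (`]s, t]%classic `|` (U `&` `[a, s])) =
    mu `]s, t]%classic + mu (U `&` `[a, s]))%E.
  apply: measureU; [by []|exact: mU|rewrite -subset0 => x [/=]].
  rewrite in_itv/= => /andP[sx _] [_].
  by rewrite in_itv/= => /andP[_]; rewrite leNgt sx.
apply: mu_le => //; first exact: measurableU.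
move=> x [/[dup] xst /stU Ux|[Ux]].
  by split => //; move: xst; rewrite /= !in_itv/= => /andP[/ltW/(le_trans as_) -> ->].
by rewrite /= !in_itv/= => /andP[-> xs]; split => //; exact: le_trans xs st.
Qed.

(** A real induction: the bound propagates through [K] by the local estimate and
    through [U] by the Lipschitz estimate. *)
Lemma slow_on_subset (h : R -> R) (L e : R) : 0 <= L -> 0 <= e ->
  (forall s t, a <= s <= b -> a <= t <= b -> `|h s - h t| <= L * `|s - t|) ->
  (forall t, K t -> exists2 d, 0 < d &
     forall s, K s -> `|s - t| < d -> `|h s - h t| <= e * `|s - t|) ->
  forall p q, a <= p -> p <= q -> q <= b ->
    `|h p - h q| <= (e * q + L * u q) - (e * p + L * u p).
Proof.
move=> L0 e0 hL hK p q ap pq qb; pose F t := e * t + L * u t.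
have F_incr s t : a <= s -> s <= t -> e * (t - s) <= F t - F s.
  move=> as_ st; have : L * u s <= L * u t by rewrite ler_wpM2l// u_incr.
  rewrite /F; lra.
have F_incr_sub s t : a <= s -> s <= t -> `]s, t]%classic `<=` U ->
    L * (t - s) <= F t - F s.
  move=> as_ st stU; have : L * (t - s) <= L * (u t - u s).
    by rewrite ler_wpM2l// u_incr_sub.
  have : e * s <= e * t by rewrite ler_wpM2l.
  rewrite /F; lra.
pose G := [set t | p <= t <= q /\ `|h p - h t| <= F t - F p].
have Gp : G p by split; rewrite ?lexx// !subrr normr0.
have supG : has_sup G by split; [exists p|exists q => t [/andP[]]].
(* [tau] is the furthest point reached by the bound *)
pose tau := sup G.
have ptau : p <= tau by apply: ub_le_sup => //; have [] := supG.
have tauq : tau <= q by apply: ge_sup => [|t [/andP[]]//]; exists p.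
have atau : a <= tau := le_trans ap ptau.
have taub : tau <= b := le_trans tauq qb.
have G_step s : tau < s <= q -> `|h tau - h s| <= F s - F tau ->
    `|h p - h tau| <= F tau - F p -> False.
  move=> /andP[taus sq] h1 h2; move: (taus); apply/negP; rewrite -leNgt.
  apply: ub_le_sup; [by have [] := supG|split].
    by rewrite sq (le_trans ptau)// ltW.
  by apply: le_trans (ler_distD (h tau) _ _) _; lra.
have Gtau : `|h p - h tau| <= F tau - F p.
  apply/ler_addgt0Pr => eta eta0.
  have eta10 : 0 < eta / (L + 1) by rewrite divr_gt0// ltr_wpDl.
  have [t [/andP[pt tq] Gt] ttau] := sup_adherent eta10 supG.
  have t_tau : t <= tau by apply: ub_le_sup; [have [] := supG|split; rewrite ?pt].
  have abt : a <= t <= b by rewrite (le_trans ap pt) (le_trans tq).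
  have abtau : a <= tau <= b by rewrite atau taub.
  have := ler_distD (h t) (h p) (h tau); have := hL _ _ abt abtau.
  have -> : `|t - tau| = tau - t by rewrite distrC ger0_norm ?subr_ge0.
  have : L * (tau - t) <= eta.
    apply: (@le_trans _ _ ((L + 1) * (tau - t))).
      by rewrite ler_wpM2r ?subr_ge0// lerDl.
    by rewrite -ler_pdivlMl ?ltr_wpDl// mulrC; rewrite -/tau in ttau; lra.
  have := F_incr t tau (le_trans ap pt) t_tau.
  have : 0 <= e * (tau - t) by rewrite mulr_ge0// subr_ge0.
  lra.
have [<-//|tauNq] := eqVneq tau q.
have {tauNq} tau_lt : tau < q by rewrite lt_neqAle tauNq.
exfalso; have abtau : a <= tau <= b by rewrite atau taub.
have through_U s : tau < s <= q -> `]tau, s]%classic `<=` U -> False.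
  move=> /[dup] taus /andP[tau_s sq] sU; apply: G_step taus _ Gtau.
  have abs : a <= s <= b by rewrite (le_trans atau (ltW tau_s)) (le_trans sq qb).
  apply: le_trans (hL _ _ abtau abs) _.
  by rewrite distrC ger0_norm ?subr_ge0 ?(ltW tau_s)// F_incr_sub// ltW.
have [Ktau|nKtau] := pselect (K tau).
  have [d d0 Hd] := hK _ Ktau; pose s := Num.min q (tau + d / 2).
  have taus : tau < s <= q.
    by rewrite lt_min tau_lt ge_min lexx/= andbT; lra.
  have sd : s <= tau + d / 2 by rewrite ge_min lexx orbT.
  apply: (through_U s taus) => x; rewrite /= in_itv/= => /andP[taux xs].
  have /andP[_ sq] := taus; have xq := le_trans xs sq.
  apply: contrapT => nUx; have Kx : K x.
    apply: contrapT => nKx; apply: nUx; apply: KU nKx.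
    by rewrite (le_trans atau (ltW taux)) (le_trans xq).
  apply: (G_step x) => //; first by rewrite taux.
  have xd : `|x - tau| < d by rewrite ger0_norm ?subr_ge0 ?(ltW taux)//; lra.
  have := Hd x Kx xd; rewrite distrC [`|x - tau|]ger0_norm ?subr_ge0 ?(ltW taux)// => /le_trans.
  by apply; apply: F_incr => //; exact: ltW.
have /nbhs_ballP[d /= d0 dU] : nbhs tau U by apply: open_nbhs_nbhs; split => //; exact: KU.
pose s := Num.min q (tau + d / 2).
have sd : s <= tau + d / 2 by rewrite ge_min lexx orbT.
have taus : tau < s <= q by rewrite lt_min tau_lt ge_min lexx/= andbT; lra.
apply: (through_U s taus) => x; rewrite /= in_itv/= => /andP[taux xs].
by apply: dU; rewrite /ball /= distrC ger0_norm ?subr_ge0 ?(ltW taux)//; lra.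
Qed.

End slow_functions.

Section weak_BLD_curves.
Context {R : realType} {X : metricType R}.
Local Notation mu := (@lebesgue_measure R).
Variables (Phi : X -> linfty R) (C M : R).
Hypotheses (X_complete : complete_space X) (C1 : 1 <= C) (M1 : 1 <= M).
Hypothesis X_quasi : forall x y : X, exists c : R -> X,
      [/\ rectifiable_curve 0 1 c, c 0 = x, c 1 = y
        & (curve_length 0 1 c <= (C * mdist x y)%:E)%E].
Hypothesis Phi_BLD : forall (a b : R) (c : R -> X), rectifiable_curve a b c ->
      ((M^-1)%:E * curve_length a b c <= curve_length a b (Phi \o c))%E /\
      (curve_length a b (Phi \o c) <= M%:E * curve_length a b c)%E.

Lemma weak_BLD_lipschitz x y : mdist (Phi x) (Phi y) <= M * C * mdist x y.
Proof.
have [c [cr c0 c1 cl]] := X_quasi x y.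
have [_ cM] := Phi_BLD cr.
rewrite -lee_fin -c0 -c1 -[mdist _ _ in leLHS]/(mdist ((Phi \o c) 0) ((Phi \o c) 1)).
apply: le_trans (mdist_le_curve_length _ ler01) _; apply: le_trans cM _.
rewrite c0 c1 -mulrA EFinM; apply: lee_wpmul2l => //.
by rewrite lee_fin (le_trans ler01).
Qed.

Lemma quasiconvex_path (x y : X) : exists g : R -> X, [/\ g 0 = x, g 1 = y &
  forall s t, 0 <= s -> s <= t -> t <= 1 ->
    mdist (g s) (g t) <= C * mdist x y * (t - s)].
Proof.
have [c [[_ cc _] c0 c1 cl]] := X_quasi x y.
have [g [g0 g1 gL]] := lipschitz_reparametrization cc cl.
by exists g; rewrite g0 g1.
Qed.

Lemma linfty_mdist_le (x y : linfty R) r :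
  (forall i, `|val x i - val y i| <= r) -> mdist x y <= r.
Proof. exact: linfty_dist_le. Qed.

Lemma linfty_mdist_ge (x y : linfty R) i : `|val x i - val y i| <= mdist x y.
Proof. exact: linfty_dist_ge. Qed.

Lemma lipschitz_rectifiable (a b L : R) (c : R -> X) : a <= b -> 0 <= L ->
  (forall s t, a <= s -> s <= t -> t <= b -> mdist (c s) (c t) <= L * (t - s)) ->
  rectifiable_curve a b c.
Proof.
move=> ab L0 cL; split => //.
  apply/subspace_continuousP => x; rewrite /= in_itv/= => /andP[ax xb] B.
  move=> /nbhs_ballP[e /= e0 eB].
  have L10 : 0 < L + 1 by rewrite ltr_wpDl.
  apply/nbhs_ballP; exists (e / (L + 1)); first by rewrite /= divr_gt0.
  move=> y; rewrite /ball /= => xy; rewrite in_itv/= => /andP[ay yb].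
  apply: eB; rewrite ballEmdist /=.
  apply: (@le_lt_trans _ _ (L * `|x - y|)).
    have [xley|/ltW ylex] := leP x y.
      by rewrite distrC ger0_norm ?subr_ge0//; exact: cL.
    by rewrite metric_sym ger0_norm ?subr_ge0//; exact: cL.
  apply: (@le_lt_trans _ _ ((L + 1) * `|x - y|)); first by rewrite ler_wpM2r// lerDl.
  by rewrite mulrC -ltr_pdivlMr.
apply: (@le_lt_trans _ _ (L * b - L * a)%:E); last exact: ltry.
by apply: (@curve_length_le _ _ a b c (fun t => L * t)) => s t as_ st tb;
  rewrite -mulrBr; exact: cL.
Qed.

(** The lower weak BLD bound is applied to a curve through the values of [phi]:
    the composite with [Phi] is slow on [K], and only the small rest of the
    interval contributes at full speed. *)
Lemma slow_curve_mdist (K U : set R) (a b : R) (phi : R -> X) (L e : R) :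
  0 <= L -> 0 <= e -> K `<=` `[a, b]%classic -> K a -> K b ->
  (forall s t, K s -> K t -> mdist (phi s) (phi t) <= L * `|s - t|) ->
  (forall i t, K t -> exists2 d, 0 < d & forall s, K s -> `|s - t| < d ->
     `|val (Phi (phi s)) i - val (Phi (phi t)) i| <= e * `|s - t|) ->
  open U -> (forall t, a <= t <= b -> ~ K t -> U t) ->
  mdist (phi a) (phi b) <=
    M * (e * (b - a) + M * C * (C * L) * fine (mu (U `&` `[a, b]))).
Proof.
move=> L0 e0 Kab Ka Kb phiL phie oU KU.
have ab : a <= b by have := Kab a Ka; rewrite /= in_itv/= lexx.
have C0 : 0 <= C by exact: le_trans C1.
have M0 : 0 < M by exact: lt_le_trans M1.
have [g [gK gL]] := lipschitz_filling X_complete C1 quasiconvex_path L0 Kab Ka Kb phiL.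
have CL0 : 0 <= C * L by rewrite mulr_ge0.
have gr := lipschitz_rectifiable ab CL0 gL.
have [gM _] := Phi_BLD gr.
have MCCL0 : 0 <= M * C * (C * L) by rewrite !mulr_ge0// ltW.
have len_le : (curve_length a b (Phi \o g) <=
    (e * (b - a) + M * C * (C * L) * fine (mu (U `&` `[a, b])))%:E)%E.
  pose F t := e * t + M * C * (C * L) * fine (mu (U `&` `[a, t])).
  apply: (@le_trans _ _ (F b - F a)%:E); last first.
    rewrite lee_fin /F; have : 0 <= M * C * (C * L) * fine (mu (U `&` `[a, a])).
      by rewrite mulr_ge0// fine_ge0.
    lra.
  apply: curve_length_le => s t as_ st tb; apply: linfty_mdist_le => i /=.
  have hL x y : a <= x <= b -> a <= y <= b ->
      `|val (Phi (g x)) i - val (Phi (g y)) i| <= M * C * (C * L) * `|x - y|.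
    move=> /andP[ax xb] /andP[ay yb].
    apply: le_trans (linfty_mdist_ge _ _ i) _.
    apply: le_trans (weak_BLD_lipschitz _ _) _.
    rewrite -[leRHS]mulrA; apply: ler_wpM2l; first by rewrite mulr_ge0// ltW.
    have [xley|/ltW ylex] := leP x y.
      by rewrite distrC ger0_norm ?subr_ge0//; exact: gL.
    by rewrite metric_sym ger0_norm ?subr_ge0//; exact: gL.
  have he x : K x -> exists2 d, 0 < d & forall y, K y -> `|y - x| < d ->
      `|val (Phi (g y)) i - val (Phi (g x)) i| <= e * `|y - x|.
    move=> Kx; have [d d0 Hd] := phie i x Kx; exists d => // y Ky yx.
    by rewrite !gK//; exact: Hd.
  exact (slow_on_subset oU KU (h := fun x => val (Phi (g x)) i) MCCL0 e0 hL he as_ st tb).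
rewrite -gK// -(gK b)// -lee_fin.
apply: le_trans (mdist_le_curve_length _ ab) _.
rewrite EFinM; apply: le_trans (lee_wpmul2l _ len_le); last by rewrite lee_fin ltW.
rewrite -lee_pdivrMl//.
Qed.

End weak_BLD_curves.

(** * Small Hausdorff content when one direction is slow *)

(** Both ends of the segment are in the interval: moving towards the centre [c] by
    the factor [2 * e] leaves room for two errors of [e * r]. *)
Lemma segment_in_interval (R : realType) (e r s x y c z w t : R) :
  0 < e <= 8^-1 -> `|z - (x + 2 * e * (c - x))| <= e * r ->
  `|x - c| <= r -> `|y - c| <= r -> `|y - x - s * w| <= e * r ->
  0 <= t <= (1 - 2 * e) * s -> `|z + t * w - c| <= r.
Proof.
move=> /andP[e0 e8] zx xc yc xyw /andP[t0 ts].
have er0 : 0 <= e * r by apply: le_trans zx.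
have e1 : 0 <= 1 - 2 * e by lra.
have end0 : `|z - c| <= r.
  have -> : z - c = (z - (x + 2 * e * (c - x))) + (1 - 2 * e) * (x - c) by ring.
  apply: le_trans (ler_normD _ _) _.
  have : `|(1 - 2 * e) * (x - c)| <= (1 - 2 * e) * r.
    by rewrite normrM ger0_norm// ler_wpM2l.
  lra.
have end1 : `|z + (1 - 2 * e) * s * w - c| <= r.
  have -> : z + (1 - 2 * e) * s * w - c = (z - (x + 2 * e * (c - x))) +
      ((1 - 2 * e) * (y - c) - (1 - 2 * e) * (y - x - s * w)) by ring.
  apply: le_trans (ler_normD _ _) _.
  have : `|(1 - 2 * e) * (y - c)| <= (1 - 2 * e) * r.
    by rewrite normrM ger0_norm// ler_wpM2l.
  have : `|(1 - 2 * e) * (y - x - s * w)| <= e * r.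
    rewrite normrM ger0_norm//; apply: le_trans xyw; rewrite ler_piMl//; lra.
  have := ler_normB ((1 - 2 * e) * (y - c)) ((1 - 2 * e) * (y - x - s * w)).
  lra.
move: end0 end1; rewrite !ler_norml => /andP[a1 a2] /andP[b1 b2].
have [w0|/ltW w0] := leP 0 w.
  have : 0 <= t * w by rewrite mulr_ge0.
  have : t * w <= (1 - 2 * e) * s * w by rewrite ler_wpM2r.
  by move=> ? ?; apply/andP; split; lra.
have : t * w <= 0 by rewrite mulr_ge0_le0.
have : (1 - 2 * e) * s * w <= t * w by rewrite ler_wnM2r.
by move=> ? ?; apply/andP; split; lra.
Qed.

Section slow_direction.
Context {R : realType} {X : metricType R} {k' : nat}.
Local Notation k := k'.+1.
Local Notation V := 'rV[R]_k.
Local Notation leb := (@lebesgue_outer R k).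
Local Notation mu := (@lebesgue_measure R).
Variables (Phi : X -> linfty R) (C M : R).
Hypotheses (X_complete : complete_space X) (C1 : 1 <= C) (M1 : 1 <= M).
Hypothesis X_quasi : forall x y : X, exists c : R -> X,
      [/\ rectifiable_curve 0 1 c, c 0 = x, c 1 = y
        & (curve_length 0 1 c <= (C * mdist x y)%:E)%E].
Hypothesis Phi_BLD : forall (a b : R) (c : R -> X), rectifiable_curve a b c ->
      ((M^-1)%:E * curve_length a b c <= curve_length a b (Phi \o c))%E /\
      (curve_length a b (Phi \o c) <= M%:E * curve_length a b c)%E.
Variables (f : V -> X) (L : R).
Hypothesis L0 : 0 < L.

(** [Phi \o f] moves at speed at most [e] along [S] in direction [w], at each
    point and for each coordinate of [linfty] on a scale of its own. *)
Definition slow_along (S : set V) (w : V) (e : R) := forall i x, S x ->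
  exists2 d, 0 < d & forall t, `|t| < d -> S (x + t *: w) ->
    `|val (Phi (f (x + t *: w))) i - val (Phi (f x)) i| <= e * `|t|.

(** [5 * L] and [6 * L] bound the jumps from two points to the ends of a line that
    runs close to them; the other terms bound the length along this line. *)
Definition tube_constant : R := 11 * L + 2 * M + 2 * M ^+ 2 * C ^+ 2 * L.

(** Chosen so that among the lines with parameters in an interval of length at most
    [2 * r] that start in a box of side [2 * e * r], one meets a set of this measure
    for parameters of measure at most [e * r / 2]. *)
Definition tube_defect (e r : R) : R := e * (2 * e * r) ^+ k / 4.

(** Two points of [S] in the same tube of direction [w] are pushed slightly
    towards the centre of the cube, so that a whole box of parallel lines between
    their neighbourhoods stays inside; one of these lines lies mostly in [S]. *)
Lemma tube_mdist (S : set V) (w c x y : V) (e r s : R) :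
  (forall x y, S x -> S y -> mdist (f x) (f y) <= L * `|x - y|) ->
  slow_along S w e -> `|w| <= 2 -> 0 < e <= 8^-1 -> 0 < r ->
  (leb (cube c r `\` S) < (tube_defect e r)%:E)%E ->
  S x -> S y -> cube c r x -> cube c r y -> 0 <= s <= 2 * r ->
  `|y - x - s *: w| <= e * r ->
  mdist (f x) (f y) <= tube_constant * (e * r).
Proof.
move=> fL Sslow w2 /andP[e0 e8] r0 QS Sx Sy Qx Qy /andP[s0 s2r] xyw.
have er0 : 0 < e * r by rewrite mulr_gt0.
have M0 : 0 < M by exact: lt_le_trans M1.
have C0 : 0 < C by exact: lt_le_trans C1.
have norm_w t : `|t *: w| <= 2 * `|t| by rewrite normrZ mulrC ler_wpM2r.
have Llin d : `|d| <= 7 * (e * r) -> L * `|d| <= 7 * (L * (e * r)).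
  by move=> dle; rewrite [leRHS]mulrCA ler_pM2l.
have McL0 : 0 <= M ^+ 2 * C ^+ 2 * L * (e * r).
  by rewrite !mulr_ge0 ?exprn_ge0// ltW.
have Mer0 : 0 <= M * (e * r) by rewrite mulr_ge0// ltW.
have Ler0 : 0 <= L * (e * r) by rewrite mulr_ge0// ltW.
pose eta := y - x - s *: w.
pose x' := x + (2 * e) *: (c - x); pose s' := (1 - 2 * e) * s.
have e1 : 0 <= 1 - 2 * e by lra.
have s'0 : 0 <= s' by rewrite mulr_ge0.
(* a short segment needs no curve *)
have [s'le|s'gt] := leP s' (2 * (e * r)).
  have sle : s <= 3 * (e * r).
    have : 3 / 4 * s <= s' by rewrite ler_wpM2r//; lra.
    lra.
  apply: le_trans (fL _ _ Sx Sy) _; rewrite distrC.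
  have -> : y - x = eta + s *: w by rewrite subrK.
  apply: le_trans (ler_wpM2l (ltW L0) (ler_normD _ _)) _.
  have := norm_w s; rewrite (ger0_norm s0) => ws.
  have : L * (`|eta| + `|s *: w|) <= L * (7 * (e * r)) by rewrite ler_pM2l//; lra.
  rewrite /tube_constant; lra.
have defect0 : 0 < tube_defect e r.
  by rewrite !mulr_gt0 ?invr_gt0// exprn_gt0// !mulr_gt0.
have l0 : 0 < 2 * (e * r) by rewrite mulr_gt0.
have [y0 y0P [W [mW W0s SW lW]]] :=
  exists_good_line w (x' - const_mx (e * r)) l0 s'0 defect0 QS.
have y0x' : `|y0 - x'| <= e * r.
  apply/row_norm_leP => [|i]; first exact: ltW.
  have := y0P i; rewrite !mxE => /andP[? ?]; rewrite ler_norml; apply/andP; split; lra.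
have muW : (mu W <= (e * r / 2)%:E)%E.
  have lk0 : 0 < (2 * (e * r)) ^+ k by rewrite exprn_gt0.
  rewrite -(@lee_pmul2l _ ((2 * (e * r)) ^+ k)%:E)//.
  apply: le_trans lW _; rewrite -EFinM lee_fin /tube_defect -(mulrA 2 e r).
  apply: (@le_trans _ _ (2 * r * (e * (2 * (e * r)) ^+ k / 4))).
    rewrite ler_wpM2r ?divr_ge0 ?mulr_ge0 ?(ltW e0)// ?(ltW lk0)//.
    apply: le_trans s2r; rewrite ler_piMl//; lra.
  rewrite le_eqVlt; by apply/orP; left; apply/eqP; field.
have [U [oU WU UW]] : exists U : set R, [/\ open U , W `<=` U &
    (mu (U `\` W) < (e * r / 2)%:E)%E].
  apply: lebesgue_regularity_outer => //; last by rewrite divr_gt0.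
  by apply: le_lt_trans muW _; exact: ltry.
have mU : measurable U by exact: open_measurable.
have muU : (mu U <= (e * r)%:E)%E.
  have -> : U = W `|` (U `\` W) by rewrite setDUK.
  have mUW : measurable (U `\` W) by exact: measurableD.
  apply: le_trans (measureU2 mu mW mUW) _.
  have -> : ((e * r)%:E = (e * r / 2)%:E + (e * r / 2)%:E)%E.
    by rewrite -EFinD -splitr.
  by apply: leeD => //; exact: ltW.
(* the segments from these starting points stay in the cube by convexity *)
have xc : `|x - c| <= r by apply/cube_normP => //; exact: ltW.
have yc : `|y - c| <= r by apply/cube_normP => //; exact: ltW.
have in_cube t : 0 <= t <= s' -> cube c r (y0 + t *: w).
  move=> /andP[t0 ts]; apply/cubeP => i.
  have := coord_le_norm (x - c) i; have := coord_le_norm (y - c) i.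
  have := coord_le_norm (y0 - x') i; have := coord_le_norm eta i.
  rewrite /eta /x' !mxE => h1 h2 h3 h4.
  have {}h1 := le_trans h1 xyw; have {}h2 := le_trans h2 y0x'.
  have {}h3 := le_trans h3 yc; have {}h4 := le_trans h4 xc.
  have := @segment_in_interval R e r s (x 0 i) (y 0 i) (c 0 i) (y0 0 i) (w 0 i) t.
  by apply => //; apply/andP.
have Snear t : 0 <= t <= s' -> ~ W t -> S (y0 + t *: w).
  move=> ts nWt; apply: contrapT => nS; apply: nWt; apply: SW => //.
  by split => //; exact: in_cube.
have muW' : (mu W < (e * r)%:E)%E.
  by apply: le_lt_trans muW _; rewrite lte_fin; lra.
have [t0 /andP[t00 t0er] nWt0] : exists2 t, 0 <= t <= e * r & ~ W t.
  by apply: not_negligible_meets => //; rewrite subr0.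
have [t1 /andP[t1er t1s] nWt1] : exists2 t, s' - e * r <= t <= s' & ~ W t.
  by apply: not_negligible_meets => //; rewrite opprB addrC subrK.
pose K := [set t | t0 <= t <= t1 /\ S (y0 + t *: w)].
pose phi t := f (y0 + t *: w).
have t01 : t0 <= t1 by lra.
have Kt0 : K t0 by split; [rewrite lexx|apply: Snear => //; apply/andP; split; lra].
have Kt1 : K t1 by split; [rewrite lexx andbT|apply: Snear => //; apply/andP; split; lra].
have Kab : K `<=` `[t0, t1]%classic by move=> t [tt _]; rewrite /= in_itv.
have diff t t' : y0 + t *: w - (y0 + t' *: w) = (t - t') *: w.
  by rewrite opprD addrACA subrr add0r scalerBl.
have phiL t t' : K t -> K t' -> mdist (phi t) (phi t') <= 2 * L * `|t - t'|.
  move=> [_ St] [_ St']; apply: le_trans (fL _ _ St St') _.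
  by rewrite diff -[leRHS]mulrA [leRHS]mulrCA ler_wpM2l ?(ltW L0).
have phie i t : K t -> exists2 d, 0 < d & forall t', K t' -> `|t' - t| < d ->
     `|val (Phi (phi t')) i - val (Phi (phi t)) i| <= e * `|t' - t|.
  move=> [_ St]; have [d d0 Hd] := Sslow i _ St; exists d => // t' [_ St'] tt'.
  have E : y0 + t *: w + (t' - t) *: w = y0 + t' *: w.
    by rewrite -addrA -scalerDl; congr (_ + _ *: _); ring.
  by have := Hd (t' - t) tt'; rewrite E; apply.
have KU t : t0 <= t <= t1 -> ~ K t -> U t.
  move=> /andP[tt0 tt1] nK; apply: WU; apply: contrapT => nW; apply: nK; split.
    by rewrite tt0.
  by apply: Snear => //; apply/andP; split; lra.
have L20 : 0 <= 2 * L by rewrite mulr_ge0// ltW.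
have line := slow_curve_mdist X_complete C1 M1 X_quasi Phi_BLD L20 (ltW e0)
  Kab Kt0 Kt1 phiL phie oU KU.
have fineU : fine (mu (U `&` `[t0, t1])) <= e * r.
  have Ule : (mu (U `&` `[t0, t1]) <= (e * r)%:E)%E.
    apply: le_trans muU; apply: le_measure; rewrite ?inE//.
    by apply: measurableI => //.
  rewrite -lee_fin fineK// ge0_fin_numE//.
  by apply: le_lt_trans Ule _; exact: ltry.
have lineB : mdist (phi t0) (phi t1) <= 2 * (M * (e * r)) + 2 * (M ^+ 2 * C ^+ 2 * L * (e * r)).
  apply: le_trans line _.
  have -> : 2 * (M * (e * r)) + 2 * (M ^+ 2 * C ^+ 2 * L * (e * r)) =
      M * (e * (2 * r) + M * C * (C * (2 * L)) * (e * r)) by ring.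
  rewrite ler_pM2l// lerD//.
    rewrite ler_pM2l//; have : s' <= s by rewrite ler_piMl//; lra.
    lra.
  by rewrite ler_wpM2l// !mulr_ge0// ltW.
have S0 : S (y0 + t0 *: w) by have [] := Kt0.
have S1 : S (y0 + t1 *: w) by have [] := Kt1.
have dist0 : mdist (f x) (phi t0) <= 5 * (L * (e * r)).
  apply: le_trans (fL _ _ Sx S0) _.
  rewrite [leRHS]mulrCA ler_pM2l//.
  have -> : x - (y0 + t0 *: w) = (2 * e) *: (x - c) - (y0 - x') - t0 *: w.
    apply/rowP => i; rewrite /x' !mxE; ring.
  apply: le_trans (ler_normB _ _) _; have := ler_normB ((2 * e) *: (x - c)) (y0 - x').
  have := norm_w t0; rewrite (ger0_norm t00).
  have : `|(2 * e) *: (x - c)| <= 2 * (e * r).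
    rewrite normrZ ger0_norm ?mulr_ge0 ?(ltW e0)// -mulrA.
    by rewrite ler_wpM2l// ler_wpM2l// ltW.
  lra.
have dist1 : mdist (phi t1) (f y) <= 6 * (L * (e * r)).
  apply: le_trans (fL _ _ S1 Sy) _.
  rewrite [leRHS]mulrCA ler_pM2l//.
  have -> : y0 + t1 *: w - y = (y0 - x') - (2 * e) *: (y - c) - (1 - 2 * e) *: eta
      - (s' - t1) *: w.
    apply/rowP => i; rewrite /x' /eta /s' !mxE; ring.
  apply: le_trans (ler_normB _ _) _.
  have := ler_normB ((y0 - x') - (2 * e) *: (y - c)) ((1 - 2 * e) *: eta).
  have := ler_normB (y0 - x') ((2 * e) *: (y - c)).
  have := norm_w (s' - t1); rewrite ger0_norm ?subr_ge0//.
  have : `|(2 * e) *: (y - c)| <= 2 * (e * r).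
    rewrite normrZ ger0_norm ?mulr_ge0 ?(ltW e0)// -mulrA.
    by rewrite ler_wpM2l// ler_wpM2l// ltW.
  have : `|(1 - 2 * e) *: eta| <= e * r.
    rewrite normrZ ger0_norm//; apply: le_trans xyw; rewrite ler_piMl//; lra.
  lra.
have := metric_triangle (f x) (phi t0) (f y).
have := metric_triangle (phi t0) (phi t1) (f y).
by rewrite /tube_constant; lra.
Qed.

Lemma tube_constant_gt0 : 0 < tube_constant.
Proof.
have M0 : 0 < M by exact: lt_le_trans M1.
have C0 : 0 < C by exact: lt_le_trans C1.
by rewrite /tube_constant !addr_gt0 ?mulr_gt0 ?exprn_gt0.
Qed.

(** A cube is a union of [(6 * N + 1) ^ k'] tubes of width of the order of
    its side over [N]; the exponent [k'] instead of [k] gains the factor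
    [N%:R^-1] over the volume. *)
Lemma tubes_content (S : set V) (w c : V) (j : 'I_k) (N : nat) (r delta : R) :
  (forall x y, S x -> S y -> mdist (f x) (f y) <= L * `|x - y|) ->
  slow_along S w N%:R^-1 -> w 0 j = 1 -> `|w| <= 2 -> (8 <= N)%N -> 0 < r ->
  tube_constant * r <= delta ->
  (leb (cube c r `\` S) < (tube_defect N%:R^-1 r)%:E)%E ->
  (hausdorff_content k delta (f @` (S `&` cube c r)) <=
    (7 ^+ k' * tube_constant ^+ k / N%:R * r ^+ k)%:E)%E.
Proof.
move=> fL Sslow wj w2 N8 r0 rdelta QS.
have A0 := tube_constant_gt0.
have N0 : 0 < N%:R :> R by rewrite ltr0n (leq_trans _ N8).
have e0 : 0 < N%:R^-1 :> R by rewrite invr_gt0.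
have e8 : N%:R^-1 <= 8^-1 :> R by rewrite lef_pV2 ?posrE// ler_nat.
have er0 : 0 < N%:R^-1 * r by rewrite mulr_gt0.
pose D := tube_constant * (N%:R^-1 * r).
have D0 : 0 < D by rewrite mulr_gt0.
have Dd : D <= delta.
  apply: le_trans rdelta; rewrite ler_pM2l// ler_piMl ?(ltW r0)//.
  by apply: le_trans e8 _; rewrite invf_le1// ler1n.
(* the coordinates of the projection along [w] to the hyperplane of the [j]-th
   coordinate *)
pose z (x : V) (i : 'I_k') : R :=
  x 0 (lift j i) - c 0 (lift j i) - (x 0 j - c 0 j) * w 0 (lift j i).
have z_le x i : cube c r x -> `|z x i| <= 3 * r.
  move=> /cubeP xc; apply: le_trans (ler_normB _ _) _.
  have := xc (lift j i); have := xc j; rewrite normrM => h1 h2.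
  have := le_trans (coord_le_norm w (lift j i)) w2 => h3.
  have : `|x 0 j - c 0 j| * `|w 0 (lift j i)| <= r * 2 by apply: ler_pM.
  lra.
pose ix x i := Num.truncn ((z x i + 3 * r) / (N%:R^-1 * r)).
have ix_lt x i : cube c r x -> (ix x i < (6 * N).+1)%N.
  move=> Qx; rewrite ltnS /ix truncn_le_nat ltr_pdivrMr//.
  have := z_le x i Qx; rewrite ler_norml => /andP[_ h].
  have -> : (6 * N).+1%:R * (N%:R^-1 * r) = 6 * r + N%:R^-1 * r.
    by rewrite -natr1 natrM; field; rewrite gt_eqF.
  lra.
pose J := {ffun 'I_k' -> 'I_(6 * N).+1}.
pose tube (p : J) := [set x | [/\ S x, cube c r x & forall i, ix x i = p i]].
have tube_diam p x y : tube p x -> tube p y -> mdist (f x) (f y) <= D.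
  move=> [Sx Qx px] [Sy Qy py].
  have near_dir x1 y1 : cube c r x1 -> cube c r y1 -> (forall i, ix x1 i = ix y1 i) ->
      `|y1 - x1 - (y1 0 j - x1 0 j) *: w| <= N%:R^-1 * r.
    move=> Qx1 Qy1 xy1; apply/row_norm_leP => [|i]; first exact: ltW.
    rewrite !mxE; case: (unliftP j i) => [i' ->|->]; last first.
      by rewrite wj mulr1 subrr normr0 ltW.
    have -> : y1 0 (lift j i') - x1 0 (lift j i') - (y1 0 j - x1 0 j) * w 0 (lift j i') =
        z y1 i' - z x1 i' by rewrite /z; ring.
    have trunc_near v : `|v| <= 3 * r ->
        (Num.truncn ((v + 3 * r) / (N%:R^-1 * r)))%:R * (N%:R^-1 * r) <= v + 3 * r <
        (Num.truncn ((v + 3 * r) / (N%:R^-1 * r)))%:R * (N%:R^-1 * r) + N%:R^-1 * r.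
      rewrite ler_norml => /andP[v1 v2].
      have /truncn_itv : 0 <= (v + 3 * r) / (N%:R^-1 * r).
        by rewrite divr_ge0 ?(ltW er0)//; lra.
      by rewrite ler_pdivlMr// ltr_pdivrMr// -[(Num.truncn _).+1%:R]natr1 [(_ + 1) * _]mulrDl mul1r.
    have /andP[] := trunc_near _ (z_le x1 i' Qx1).
    have /andP[] := trunc_near _ (z_le y1 i' Qy1).
    have := xy1 i'; rewrite /ix => ->.
    set T := _%:R * _ => h1 h2 h3 h4.
    by rewrite ler_norml; apply/andP; split; lra.
  have xy i : ix x i = ix y i by rewrite px py.
  have /andP[y0 y2] : - (2 * r) <= y 0 j - x 0 j <= 2 * r.
    have /cubeP/(_ j) := Qx; have /cubeP/(_ j) := Qy; rewrite !ler_norml.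
    by move=> /andP[? ?] /andP[? ?]; apply/andP; split; lra.
  have e08 : 0 < (N%:R^-1 : R) <= 8^-1 by rewrite e0.
  have [xjyj|/ltW yjxj] := leP (x 0 j) (y 0 j).
    apply: (tube_mdist fL Sslow w2 e08 r0 QS Sx Sy Qx Qy (s := y 0 j - x 0 j)).
      by rewrite subr_ge0 xjyj.
    exact: near_dir.
  rewrite metric_sym.
  apply: (tube_mdist fL Sslow w2 e08 r0 QS Sy Sx Qy Qx (s := x 0 j - y 0 j)).
    by rewrite subr_ge0 yjxj/=; lra.
  by apply: near_dir => // i; rewrite xy.
apply: (@le_trans _ _ (hausdorff_content k delta (\bigcup_p (f @` tube p)))).
  apply: le_hausdorff_content => _ [x [Sx Qx] <-].
  exists [ffun i => Ordinal (ix_lt x i Qx)] => //; exists x => //.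
  by split => // i; rewrite ffunE.
apply: (@le_trans _ _ (#|J|%:R * D ^+ k)%:E).
  apply: hausdorff_content_finite => [|p]; first exact: le_trans (ltW D0) Dd.
  apply: hausdorff_content_diam; first by rewrite (ltW D0).
  by move=> _ _ [x px <-] [y py <-]; exact: tube_diam px py.
rewrite lee_fin card_ffun !card_ord natrX /D !exprMn exprVn.
have N7 : (6 * N).+1%:R <= 7 * N%:R :> R.
  by rewrite -natrM ler_nat -addn1 (mulnDl 6 1) mul1n leq_add2l (leq_trans _ N8).
have : (6 * N).+1%:R ^+ k' <= (7 * N%:R) ^+ k' :> R.
  by apply: lerXn2r N7; rewrite nnegrE// mulr_ge0.
rewrite exprMn => H; apply: (le_trans (ler_wpM2r _ H)).
  by rewrite !mulr_ge0 ?exprn_ge0 ?invr_ge0 ?exprn_ge0// ltW.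
rewrite le_eqVlt; apply/orP; left; apply/eqP.
rewrite ![_ ^+ k]exprS; field.
by rewrite !gt_eqF ?exprn_gt0.
Qed.

Definition slow_constant : R := 7 ^+ k' * tube_constant ^+ k.

(** Cubes in which [S] is not dense have small total measure, because they come
    from an efficient cover of [S]. *)
Lemma slow_content (S : set V) (w : V) (j : 'I_k) (N : nat) (delta : R) :
  lebesgue_measurable S -> (leb S < +oo)%E ->
  (forall x y, S x -> S y -> mdist (f x) (f y) <= L * `|x - y|) ->
  slow_along S w N%:R^-1 -> w 0 j = 1 -> `|w| <= 2 -> (8 <= N)%N -> 0 < delta ->
  (hausdorff_content k delta (f @` S) <= (slow_constant / N%:R)%:E * leb S)%E.
Proof.
move=> mS Soo fL Sslow wj w2 N8 delta0.
have A0 := tube_constant_gt0.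
have N0 : 0 < N%:R :> R by rewrite ltr0n (leq_trans _ N8).
have e0 : 0 < N%:R^-1 :> R by rewrite invr_gt0.
pose B := slow_constant / N%:R.
have B0 : 0 < B by rewrite /B /slow_constant !mulr_gt0 ?exprn_gt0.
(* [B] is the rate in cubes where [S] is dense; in the others the measure of the
   complement of [S], times [G], exceeds the bound given by the Lipschitz constant *)
pose G := (2 * L) ^+ k * 4 / (N%:R^-1 * (2 * N%:R^-1) ^+ k).
have G0 : 0 < G by rewrite /G divr_gt0 ?mulr_gt0 ?exprn_gt0// mulr_gt0.
have Sfin : leb S \is a fin_num by rewrite ge0_fin_numE// outer_measure_ge0.
apply/lee_addgt0Pr => eta eta0.
pose e := eta / (B + G).
have BG0 : 0 < B + G by rewrite addr_gt0.
have ee0 : 0 < e by rewrite divr_gt0.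
pose d := Num.min (delta / tube_constant) (delta / (2 * L)).
have d0 : 0 < d by rewrite lt_min !divr_gt0// mulr_gt0.
have Se : (leb S < (fine (leb S) + e)%:E)%E by rewrite EFinD fineK// lteDl.
have [c [c0 Sc ce]] := small_cube_cover d0 Se.
pose Q n := cube (c n).1 (c n).2.
pose a n : R := ((c n).2 *+ 2) ^+ k.
pose b n : R := fine (leb (S `&` Q n)).
have r0 n : 0 <= (c n).2 by have /andP[] := c0 n.
have SQle n : (leb (S `&` Q n) <= (a n)%:E)%E.
  by apply: (lebesgue_outer_cube_le (x := (c n).1)) => // x [].
have bE n : leb (S `&` Q n) = (b n)%:E.
  rewrite fineK// ge0_fin_numE ?outer_measure_ge0//.
  by apply: le_lt_trans (SQle n) _; exact: ltry.
have b0 n : 0 <= b n by rewrite fine_ge0// outer_measure_ge0.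
have ba n : b n <= a n by rewrite -lee_fin -bE.
have a0 n : 0 <= a n by exact: le_trans (ba n).
have QSE n : (leb (Q n `\` S) = (a n - b n)%:E)%E.
  have := mS (Q n); rewrite -setDE lebesgue_outer_cube// [Q n `&` S]setIC bE => aE.
  by rewrite EFinB [(a n)%:E]aE addeAC subee// add0e.
have piece n : (hausdorff_content k delta (f @` (S `&` Q n)) <=
    (B * a n + G * (a n - b n))%:E)%E.
  have [rE|rN] := eqVneq (c n).2 0.
    apply: (@le_trans _ _ (0 ^+ k)%:E); last first.
      by rewrite lee_fin expr0n/= addr_ge0// mulr_ge0// ?subr_ge0// ltW.
    apply: hausdorff_content_diam; first by rewrite lexx ltW.
    move=> _ _ [x [Sx]] + <- [y [Sy]] + <-.
    rewrite /Q rE => /(cube_normP _ _ (lexx 0)) xc /(cube_normP _ _ (lexx 0)) yc.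
    have -> : x = y.
      by apply/eqP; rewrite -subr_eq0 -normr_le0; have := ler_normB (x - (c n).1)
        (y - (c n).1); rewrite opprB addrA subrK; lra.
    by rewrite mdistxx.
  have rp : 0 < (c n).2 by rewrite lt_neqAle eq_sym rN r0.
  have /andP[_ rd] := c0 n.
  have rA : tube_constant * (c n).2 <= delta.
    rewrite mulrC -ler_pdivlMr//; apply: le_trans rd _; by rewrite ge_min lexx.
  have rL : 2 * L * (c n).2 <= delta.
    rewrite mulrC -ler_pdivlMr ?mulr_gt0//; apply: le_trans rd _.
    by rewrite ge_min lexx orbT.
  have [good|bad] := ltP (leb (Q n `\` S)) (tube_defect N%:R^-1 (c n).2)%:E.
    apply: le_trans (tubes_content fL Sslow wj w2 N8 rp rA good) _.
    rewrite lee_fin -[leLHS]addr0; apply: lerD; last first.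
      by rewrite mulr_ge0 ?subr_ge0// ltW.
    rewrite ler_pM2l// /a; apply: lerXn2r; rewrite ?nnegrE// ?mulrn_wge0//.
    by rewrite mulr2n lerDl.
  apply: (@le_trans _ _ ((2 * L * (c n).2) ^+ k)%:E).
    apply: hausdorff_content_diam; first by rewrite rL !mulr_ge0// ltW.
    move=> _ _ [x [Sx Qx] <-] [y [Sy Qy] <-].
    have xc := (cube_normP _ _ (r0 n)).1 Qx; have yc := (cube_normP _ _ (r0 n)).1 Qy.
    apply: le_trans (fL _ _ Sx Sy) _; rewrite -[leRHS]mulrA [leRHS]mulrCA ler_pM2l//.
    by have := ler_distD (c n).1 x y; rewrite [`|(c n).1 - y|]distrC; lra.
  rewrite lee_fin; apply: (@le_trans _ _ (G * tube_defect N%:R^-1 (c n).2)).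
    rewrite /G /tube_defect !exprMn le_eqVlt; apply/orP; left; apply/eqP.
    by field; rewrite !gt_eqF// exprn_gt0.
  rewrite -[leLHS]add0r; apply: lerD; first by rewrite mulr_ge0// ltW.
  by rewrite ler_pM2l// -lee_fin -QSE.
have Sb : (leb S <= \sum_(0 <= n <oo) (b n)%:E)%E.
  apply: (@le_trans _ _ (leb (\bigcup_n (S `&` Q n)))).
    by apply: le_outer_measure => x Sx; have [n _ Qx] := Sc x Sx; exists n.
  apply: (le_trans (outer_measure_sigma_subadditive _ _)).
  by apply: lee_nneseries => [n _ _|n _]; [exact: outer_measure_ge0|rewrite -bE].
have ab0 n : 0 <= a n - b n by rewrite subr_ge0.
have sum_ab : (\sum_(0 <= n <oo) (a n - b n)%:E <= e%:E)%E.
  have : (\sum_(0 <= n <oo) (a n)%:E = \sum_(0 <= n <oo) (b n)%:E +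
      \sum_(0 <= n <oo) (a n - b n)%:E)%E.
    rewrite -nneseriesD; [|by move=> n _ _; rewrite lee_fin..].
    by apply: eq_eseriesr => n _; rewrite -EFinD addrC subrK.
  move=> aE; rewrite -(@leeD2lE _ (leb S))//.
  apply: (@le_trans _ _ (\sum_(0 <= n <oo) (a n)%:E)%E).
    by rewrite aE; exact: leeD2r.
  by apply: le_trans (ltW ce) _; rewrite EFinD fineK.
apply: (@le_trans _ _ (hausdorff_content k delta (\bigcup_n (f @` (S `&` Q n))))).
  apply: le_hausdorff_content => _ [x Sx <-].
  by have [n _ Qx] := Sc x Sx; exists n => //; exists x.
apply: le_trans (hausdorff_content_subadditive _ _ _) _.
apply: (@le_trans _ _ (\sum_(0 <= n <oo) ((B * a n)%:E + (G * (a n - b n))%:E))%E).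
  apply: lee_nneseries => [n _ _|n _]; first exact: hausdorff_content_ge0.
  by rewrite -EFinD; exact: piece.
rewrite nneseriesD; last 2 first.
- by move=> n _ _; rewrite lee_fin mulr_ge0// ltW.
- by move=> n _ _; rewrite lee_fin mulr_ge0// ltW.
rewrite (eq_eseriesr (fun n _ => EFinM B (a n))) nneseriesZl; last by move=> n _; rewrite lee_fin.
rewrite (eq_eseriesr (fun n _ => EFinM G (a n - b n))) nneseriesZl; last by move=> n _; rewrite lee_fin.
apply: (@le_trans _ _ (B%:E * (fine (leb S) + e)%:E + G%:E * e%:E)%E).
  apply: leeD; apply: lee_wpmul2l; rewrite ?lee_fin ?(ltW B0) ?(ltW G0)//.
  exact: ltW.
rewrite -{2}(fineK Sfin) -!EFinM -!EFinD lee_fin.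
have -> : B * (fine (leb S) + e) + G * e = B * fine (leb S) + e * (B + G) by ring.
by rewrite /e divfK// gt_eqF.
Qed.

End slow_direction.

(** * Approximate derivatives of Lipschitz functions *)

Section lipschitz_extension.
Context {R : realType} {k : nat}.
Implicit Types (E : set 'rV[R]_k) (g : 'rV[R]_k -> R).

(** McShane's extension: the infimum of the cones [g y + L * `|x - y|]. *)
Lemma mcshane_extension E g L : 0 <= L ->
  (forall x y, E x -> E y -> `|g x - g y| <= L * `|x - y|) ->
  exists h, (forall x, E x -> h x = g x) /\
    forall x y, `|h x - h y| <= L * `|x - y|.
Proof.
move=> L0 gL; have [[x0 Ex0]|E0] := pselect (E !=set0); last first.
  exists (fun=> 0); split=> [x Ex|x y]; first by case: E0; exists x.
  by rewrite subrr normr0 mulr_ge0.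
pose A x := [set g y + L * `|x - y| | y in E].
have A_inf x : has_inf (A x).
  split; first by exists (g x0 + L * `|x - x0|), x0.
  exists (g x0 - L * `|x - x0|) => _ [y Ey <-].
  have : L * `|x0 - y| <= L * `|x - x0| + L * `|x - y|.
    by rewrite -mulrDr ler_wpM2l// (le_trans (ler_distD x _ _))// [`|x0 - x|]distrC.
  by have := gL _ _ Ex0 Ey; rewrite ler_norml => /andP[? ?]; lra.
have infL x y : inf (A x) <= inf (A y) + L * `|x - y|.
  rewrite -lerBlDr; apply: lb_le_inf; first by have [] := A_inf y.
  move=> _ [z Ez <-]; rewrite lerBlDr.
  apply: (@le_trans _ _ (g z + L * `|x - z|)).
    by apply: ge_inf; [have [] := A_inf x|exists z].
  rewrite -addrA lerD2l -mulrDr ler_wpM2l//.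
  by apply: le_trans (ler_distD y _ _) _; rewrite addrC.
exists (fun x => inf (A x)); split=> [x Ex|x y].
  apply: le_anti; apply/andP; split.
    apply: ge_inf; [by have [] := A_inf x|exists x => //].
    by rewrite subrr normr0 mulr0 addr0.
  apply: lb_le_inf; first by have [] := A_inf x.
  move=> _ [y Ey <-]; rewrite -lerBlDl; apply: le_trans (gL _ _ Ex Ey).
  exact: ler_norm.
by rewrite ler_distl; apply/andP; split; rewrite ?lerBlDr; [rewrite distrC|]; exact: infL.
Qed.

End lipschitz_extension.

Section density_points.
Context {R : realType} {k' : nat}.
Local Notation k := k'.+1.
Local Notation V := 'rV[R]_k.
Local Notation leb := (@lebesgue_outer R k).
Implicit Types (A E : set V) (x y z : V).

Let k0 : 0 < k%:R :> R. Proof. by rewrite ltr0n. Qed.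

Let ball_sub_cube x r : 0 <= r -> euclidean_ball x r `<=` cube x r.
Proof.
by move=> r0 y xy; apply/cube_normP => //; apply: le_trans (norm_le_euclidean _) (ltW xy).
Qed.

Let cube_sub_ball x y d r : 0 <= d -> k%:R * (`|y - x| + d) < r ->
  cube y d `<=` euclidean_ball x r.
Proof.
move=> d0 dr z /(cube_normP _ _ d0) zy; rewrite /euclidean_ball /=.
apply: le_lt_trans (euclidean_le_norm _) _; apply: le_lt_trans dr.
rewrite ler_pM2l//; rewrite -[z - x](subrKA y) addrC.
by apply: le_trans (ler_normD _ _) _; rewrite lerD2l.
Qed.

Let ball_fin x r B : 0 <= r -> leb (B `&` euclidean_ball x r) \is a fin_num.
Proof.
move=> r0; rewrite ge0_fin_numE ?outer_measure_ge0//.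
apply: (@le_lt_trans _ _ ((r *+ 2) ^+ k)%:E); last exact: ltry.
by apply: (lebesgue_outer_cube_le (x := x)) => // y [_ /ball_sub_cube]; apply.
Qed.

Let ball_fin' x r : 0 <= r -> leb (euclidean_ball x r) \is a fin_num.
Proof. by move=> r0; rewrite -[euclidean_ball x r]setTI; exact: ball_fin. Qed.

Let ball_le x r : 0 <= r -> fine (leb (euclidean_ball x r)) <= (2 * r) ^+ k.
Proof.
move=> r0; rewrite -lee_fin fineK ?ball_fin'// mulr_natl.
by apply: (lebesgue_outer_cube_le (x := x)) => //; exact: ball_sub_cube.
Qed.

Let ball_ge x r : 0 < r -> (r / k%:R) ^+ k <= fine (leb (euclidean_ball x r)).
Proof.
move=> r0; rewrite -lee_fin fineK ?ball_fin' ?(ltW r0)//.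
have d0 : 0 <= r / k%:R / 2 by rewrite !divr_ge0// ltW.
rewrite [r / k%:R]splitr -mulr2n.
rewrite -(lebesgue_outer_cube x)//; apply: le_outer_measure; apply: cube_sub_ball => //.
have -> : k%:R * (`|x - x| + r / k%:R / 2) = r / 2.
  by rewrite subrr normr0 add0r; field; rewrite gt_eqF.
by rewrite ltr_pdivrMr// ltr_pMr// ltr1n.
Qed.

Lemma density_pointP A x : density_point A x <-> forall c, 0 < c ->
  exists2 r0, 0 < r0 & forall r, 0 < r < r0 ->
    `|1 - fine (leb (A `&` euclidean_ball x r)) / fine (leb (euclidean_ball x r))| < c.
Proof.
rewrite /density_point; split=> [/cvgrPdist_lt H c /H|H].
  rewrite /prop_near1 /nbhs /= /at_right /within /= => /nbhs_ballP[r0 /= r00 Hr0].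
  exists r0 => // r /andP[r_gt0 rr0]; apply: Hr0 => //=.
  by rewrite /ball /= sub0r normrN gtr0_norm.
apply/cvgrPdist_lt => c /H[r0 r00 Hr0].
rewrite /prop_near1 /nbhs /= /at_right /within /=; apply/nbhs_ballP; exists r0 => //= r.
rewrite /ball /= sub0r normrN => rr0 r_gt0; apply: Hr0.
by move: rr0; rewrite gtr0_norm// r_gt0.
Qed.

(** A set with a density point [x] has no holes near [x] of size comparable to
    their distance from [x]. *)
Lemma density_point_near A x e : density_point A x -> 0 < e <= 1 ->
  exists2 r0, 0 < r0 & forall y, y != x -> `|y - x| < r0 ->
    exists2 z, A z & `|z - y| <= e * `|y - x|.
Proof.
move=> /density_pointP Ax /andP[e0 e1].
(* the cube of radius [e * d] at [y] lies in the ball of radius [3 * k%:R * d] at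
   [x] and has at least the fraction [c] of its measure *)
pose c := (e / (3 * k%:R)) ^+ k.
have c0 : 0 < c by rewrite exprn_gt0// divr_gt0// mulr_gt0.
have [r0 r00 Hr0] := Ax c c0.
exists (r0 / (3 * k%:R)); first by rewrite divr_gt0// mulr_gt0.
move=> y yx yr0.
have d0 : 0 < `|y - x| by rewrite normr_gt0 subr_eq0.
set d := `|y - x| in d0 yr0 *.
apply: contrapT => noz; pose r := 3 * k%:R * d.
have r_gt0 : 0 < r by rewrite !mulr_gt0.
have rr0 : r < r0 by rewrite /r mulrC -ltr_pdivlMr ?mulr_gt0.
have ed0 : 0 < e * d by rewrite mulr_gt0.
have cB : cube y (e * d) `<=` euclidean_ball x r.
  apply: cube_sub_ball; first exact: ltW.
  have : e * d <= d by rewrite ler_piMl// ltW.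
  rewrite -/d /r (_ : 3 * k%:R * d = k%:R * (3 * d)); last by ring.
  by rewrite ltr_pM2l//; lra.
have AB : A `&` euclidean_ball x r `<=` euclidean_ball x r `\` cube y (e * d).
  move=> z [Az Bz]; split => // /(cube_normP _ _ (ltW ed0)) zy.
  by apply: noz; exists z.
have Bfin := ball_fin' x (ltW r_gt0).
have Boo : (leb (euclidean_ball x r) < +oo)%E.
  by move: Bfin; rewrite ge0_fin_numE ?outer_measure_ge0.
have lebD := lebesgue_outer_setD Boo cB (measurable_box _).
rewrite lebesgue_outer_cube ?(ltW ed0)// in lebD.
have B0 : 0 < fine (leb (euclidean_ball x r)).
  by apply: lt_le_trans (ball_ge x r_gt0); rewrite exprn_gt0// divr_gt0.
have : fine (leb (A `&` euclidean_ball x r)) <=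
    fine (leb (euclidean_ball x r)) - (e * d *+ 2) ^+ k.
  rewrite -lee_fin fineK ?ball_fin ?(ltW r_gt0)// EFinB fineK// -lebD.
  exact: le_outer_measure.
move=> ratio.
have := Hr0 r; rewrite r_gt0 rr0 => /(_ isT); apply/negP; rewrite -leNgt.
apply: le_trans (ler_norm _).
have -> : 1 - fine (leb (A `&` euclidean_ball x r)) / fine (leb (euclidean_ball x r)) =
   (fine (leb (euclidean_ball x r)) - fine (leb (A `&` euclidean_ball x r))) /
   fine (leb (euclidean_ball x r)) by field; rewrite gt_eqF.
rewrite ler_pdivlMr//; apply: (@le_trans _ _ ((e * d *+ 2) ^+ k)); last lra.
apply: (@le_trans _ _ (c * (2 * r) ^+ k)).
  by rewrite ler_pM2l// ball_le// ltW.
rewrite /c -exprMn le_eqVlt; apply/orP; left; apply/eqP; congr (_ ^+ k).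
by rewrite /r -mulr_natr; field; rewrite gt_eqF.
Qed.

(** Balls and cubes of comparable radii have comparable measures, and density at [x]
    depends only on the part of the set near [x]. *)
Lemma density_point_of_cube A E x rho : 0 < rho -> cube_density_point E x ->
  (forall y, E y -> `|y - x| < rho -> A y) -> density_point A x.
Proof.
move=> rho0 Ex EA; apply/density_pointP => c c0.
have c'0 : 0 < c / 2 / k%:R ^+ k by rewrite !divr_gt0// exprn_gt0.
have [r0 r00 Hr0] := Ex _ c'0.
exists (Num.min r0 rho) => [|r]; first by rewrite lt_min r00.
rewrite lt_min => /andP[r_gt0 /andP[rr0 rrho]].
have B0 : 0 < fine (leb (euclidean_ball x r)).
  by apply: lt_le_trans (ball_ge x r_gt0); rewrite exprn_gt0// divr_gt0.
have Bfin := ball_fin' x (ltW r_gt0); have ABfin := ball_fin x A (ltW r_gt0).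
have le1 : fine (leb (A `&` euclidean_ball x r)) <= fine (leb (euclidean_ball x r)).
  by rewrite fine_le//; apply: le_outer_measure => y [].
have le2 : fine (leb (euclidean_ball x r)) <=
    fine (leb (A `&` euclidean_ball x r)) + c / 2 / k%:R ^+ k * r ^+ k.
  rewrite -lee_fin EFinD !fineK//.
  apply: (@le_trans _ _ (leb (A `&` euclidean_ball x r) + leb (cube x r `\` E))%E).
    apply: le_trans (outer_measureU2 _ _ _); apply: le_outer_measure => y By.
    have [Ay|nAy] := pselect (A y); [by left|right; split].
      exact: ball_sub_cube (ltW r_gt0) _ By.
    move=> Ey; apply: nAy; apply: EA => //.
    by apply: le_lt_trans (norm_le_euclidean _) _; exact: lt_trans By rrho.
  by apply: leeD => //; apply: Hr0; rewrite r_gt0.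
have -> : 1 - fine (leb (A `&` euclidean_ball x r)) / fine (leb (euclidean_ball x r)) =
   (fine (leb (euclidean_ball x r)) - fine (leb (A `&` euclidean_ball x r))) /
   fine (leb (euclidean_ball x r)) by field; rewrite gt_eqF.
rewrite ger0_norm ?divr_ge0 ?subr_ge0 ?(ltW B0)// ltr_pdivrMr//.
apply: (@le_lt_trans _ _ (c / 2 * (r / k%:R) ^+ k)).
  rewrite expr_div_n mulrA -mulrAC; lra.
apply: (@lt_le_trans _ _ (c * (r / k%:R) ^+ k)).
  by rewrite ltr_pM2r ?exprn_gt0 ?divr_gt0//; lra.
by rewrite ler_pM2l// ball_ge.
Qed.

End density_points.

Section linear_forms.
Context {R : realType} {k : nat}.
Local Notation V := 'rV[R]_k.
Implicit Types (D : nat -> V) (u v a : V).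

Definition linear_form a v : R := \sum_(j < k) a 0 j * v 0 j.

Lemma linear_formE a v : linear_form a v = (v *m a^T) 0 0.
Proof. by rewrite mxE; apply: eq_bigr => j _; rewrite mxE mulrC. Qed.

Lemma linear_formD a u v : linear_form a (u + v) = linear_form a u + linear_form a v.
Proof. by rewrite !linear_formE mulmxDl mxE. Qed.

Lemma linear_formZ a t v : linear_form a (t *: v) = t * linear_form a v.
Proof. by rewrite !linear_formE -scalemxAl mxE. Qed.

Lemma linear_form0 a : linear_form a 0 = 0.
Proof. by rewrite linear_formE mul0mx mxE. Qed.

Lemma linear_form_le a v (s : R) : `|v| <= s ->
  `|linear_form a v| <= (\sum_(j < k) `|a 0 j|) * s.
Proof.
move=> vs; apply: le_trans (ler_norm_sum _ _ _) _; rewrite mulr_suml.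
apply: ler_sum => j _; rewrite normrM ler_wpM2l//.
exact: le_trans (coord_le_norm _ _) vs.
Qed.

Lemma rank_rows_lt_orthogonal D : (rank_rows D < k)%N ->
  exists2 v, v != 0 & forall i, linear_form (D i) v = 0.
Proof.
rewrite /rank_rows; have [DU _] := rowspanP D; move: (rowspan D) DU => U DU dimU.
pose A := \matrix_(i < \dim U) (vbasis U)`_i.
have : kermx A^T != 0.
  rewrite -mxrank_eq0 mxrank_ker subn_eq0 -ltnNge.
  by apply: leq_ltn_trans (rank_leq_col _) dimU.
move=> /rowV0Pn[v /sub_kermxP vA v0]; exists v => // i.
have Av (l : 'I_(\dim U)) : v *m ((vbasis U)`_l)^T = 0.
  have := congr1 (fun B => col l B) vA; rewrite col0 => <-.
  rewrite colE -mulmxA -colE; congr (_ *m _).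
  by apply/matrixP => r s; rewrite !mxE (ord1 s).
rewrite linear_formE (coord_vbasis (DU i)) linear_sum/= mulmx_sumr.
rewrite big1 ?mxE// => l _; by rewrite linearZ/= -scalemxAr Av scaler0.
Qed.

(** Finitely many rows already span the space, so the coordinates of [v] are fixed
    combinations of the values of these rows at [v]. *)
Lemma rank_rows_full_bound D : rank_rows D = k -> exists n (c : R), 0 < c /\
  forall v (s : R), (forall i, (i < n)%N -> `|linear_form (D i) v| <= s) ->
    0 <= s -> `|v| <= c * s.
Proof.
rewrite /rank_rows; have [_ Umin] := rowspanP D; move: (rowspan D) Umin => U Umin dimU.
pose S n : {vspace V} := <<mkseq D n>>%VS.
have [n Sn] : exists n, forall m, (\dim (S m) <= \dim (S n))%N.
  apply: contrapT => /forallNP H.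
  have big d : exists n, (d <= \dim (S n))%N.
    elim: d => [|d [n dn]]; first by exists 0%N.
    have /existsNP[m /negP] := H n; rewrite -ltnNge => nm.
    by exists m; exact: leq_ltn_trans dn nm.
  have [n] := big k.+1; have := dimvS (subvf (S n)).
  by rewrite dimvf /dim/= mul1n => /leq_ltn_trans/[apply]; rewrite ltnn.
have DS i : D i \in S n.
  have sub : (S n <= S (maxn n i.+1))%VS.
    apply: sub_span => u /mapP[l]; rewrite mem_iota add0n => /= ln ->.
    by apply: map_f; rewrite mem_iota/= add0n leq_max ln.
  have /eqP -> : S n == S (maxn n i.+1) by rewrite eqEdim sub Sn.
  by apply: memv_span; apply: map_f; rewrite mem_iota add0n/= leq_max ltnSn orbT.
have Sfull v : v \in S n.
  have -> : S n = fullv; last exact: memvf.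
  apply/eqP; rewrite eqEdim subvf/= dimvf /dim/= mul1n -[leqLHS]dimU.
  by apply: dimvS; exact: Umin.
have spanE v : v = \sum_(i < n) coord (in_tuple (mkseq D n)) (cast_ord (esym (size_mkseq D n)) i) v *: D i.
  have Sv : v \in <<in_tuple (mkseq D n)>>%VS := Sfull v.
  rewrite {1}(coord_span Sv) (reindex (cast_ord (esym (size_mkseq D n))))/=; last first.
    by exists (cast_ord (size_mkseq D n)) => i _; rewrite ?cast_ordK ?cast_ordKV.
  by apply: eq_bigr => i _; rewrite nth_mkseq.
pose co i v := coord (in_tuple (mkseq D n)) (cast_ord (esym (size_mkseq D n)) i) v.
pose c := 1 + \sum_(j < k) \sum_(i < n) `|co i (delta_mx 0 j)|.
have c0 : 0 < c by rewrite ltr_pwDl// !sumr_ge0// => j _; rewrite sumr_ge0.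
exists n, c; split => // v s vs s0; apply/row_norm_leP => [|j].
  by rewrite mulr_ge0// ltW.
have -> : v 0 j = \sum_(i < n) co i (delta_mx 0 j) * linear_form (D i) v.
  have -> : v 0 j = (v *m (@delta_mx R 1 k 0 j)^T) 0 0.
    by rewrite trmx_delta -colE mxE.
  rewrite {1}(spanE (delta_mx 0 j)) linear_sum/= mulmx_sumr summxE.
  by apply: eq_bigr => i _; rewrite linearZ/= -scalemxAr mxE linear_formE.
apply: le_trans (ler_norm_sum _ _ _) _.
apply: (@le_trans _ _ (\sum_(i < n) `|co i (delta_mx 0 j)| * s)).
  by apply: ler_sum => i _; rewrite normrM ler_wpM2l// vs.
rewrite -mulr_suml ler_wpM2r// /c; apply: (@le_trans _ _ (\sum_(j < k) \sum_(i < n) `|co i (delta_mx 0 j)|)).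
  by rewrite (bigD1 j)//= lerDl; apply: sumr_ge0 => l _; apply: sumr_ge0.
by rewrite lerDr.
Qed.

End linear_forms.

(** An approximate derivative of a restriction is a derivative of any Lipschitz
    extension, since the set along which it is a limit comes close to every
    point near [x]. *)
Lemma ap_derivative_extension {R : realType} {k' : nat} (E : set 'rV[R]_k'.+1)
    (g h : 'rV[R]_k'.+1 -> R) (x D : 'rV[R]_k'.+1) (L : R) :
  0 <= L -> (forall y z, `|h y - h z| <= L * `|y - z|) ->
  (forall y, E y -> h y = g y) -> E x -> is_ap_derivative E g x D ->
  forall e, 0 < e -> exists2 r, 0 < r & forall y, `|y - x| < r ->
    `|h y - h x - linear_form D (y - x)| <= e * `|y - x|.
Proof.
move=> L0 hL hg Ex gD e e0; set k := k'.+1.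
have k0 : 0 < k%:R :> R by rewrite ltr0n.
pose N := \sum_(j < k) `|D 0 j|.
have N0 : 0 <= N by apply: sumr_ge0.
have e10 : 0 < e / (4 * k%:R) by rewrite divr_gt0// mulr_gt0.
pose q := e / (4 * (L + N + 1)).
have q0 : 0 < q by rewrite divr_gt0// mulr_gt0// ltr_wpDl// addr_ge0.
have q10 : 0 < Num.min 1 q <= 1 by rewrite lt_min ltr01 q0 ge_min lexx.
have [r r0 near] := density_point_near (gD _ e10) q10.
exists r => // y yr; have [->|yx] := eqVneq y x.
  by rewrite !subrr linear_form0 subr0 !normr0 mulr0.
have [z [Ez zD] zy] := near y yx yr.
set d := `|y - x| in zy *; have d0 : 0 < d by rewrite normr_gt0 subr_eq0.
have zyd : `|z - y| <= d.
  by apply: le_trans zy _; rewrite ler_piMl ?(ltW d0)// ge_min lexx.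
have zyq : `|z - y| <= q * d.
  by apply: le_trans zy _; rewrite ler_wpM2r ?(ltW d0)// ge_min lexx orbT.
have zx : `|z - x| <= 2 * d.
  rewrite -[z - x](subrKA y); apply: le_trans (ler_normD _ _) _.
  by rewrite mulr2n mulrDl mul1r lerD.
have main : `|h z - h x - linear_form D (z - x)| <= e / 2 * d.
  have [zE|zxN] := eqVneq z x.
    by rewrite zE !subrr linear_form0 subr0 normr0 mulr_ge0 ?divr_ge0 ?ltW.
  have zx0 : 0 < euclidean_norm (z - x).
    by apply: lt_le_trans (norm_le_euclidean _); rewrite normr_gt0 subr_eq0.
  move: zD; rewrite -(hg _ Ez) -(hg _ Ex) ltr_pdivrMr// => /ltW/le_trans; apply.
  have -> : e / 2 * d = e / (4 * k%:R) * (k%:R * (2 * d)) by field; rewrite gt_eqF.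
  rewrite ler_pM2l//; apply: le_trans (euclidean_le_norm _) _.
  by rewrite ler_pM2l.
have -> : h y - h x - linear_form D (y - x) =
    (h z - h x - linear_form D (z - x)) + (- (h z - h y) + linear_form D (z - y)).
  have -> : linear_form D (z - x) = linear_form D (z - y) + linear_form D (y - x).
    by rewrite -linear_formD subrKA.
  ring.
apply: le_trans (ler_normD _ _) _.
have h1 : `|h z - h y| <= L * (q * d) by apply: le_trans (hL _ _) _; rewrite ler_wpM2l.
have h2 : `|linear_form D (z - y)| <= N * (q * d) by apply: linear_form_le.
have h3 := ler_normD (- (h z - h y)) (linear_form D (z - y)).
have h4 : (L + N) * (q * d) <= e / 4 * d.
  rewrite mulrA ler_pM2r// /q mulrA ler_pdivrMr ?mulr_gt0 ?ltr_wpDl ?addr_ge0//.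
  have : e * (L + N) <= e * (L + N + 1) by rewrite ler_pM2l// lerDl.
  by rewrite [(L + N) * e]mulrC; lra.
have ed : 0 <= e * d by rewrite mulr_ge0// ltW.
rewrite normrN in h3; move: main h1 h2 h3 h4 ed; rewrite mulrDl -!mulrA.
set qq := q * d; set a := `|_|; set b := `|_|; set b' := `|_ + _|; set b'' := `|linear_form _ _|.
move=> m1 m2 m3 m4 m5 m6; clear -m1 m2 m3 m4 m5 m6; lra.
Qed.

(** * Degenerate derivatives give null images *)

Section lipschitz_increments.
Context {R : realType} {k' : nat}.
Local Notation V := 'rV[R]_k'.+1.
Implicit Types (h : V -> R) (w : V).

Lemma closed_small_increments h w (L c e : R) (b : R -> R) :
  (forall x y, `|h x - h y| <= L * `|x - y|) ->
  closed [set x | forall t, `|t| < c -> `|h (x + t *: w) - h x - b t| <= e * `|t|].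
Proof.
move=> hL x clx t tc; apply/ler_addgt0Pr => d d0.
have L0 : 0 < 2 * `|L| + 1 by rewrite ltr_wpDl// mulr_ge0.
have [a [Aa]] := clx _ (nbhsx_ballx x (d / (2 * `|L| + 1)) (divr_gt0 d0 L0)).
rewrite -ball_normE /= => xa.
have hx y : `|h (x + y) - h (a + y)| <= `|L| * `|x - a|.
  apply: le_trans (hL _ _) _; rewrite opprD addrACA subrr addr0.
  by rewrite ler_wpM2r// ler_norm.
have h1 := hx (t *: w); have := hx 0; rewrite !addr0 => h2.
have -> : h (x + t *: w) - h x - b t = (h (a + t *: w) - h a - b t) +
    ((h (x + t *: w) - h (a + t *: w)) - (h x - h a)) by ring.
apply: le_trans (ler_normD _ _) _; apply: lerD; first exact: Aa.
apply: le_trans (ler_normB _ _) _; apply: le_trans (lerD h1 h2) _.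
have -> : `|L| * `|x - a| + `|L| * `|x - a| = 2 * `|L| * `|x - a| by ring.
move: xa; rewrite ltr_pdivlMr// => /ltW; apply: le_trans.
by rewrite mulrC ler_wpM2l// lerDl.
Qed.

End lipschitz_increments.

Section rational_directions.
Context {R : realType} {k' : nat}.
Local Notation V := 'rV[R]_k'.+1.

Definition rational_point (q : {ffun 'I_k'.+1 -> rat}) : V := \row_i ratr (q i).

Lemma rational_point_near (v : V) (d : R) : 0 < d ->
  exists q, `|rational_point q - v| <= d.
Proof.
move=> d0; have /choice[q qP] : forall i, exists q : rat, `|ratr q - v 0 i| <= d.
  move=> i; have vd : v 0 i - d < v 0 i + d by lra.
  have [q] := rat_in_itvoo vd; rewrite in_itv/= => /andP[q1 q2].
  by exists q; rewrite ler_norml; apply/andP; split; lra.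
exists [ffun i => q i]; apply/row_norm_leP => [|i]; first exact: ltW.
by rewrite !mxE ffunE.
Qed.

End rational_directions.

Section degenerate_derivative.
Context {R : realType} {X : metricType R} {k' : nat}.
Local Notation k := k'.+1.
Local Notation V := 'rV[R]_k.
Local Notation leb := (@lebesgue_outer R k).
Variables (Phi : X -> linfty R) (C M : R).
Hypotheses (X_complete : complete_space X) (C1 : 1 <= C) (M1 : 1 <= M).
Hypothesis X_quasi : forall x y : X, exists c : R -> X,
      [/\ rectifiable_curve 0 1 c, c 0 = x, c 1 = y
        & (curve_length 0 1 c <= (C * mdist x y)%:E)%E].
Hypothesis Phi_BLD : forall (a b : R) (c : R -> X), rectifiable_curve a b c ->
      ((M^-1)%:E * curve_length a b c <= curve_length a b (Phi \o c))%E /\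
      (curve_length a b (Phi \o c) <= M%:E * curve_length a b c)%E.
Variables (E : set V) (f : V -> X) (L : R).
Hypotheses (mE : lebesgue_measurable E) (L0 : 0 < L).
Hypothesis fL : forall x y, E x -> E y -> mdist (f x) (f y) <= L * `|x - y|.

Definition degenerate : set V := [set x | E x /\
  (linfty_ap_derivable E (Phi \o f) x /\
   (rank_rows (linfty_ap_derivative E (Phi \o f) x) < k)%N)].

Lemma component_lipschitz i x y : E x -> E y ->
  `|val (Phi (f x)) i - val (Phi (f y)) i| <= M * C * L * `|x - y|.
Proof.
move=> Ex Ey; have MC : 0 <= M * C by apply: mulr_ge0; exact: le_trans ler01 _.
apply: le_trans (linfty_mdist_ge _ _ i) _.
apply: le_trans (weak_BLD_lipschitz M1 X_quasi Phi_BLD _ _) _.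
by rewrite -[leRHS]mulrA ler_wpM2l// fL.
Qed.

(** Countably many directions are enough because the increments of a Lipschitz
    map hardly change when the direction changes a little. *)
Lemma degenerate_slow_cover (N : nat) : (0 < N)%N -> exists F : nat -> set V,
  [/\ forall n, lebesgue_measurable (F n), forall n, F n `<=` E,
      forall n, exists w j, [/\ slow_along Phi f (F n) w N%:R^-1, w 0 j = 1 & `|w| <= 2] &
      degenerate `<=` \bigcup_n F n].
Proof.
move=> N0; pose L' := M * C * L.
have L'0 : 0 < L' by rewrite !mulr_gt0// (lt_le_trans ltr01).
have NR0 : 0 < N%:R :> R by rewrite ltr0n.
have /choice[h hP] : forall i, exists h : V -> R,
    (forall x, E x -> h x = val (Phi (f x)) i) /\
    forall x y, `|h x - h y| <= L' * `|x - y|.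
  move=> i; apply: (@mcshane_extension R k E (fun x => val (Phi (f x)) i)); first exact: ltW.
  exact: component_lipschitz.
pose A (w : V) (i n : nat) : set V := [set x | forall t : R, `|t| < n.+1%:R^-1 ->
  `|h i (x + t *: w) - h i x| <= N%:R^-1 * `|t|].
pose G (w : V) : set V := E `&` \bigcap_i \bigcup_n A w i n.
have mG w : lebesgue_measurable (G w).
  apply: caratheodory_measurable_setI => //.
  rewrite -[\bigcap_i _]setCK setC_bigcap.
  apply: caratheodory_measurable_setC; apply: caratheodory_measurable_bigcup => i.
  apply: caratheodory_measurable_setC; apply: caratheodory_measurable_bigcup => n.
  apply: measurable_closed.
  have := @closed_small_increments _ _ _ w _ n.+1%:R^-1 N%:R^-1 (fun=> 0) (hP i).2.
  by under eq_set do under eq_forall do rewrite subr0.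
have slowG w : slow_along Phi f (G w) w N%:R^-1.
  move=> i x [Ex /(_ i I)[n _ Ax]]; exists n.+1%:R^-1; first by rewrite invr_gt0.
  by move=> t tn [Et _]; rewrite -!(hP i).1//; exact: Ax.
pose ok (z : 'I_k * {ffun 'I_k -> rat}) :=
  (rational_point z.2 : V) 0 z.1 = 1 /\ `|rational_point z.2 : V| <= 2.
pose F (n : nat) : set V := if pickle_inv n is Some z then
  (if `[< ok z >] then G (rational_point z.2) else set0) else set0.
have slow0 : exists w j, [/\ slow_along Phi f set0 w N%:R^-1, w 0 j = 1 & `|w| <= 2].
  exists (const_mx 1), ord0; rewrite mxE; split => //.
  by apply/row_norm_leP => // i; rewrite mxE normr1 ler1n.
exists F; split.
- move=> n; rewrite /F; case: pickle_inv => [z|]; last exact: caratheodory_measurable_set0.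
  by case: ifP => // _; exact: caratheodory_measurable_set0.
- move=> n x; rewrite /F; case: pickle_inv => // z; case: ifP => // _; by case.
- move=> n; rewrite /F; case: pickle_inv => [z|]//; case: ifPn => [/asboolP[z1 z2]|_]//.
  by exists (rational_point z.2), z.1.
move=> x [Ex [dx rx]].
have [v0 v0N v0D] := rank_rows_lt_orthogonal rx.
have [j v0j] : exists j, `|v0| = `|v0 0 j|.
  apply: contrapT => /forallNP H.
  have v0pos : 0 < `|v0| by rewrite normr_gt0.
  have lt j : `|v0 0 j| < `|v0|.
    by rewrite lt_neqAle coord_le_norm andbT eq_sym; apply/eqP; exact: H.
  pose m := \big[Num.max/0]_(j < k) `|v0 0 j|.
  have mlt : m < `|v0| by rewrite /m; elim/big_ind : _ => // a b; rewrite gt_max => -> ->.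
  suff : `|v0| <= m by rewrite leNgt mlt.
  apply/row_norm_leP => [|i]; last by rewrite /m; exact: le_bigmax.
  by rewrite /m; elim/big_ind : _ => // a b a0 b0; rewrite le_max a0.
have v0j0 : v0 0 j != 0 by rewrite -normr_gt0 -v0j normr_gt0.
(* normalized so that the largest coordinate is 1 *)
pose v := (v0 0 j)^-1 *: v0.
have vj : v 0 j = 1 by rewrite mxE mulVf.
have v1 : `|v| <= 1 by rewrite normrZ normfV -v0j mulVf// normr_eq0.
have vD i : linear_form (linfty_ap_derivative E (Phi \o f) x i) v = 0.
  by rewrite linear_formZ v0D mulr0.
(* half of the error is spent on the derivative in direction [v] and half on the
   replacement of [v] by a rational direction *)
pose d := Num.min 1 (N%:R^-1 / 2 / L').
have d0 : 0 < d by rewrite lt_min ltr01 !divr_gt0// invr_gt0.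
have [q0 q0v] := rational_point_near v d0.
pose q := [ffun i => if i == j then 1 else q0 i] : {ffun 'I_k -> rat}.
have qj : rational_point q 0 j = 1 :> R by rewrite mxE ffunE eqxx rmorph1.
have qv : `|rational_point q - v| <= d.
  apply/row_norm_leP => [|i]; first exact: ltW.
  have [->|ij] := eqVneq i j; first by rewrite mxE qj mxE vj subrr normr0 ltW.
  apply: le_trans q0v; apply: le_trans (coord_le_norm _ i).
  by rewrite !mxE ffunE (negbTE ij).
have okq : ok (j, q).
  split => //=; rewrite -[rational_point q](subrK v).
  apply: le_trans (ler_normD _ _) _; rewrite -[2]/(1 + 1); apply: lerD => //.
  by apply: le_trans qv _; rewrite ge_min lexx.
exists (pickle (j, q)) => //; rewrite /F pickleK_inv asboolT//; split => // i _.
have [D iD] := dx i; rewrite /= in iD.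
have Dx : is_ap_derivative E (fun y => val (Phi (f y)) i) x
    (linfty_ap_derivative E (Phi \o f) x i).
  exact: (xgetPex (0 : V) (P := [set D | is_ap_derivative E (fun y => val (Phi (f y)) i) x D]) (dx i)).
have N20 : 0 < N%:R^-1 / 2 :> R by rewrite divr_gt0// invr_gt0.
have [r r0 near] := ap_derivative_extension (ltW L'0) (hP i).2 (hP i).1 Ex Dx N20.
have [n nr] := ltr_add_invr r0; rewrite add0r in nr.
exists n => // t tn /=; set w := rational_point q.
have tv : `|x + t *: v - x| <= `|t|.
  by rewrite addrAC subrr add0r normrZ ler_piMr.
have tr : `|x + t *: v - x| < r by apply: le_lt_trans tv (lt_trans tn nr).
have h1 : `|h i (x + t *: v) - h i x| <= N%:R^-1 / 2 * `|t|.
  have := near _ tr; have -> : linear_form (linfty_ap_derivative E (Phi \o f) x i)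
      (x + t *: v - x) = 0 by rewrite addrAC subrr add0r linear_formZ vD mulr0.
  by rewrite subr0 => /le_trans; apply; rewrite ler_wpM2l// ltW.
have h2 : `|h i (x + t *: w) - h i (x + t *: v)| <= N%:R^-1 / 2 * `|t|.
  apply: le_trans ((hP i).2 _ _) _.
  have -> : x + t *: w - (x + t *: v) = t *: (w - v).
    by rewrite opprD addrACA subrr add0r scalerBr.
  rewrite normrZ [`|t| * _]mulrC mulrA ler_wpM2r//.
  rewrite -ler_pdivlMl// mulrC; apply: le_trans qv _; by rewrite ge_min lexx orbT.
have -> : h i (x + t *: w) - h i x =
    (h i (x + t *: w) - h i (x + t *: v)) + (h i (x + t *: v) - h i x) by ring.
apply: le_trans (ler_normD _ _) _; apply: le_trans (lerD h2 h1) _.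
by rewrite -mulrDl -splitr.
Qed.

(** For each [N] the pieces of the cover, made disjoint, give a bound of the content
    by a constant times the measure of a cube over [N]. *)
Lemma degenerate_null : hausdorff_measure k (f @` degenerate) = 0%E.
Proof.
pose T m : set V := cube 0 m%:R.
have -> : f @` degenerate = \bigcup_m (f @` (degenerate `&` T m)).
  apply/seteqP; split => [_ [x dx <-]|_ [m _ [x [dx _] <-]]]; last by exists x.
  have [m xm] : exists m : nat, `|x| <= m%:R.
    exists (Num.truncn `|x|).+1; apply: ltW; exact: truncnS_gt.
  by exists m => //; exists x => //; split => //; apply/cube_normP; rewrite ?subr0.
apply: hausdorff_measure0_bigcup => m; apply/hausdorff_measure_eq0P => delta delta0.
apply/eqP; rewrite eq_le hausdorff_content_ge0 andbT.
have TE : leb (T m) = ((m%:R *+ 2) ^+ k)%:E by apply: lebesgue_outer_cube.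
pose B := slow_constant (k' := k') C M L.
have B0 : 0 <= B * (m%:R *+ 2) ^+ k.
  rewrite mulr_ge0 ?exprn_ge0 ?mulrn_wge0// /B /slow_constant mulr_ge0 ?exprn_ge0//.
  by apply: ltW; apply: tube_constant_gt0.
apply: (@le_trans _ _ (ereal_inf [set ((B / N%:R)%:E * leb (T m))%E | N in [set N : nat | (8 <= N)%N]])).
  apply: le_ereal_inf_tmp => _ [N N8 <-]; have N0 : (0 < N)%N by exact: leq_trans N8.
  have [F [mF FE slowF degF]] := degenerate_slow_cover N0.
  apply: (@le_trans _ _ (\sum_(0 <= n <oo) hausdorff_content k delta (f @` (T m `&` seqDU F n)))%E).
    apply: le_trans (hausdorff_content_subadditive _ _ _).
    apply: le_hausdorff_content => _ [x [dx Tx] <-].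
    have := degF _ dx; rewrite seqDU_bigcup_eq => -[n _ Fx].
    by exists n => //; exists x.
  have mU n : lebesgue_measurable (seqDU F n).
    apply: caratheodory_measurable_setD => //.
      exact: mF.
    exact: caratheodory_measurable_bigsetU.
  apply: (@le_trans _ _ (\sum_(0 <= n <oo) ((B / N%:R)%:E * leb (T m `&` seqDU F n)))%E).
    apply: lee_nneseries => n _; first by move=> _; exact: hausdorff_content_ge0.
    have [w [j [Fw wj w2]]] := slowF n.
    apply: (slow_content X_complete C1 M1 X_quasi Phi_BLD L0 (w := w) (j := j)) => //.
    - by apply: caratheodory_measurable_setI; [exact: measurable_box|exact: mU].
    - apply: (@le_lt_trans _ _ (leb (T m))); last by rewrite TE ltry.
      by apply: le_outer_measure; exact: subIsetl.
    - by move=> x y [_ [Fx _]] [_ [Fy _]]; apply: fL; [exact: FE Fx|exact: FE Fy].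
    - move=> i x [_ [Fx _]]; have [e e0 He] := Fw i _ Fx.
      by exists e => // t te [_ [Ft _]]; exact: He.
  rewrite nneseriesZl//; last by move=> n _; exact: outer_measure_ge0.
  rewrite lee_wpmul2l//.
    rewrite lee_fin mulr_ge0// ?invr_ge0// /B /slow_constant mulr_ge0 ?exprn_ge0//.
    by apply: ltW; apply: tube_constant_gt0.
  apply: le_trans (caratheodory_lime_le mU (@trivIset_seqDU _ F) (T m)).
  by rewrite leeDl// outer_measure_ge0.
apply/lee_addgt0Pr => e e0; rewrite add0e.
pose b := B * (m%:R *+ 2) ^+ k.
pose N := maxn 8 (Num.truncn (b / e)).+1.
have N0 : 0 < N%:R :> R by rewrite ltr0n leq_max.
apply: ereal_inf_le; exists ((B / N%:R)%:E * leb (T m))%E.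
  by exists N => //=; rewrite leq_max leqnn.
rewrite TE -EFinM lee_fin mulrAC ler_pdivrMr// -/b [e * _]mulrC -ler_pdivrMr//.
apply: ltW; apply: lt_le_trans (truncnS_gt _) _.
by rewrite ler_nat leq_max leqnn orbT.
Qed.

Lemma ae_degenerate_null :
  ae_in E (fun x => linfty_ap_derivable E (Phi \o f) x /\
     (rank_rows (linfty_ap_derivative E (Phi \o f) x) < k)%N) ->
  hausdorff_measure k (f @` E) = 0%E.
Proof.
rewrite /ae_in; set Z := [set x | _] => Z0.
have -> : f @` E = \bigcup_(n : nat) (if n is 0%N then f @` degenerate else f @` Z).
  apply/seteqP; split => [_ [x Ex <-]|_ [[|n] _ [x [Ex _] <-]]]; last 2 first.
  - by exists x.
  - by exists x.
  have [dx|ndx] := pselect (degenerate x); first by exists 0%N => //; exists x.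
  by exists 1%N => //; exists x => //; split => // Hx; apply: ndx.
apply: hausdorff_measure0_bigcup => -[|n]; first exact: degenerate_null.
by apply: (lebesgue0_hausdorff0 L0) => // x y [Ex _] [Ey _]; exact: fL.
Qed.

End degenerate_derivative.

(** * Maps of full rank expand *)

Section full_rank.
Context {R : realType} {k' : nat}.
Local Notation k := k'.+1.
Local Notation V := 'rV[R]_k.
Local Notation leb := (@lebesgue_outer R k).
Variables (E : set V) (g : V -> linfty R) (L : R).
Hypothesis L0 : 0 < L.
Hypothesis gL : forall i x y, E x -> E y ->
  `|val (g x) i - val (g y) i| <= L * `|x - y|.

Definition expanding_set (n : nat) : set V := [set x | E x /\
  forall y, E y -> `|y - x| < n.+1%:R^-1 -> `|y - x| <= n.+1%:R * mdist (g y) (g x)].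

(** On a cube of small diameter the inverse of [g] is Lipschitz. *)
Lemma expanding_set_null n : hausdorff_measure k (g @` E) = 0%E ->
  leb (expanding_set n) = 0%E.
Proof.
move=> gE0; pose d : R := n.+1%:R^-1 / 4.
have n0 : 0 < n.+1%:R :> R by rewrite ltr0n.
have d0 : 0 < d by rewrite divr_gt0// invr_gt0.
pose S (q : {ffun 'I_k -> rat}) := expanding_set n `&` cube (rational_point q) d.
apply: (@lebesgue_outer_subset0 _ _ _ (\bigcup_q S q)).
  move=> x Bx; have [q qx] := rational_point_near x d0.
  by exists q => //; split => //; apply/cube_normP; rewrite ?(ltW d0)// distrC.
apply: lebesgue_outer_countable => q.
apply: (@hausdorff0_lebesgue0 _ _ _ _ g n.+1%:R) => //.
  move=> x y [[Ex _] Qx] [[Ey Hy] Qy]; apply: Hy => //.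
  move: Qx Qy => /(cube_normP _ _ (ltW d0)) Qx /(cube_normP _ _ (ltW d0)) Qy.
  rewrite -[x - y](subrKA (rational_point q)).
  apply: le_lt_trans (ler_normD _ _) _; rewrite [`|_ - y|]distrC.
  have : d *+ 2 < n.+1%:R^-1.
    have : 0 < n.+1%:R^-1 :> R by rewrite invr_gt0.
    by rewrite /d mulr2n; set m := n.+1%:R^-1; lra.
  by apply: le_lt_trans; rewrite mulr2n lerD.
apply: hausdorff_measure0_sub gE0 => _ [x [[Ex _] _] <-]; by exists x.
Qed.

(** Finitely many coordinates of [g] determine [y - x] up to their errors of linear
    approximation, and these are small enough to be absorbed. *)
Lemma full_rank_expanding : [set x | E x /\ (linfty_ap_derivable E g x /\
    rank_rows (linfty_ap_derivative E g x) = k)] `<=` \bigcup_n expanding_set n.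
Proof.
move=> x [Ex [dx rx]].
have [n [c [c0 nc]]] := rank_rows_full_bound rx.
have e0 : 0 < (2 * c)^-1 by rewrite invr_gt0 mulr_gt0.
have /choice[r rP] : forall i, exists r : R, 0 < r /\ forall y, E y -> `|y - x| < r ->
    `|val (g y) i - val (g x) i - linear_form (linfty_ap_derivative E g x i) (y - x)|
      <= (2 * c)^-1 * `|y - x|.
  move=> i; have [h [hE hL]] := mcshane_extension (ltW L0) (gL i).
  have Dx : is_ap_derivative E (fun y => val (g y) i) x (linfty_ap_derivative E g x i).
    exact: (xgetPex (0 : V) (P := [set D | is_ap_derivative E (fun y => val (g y) i) x D]) (dx i)).
  have [r r0 near] := ap_derivative_extension (ltW L0) hL hE Ex Dx e0.
  by exists r; split => // y Ey yr; rewrite -!hE//; exact: near.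
pose r0 := \big[Num.min/1]_(i < n) r i.
have r00 : 0 < r0.
  by rewrite /r0; elim/big_ind : _ => // [a b a0 b0|i _]; [rewrite lt_min a0|exact: (rP i).1].
have [m mr] : exists m : nat, m.+1%:R^-1 < r0 /\ 2 * c <= m.+1%:R.
  have [m1 m1r] := ltr_add_invr r00; rewrite add0r in m1r.
  exists (maxn m1 (Num.truncn (2 * c))); split.
    apply: le_lt_trans m1r; rewrite lef_pV2 ?posrE ?ltr0n// ler_nat ltnS.
    exact: leq_maxl.
  apply: ltW; apply: lt_le_trans (truncnS_gt _) _.
  by rewrite ler_nat ltnS leq_maxr.
exists m => //; split => // y Ey ym; case: mr => mr mc.
have yr : `|y - x| < r0 by exact: lt_trans ym mr.
pose s := mdist (g y) (g x) + (2 * c)^-1 * `|y - x|.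
have g0 : 0 <= mdist (g y) (g x) by exact: mdist_ge0.
have ys : `|y - x| <= c * s.
  apply: nc => [i ltin|]; last by rewrite addr_ge0// mulr_ge0// ltW.
  have ri : `|y - x| < r i.
    apply: lt_le_trans yr _; rewrite /r0 (bigD1 (Ordinal ltin))//=.
    by rewrite ge_min lexx.
  have h1 := (rP i).2 _ Ey ri; have h2 := linfty_mdist_ge (g y) (g x) i.
  have -> : linear_form (linfty_ap_derivative E g x i) (y - x) =
     (val (g y) i - val (g x) i) - (val (g y) i - val (g x) i -
       linear_form (linfty_ap_derivative E g x i) (y - x)) by ring.
  by apply: le_trans (ler_normB _ _) _; apply: lerD.
have : c * s = c * mdist (g y) (g x) + `|y - x| / 2.
  by rewrite /s; field; rewrite gt_eqF.
move=> cs; have : `|y - x| <= 2 * c * mdist (g y) (g x).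
  by rewrite cs in ys; move: ys; rewrite -mulrA; set a := c * _; set b := `|_|; lra.
by move=> /le_trans; apply; rewrite ler_wpM2r.
Qed.

Lemma null_image_rank_ae : hausdorff_measure k (g @` E) = 0%E ->
  leb [set x | E x /\ ~ linfty_ap_derivable E g x] = 0%E ->
  ae_in E (fun x => linfty_ap_derivable E g x /\
     (rank_rows (linfty_ap_derivative E g x) < k)%N).
Proof.
move=> gE0 nd0; rewrite /ae_in.
pose F (n : nat) := if n is m.+1 then expanding_set m
  else [set x | E x /\ ~ linfty_ap_derivable E g x].
apply: (@lebesgue_outer_subset0 _ _ _ (\bigcup_n F n)); last first.
  by apply: lebesgue_outer_countable => -[|n]//; exact: expanding_set_null.
move=> x [Ex nx]; have [dx|ndx] := pselect (linfty_ap_derivable E g x); last by exists 0%N.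
have [n _ xn] : (\bigcup_n expanding_set n) x.
  apply: full_rank_expanding; split => //; split => //.
  have := dimvS (subvf (rowspan (linfty_ap_derivative E g x))).
  rewrite dimvf /dim/= mul1n leq_eqVlt => /orP[/eqP//|lt]; exfalso; apply: nx; split => //.
by exists n.+1.
Qed.

End full_rank.

(** * Lipschitz functions of one variable *)

Section lipschitz_line.
Context {R : realType}.
Local Notation mu := (@lebesgue_measure R).

(** The measure is at most [c] times Lebesgue measure on the intervals of a cover. *)
Lemma stieltjes_measure_null (F : cumulative R R) (c : R) : 0 < c ->
  (forall x y, x <= y -> F y - F x <= c * (y - x)) ->
  forall A, mu A = 0%E -> lebesgue_stieltjes_measure F A = 0%E.
Proof.
move=> c0 Fc A A0; apply/eqP; rewrite eq_le measure_ge0 andbT.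
apply/lee_addgt0Pr => e e0; rewrite add0e.
have : (mu A < (e / c)%:E)%E by rewrite A0 lte_fin divr_gt0.
move=> /ereal_inf_lt[_ [B [mB AB] <-] Be].
apply: (@le_trans _ _ (\sum_(0 <= n <oo) wlength F (B n))%E).
  by apply: ereal_inf_lbound; exists B.
have c0' : (0 <= c%:E)%E by rewrite lee_fin ltW.
have Bc n : (wlength F (B n) <= c%:E * wlength idfun (B n))%E.
  have /ocitvP[->|[x x12 ->]] := mB n; first by rewrite !wlength0 mule0.
  by rewrite !wlength_itv_bnd ?(ltW x12)// -EFinM lee_fin; apply: Fc; exact: ltW.
apply: (@le_trans _ _ (\sum_(0 <= n <oo) (c%:E * wlength idfun (B n)))%E).
  by apply: lee_nneseries => n _ //; exact: wlength_ge0.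
rewrite nneseriesZl//.
apply: le_trans (lee_wpmul2l c0' (ltW Be)) _.
by rewrite -EFinM lee_fin mulrC divfK// gt_eqF.
Qed.

(** The Stieltjes measure has a density by the Radon-Nikodym theorem, so that [F] is
    an integral of this density; it is cut down to a bounded interval in order to
    be finite. *)
Lemma stieltjes_derivable_ae (F : cumulative R R) (c : R) (m : nat) : 0 < c ->
  (forall x y, x <= y -> F y - F x <= c * (y - x)) ->
  {ae mu, forall x, - m%:R < x < m%:R -> derivable F x 1}.
Proof.
move=> c0 Fc; pose D : set (measurableTypeR R) := `]- m%:R, m%:R]%classic.
have mD : measurable D by exact: (measurable_itv `]- m%:R, m%:R]).
have nuE a b : a <= b -> lebesgue_stieltjes_measure F `]a, b]%classic = (F b - F a)%:E.
  move=> ab; rewrite /lebesgue_stieltjes_measure/= /measure_extension.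
  by rewrite measurable_mu_extE/= ?wlength_itv_bnd//; exact: is_ocitv.
have nuD : (lebesgue_stieltjes_measure F D < +oo)%E by rewrite nuE ?ltry// (@le_trans _ _ 0)// oppr_le0.
pose nu : {finite_measure set (measurableTypeR R) -> \bar R} := mfrestr mD nuD.
have nu_mu : nu `<< mu.
  apply/null_content_dominatesP => A mA A0; rewrite /nu /= /mfrestr /mrestr.
  apply: (stieltjes_measure_null c0 Fc); apply/eqP; rewrite eq_le measure_ge0 andbT -A0.
  by apply: le_measure; rewrite ?inE//; exact: measurableI.
have [f [f0 ffin intf nuf]] := radon_nikodym_sigma_finite nu_mu.
pose g x := fine (f x).
have fg x : f x = (g x)%:E by rewrite fineK.
have intg : mu.-integrable setT (EFin \o g).
  by apply: eq_integrable intf => // x _; rewrite /= fg.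
have intgS y : mu.-integrable [set` Interval (BRight (- m%:R)) (BRight y)] (EFin \o g).
  by apply: integrableS intg.
have locg : locally_integrable setT g.
  by apply: open_integrable_locally => //; exact: openT.
have := FTC1 intgS locg; apply: filterS; first exact: (ae_filter_ringOfSetsType mu).
move=> x dx /andP[mx xm]; have {}mx' : (BRight (- m%:R) < BRight x)%O by rewrite bnd_simp.
have [+ _] := dx mx'; set G := (fun _ => _) => dG.
have GE y : - m%:R <= y <= m%:R -> G y = F y - F (- m%:R).
  move=> /andP[my ym]; rewrite /G /Rintegral.
  under eq_integral do rewrite -fg.
  have mI : measurable (`]- m%:R, y]%classic : set (measurableTypeR R)).
    exact: (measurable_itv `]- m%:R, y]).
  transitivity (fine (nu `]- m%:R, y]%classic)); first by rewrite (nuf _ mI).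
  rewrite /nu/= /mfrestr /mrestr setIidl ?nuE//.
  move=> z; rewrite /D /= !in_itv/= => /andP[mz zy].
  by rewrite mz; exact: le_trans zy ym.
have dG' : derivable (G + cst (F (- m%:R))) x 1.
  by apply: derivableD => //; exact: derivable_cst.
apply: near_eq_derivable dG'.
near=> y; have -> : (G + cst (F (- m%:R))) y = G y + F (- m%:R) by [].
rewrite GE ?subrK//.
apply/andP; split; apply: ltW; near: y.
  exact: lt_nbhsr.
exact: lt_nbhsl.
Unshelve. all: by end_near. Qed.

(** Adding a multiple of the identity to a Lipschitz function makes it
    nondecreasing, so that it has a Stieltjes measure; this measure has a density
    with respect to Lebesgue measure. *)
Lemma lipschitz_derivable_ae (h : R -> R) (L : R) :
  (forall x y, `|h x - h y| <= L * `|x - y|) ->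
  {ae mu, forall x, derivable h x 1}.
Proof.
move=> hL; pose c := `|L| + 1; have c0 : 0 < c by rewrite ltr_wpDl.
have hc x y : x <= y -> `|h y - h x| <= c * (y - x).
  move=> xy; apply: le_trans (hL _ _) _; rewrite ger0_norm ?subr_ge0//.
  by rewrite ler_wpM2r ?subr_ge0// /c; have := ler_norm L; lra.
pose F t := h t + c * t.
have F_mono : nondecreasing F.
  move=> x y xy; have := hc _ _ xy; rewrite ler_norml => /andP[+ _].
  by rewrite /F; lra.
have FL x y : x <= y -> F y - F x <= 2 * c * (y - x).
  move=> xy; have := hc _ _ xy; rewrite ler_norml => /andP[_ +].
  by rewrite /F; lra.
have F_rc : right_continuous F.
  move=> x; apply: cvg_at_right_filter; apply/cvgrPdist_le => e e0.
  apply/nbhs_ballP; exists (e / (2 * c)); first by rewrite /= divr_gt0// mulr_gt0.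
  move=> y; rewrite /ball/= ltr_pdivlMr ?mulr_gt0// => /ltW; apply: le_trans.
  wlog xy : x y / x <= y.
    move=> H; have [|/ltW yx] := leP x y; first exact: H.
    by rewrite distrC [`|x - y|]distrC; exact: H.
  rewrite distrC ger0_norm ?subr_ge0 ?F_mono// distrC ger0_norm ?subr_ge0//.
  rewrite [leRHS]mulrC; exact: FL.
pose G : cumulative R R := HB.pack_for (cumulative R R) F
  (isCumulative.Build R _ R F F_mono F_rc).
have c20 : 0 < 2 * c by rewrite mulr_gt0.
have dG (m : nat) : {ae mu, forall x, - m%:R < x < m%:R -> derivable F x 1}.
  exact: (@stieltjes_derivable_ae G _ m c20 FL).
have : {ae mu, forall x, forall m : nat, - m%:R < x < m%:R -> derivable F x 1}.
  exact: ae_foralln.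
apply: filterS; first exact: (ae_filter_ringOfSetsType mu).
move=> x /(_ (Num.truncn `|x|).+1); rewrite -ltr_norml truncnS_gt => /(_ isT) dF.
have -> : h = F - (c *: id).
  by apply/funext => t; rewrite /F/= fctE/= addrK.
by apply: derivableB => //; apply: derivableZ.
Qed.

End lipschitz_line.

(** * Rademacher's theorem *)

Section derivable_slope.
Context {R : realType}.

Lemma derivable_slope (phi : R -> R) (t : R) : derivable phi t 1 ->
  exists a, forall e, 0 < e -> exists2 r, 0 < r & forall s, `|s| < r ->
    `|phi (t + s) - phi t - s * a| <= e * `|s|.
Proof.
rewrite /derivable => /cvg_ex[a /= /cvgrPdist_le phia]; exists a => e /phia.
rewrite /prop_near1 /nbhs /= /dnbhs /within /= => /nbhs_ballP[r /= r0 Hr].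
exists r => // s sr; have [->|s0] := eqVneq s 0.
  by rewrite addr0 subrr sub0r mul0r oppr0 normr0 mulr0.
have := Hr s; rewrite /ball /= sub0r normrN => /(_ sr s0).
rewrite [s%:A]mulr1 [s + t]addrC => Hs.
have -> : phi (t + s) - phi t - s * a = - (s * (a - s^-1 *: (phi (t + s) - phi t))).
  by rewrite mulrBr /GRing.scale/= mulrA divff// mul1r opprB.
by rewrite normrN normrM mulrC ler_wpM2r.
Qed.

End derivable_slope.

Section partial_derivatives.
Context {R : realType} {k' : nat}.
Local Notation k := k'.+1.
Local Notation V := 'rV[R]_k.
Local Notation leb := (@lebesgue_outer R k).
Local Notation mu := (@lebesgue_measure R).
Variables (h : V -> R) (L : R).
Hypothesis hL : forall x y, `|h x - h y| <= L * `|x - y|.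

Definition axis (j : 'I_k) : V := delta_mx 0 j.

Lemma norm_axis j t : `|t *: axis j| = `|t|.
Proof.
apply/le_anti/andP; split.
  apply/row_norm_leP => // i; rewrite !mxE/= normrM.
  by case: (i == j); rewrite ?normr1 ?mulr1// normr0 mulr0.
by have := coord_le_norm (t *: axis j) j; rewrite !mxE !eqxx mulr1.
Qed.

(** Points at which the partial increments along one axis are linear up to a
    relative error [m.+1%:R^-1]; the slope can be taken rational. *)
Definition slope_set (m : nat) (j : 'I_k) (q : rat) (n : nat) : set V :=
  [set x | forall t, `|t| < n.+1%:R^-1 ->
     `|h (x + t *: axis j) - h x - t * ratr q| <= m.+1%:R^-1 * `|t|].

Lemma measurable_slope_set m j q n : lebesgue_measurable (slope_set m j q n).
Proof.
apply: measurable_closed.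
exact: (@closed_small_increments _ _ h (axis j) L _ _ (fun t => t * ratr q)).
Qed.

Definition no_slope m j : set V := ~` \bigcup_z slope_set m j z.1 z.2.

Lemma measurable_no_slope m j : lebesgue_measurable (no_slope m j).
Proof.
apply: caratheodory_measurable_setC.
apply: (@lebesgue_measurable_countable _ _ (rat * nat)%type (fun z => slope_set m j z.1 z.2)) => z.
exact: measurable_slope_set.
Qed.

Lemma derivable_slope_set m j y (t : R) :
  derivable (fun s : R => h (y + s *: axis j)) t 1 ->
  ~ no_slope m j (y + t *: axis j).
Proof.
move=> /derivable_slope[a Ha]; apply; have m0 : 0 < m.+1%:R^-1 / 2 :> R.
  by rewrite divr_gt0// invr_gt0.
have [r r0 Hr] := Ha _ m0.
have am : a - m.+1%:R^-1 / 2 < a + m.+1%:R^-1 / 2 by set e := _ / 2 in m0 *; lra.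
have [q] := rat_in_itvoo am; rewrite in_itv/= => /andP[q1 q2].
have [n nr] := ltr_add_invr r0; rewrite add0r in nr.
exists (q, n) => // s sn /=.
have := Hr s (lt_trans sn nr).
have -> : y + t *: axis j + s *: axis j = y + (t + s) *: axis j.
  by rewrite scalerDl addrA.
move=> Hs.
have -> : h (y + (t + s) *: axis j) - h (y + t *: axis j) - s * ratr q =
  (h (y + (t + s) *: axis j) - h (y + t *: axis j) - s * a) + s * (a - ratr q) by ring.
apply: le_trans (ler_normD _ _) _; rewrite [leRHS](_ : _ =
  m.+1%:R^-1 / 2 * `|s| + m.+1%:R^-1 / 2 * `|s|); last by rewrite -mulrDl -splitr.
apply: lerD => //; rewrite normrM mulrC ler_wpM2r//.
by rewrite distrC ler_distl (ltW q1) (ltW q2).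
Qed.

(** At a density point some line parallel to the axis would meet the set in
    positive length, against the differentiability of [h] along almost all of it. *)
Lemma no_slope_null m j : leb (no_slope m j) = 0%E.
Proof.
have := cube_density_ae (measurable_no_slope m j).
suff -> : [set x | no_slope m j x /\ ~ cube_density_point (no_slope m j) x] =
    no_slope m j by [].
apply/seteqP; split => [x []//|x Nx]; split => // xN.
have c0 : 0 < 4^-1 :> R by rewrite invr_gt0.
have [r0 r00 Hr0] := xN _ c0.
pose r := r0 / 2; have r_gt0 : 0 < r by rewrite divr_gt0.
have rr0 : 0 < r < r0 by rewrite r_gt0 /r ltr_pdivrMr// ltr_pMr// ltr1n.
have rk0 : 0 < r ^+ k by rewrite exprn_gt0.
have lt : (leb (cube x r `\` no_slope m j) < (2^-1 * r ^+ k)%:E)%E.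
  apply: le_lt_trans (Hr0 _ rr0) _; rewrite lte_fin ltr_pM2r//; lra.
have e0 : 0 < 2^-1 * r ^+ k by rewrite mulr_gt0// invr_gt0.
have [y yx [W [mW W0 AW Wle]]] :=
  exists_good_line (axis j) (x - const_mx r) r_gt0 (ltW r_gt0) e0 lt.
have Wr : (mu W < (r - 0)%:E)%E.
  rewrite subr0 -(@lte_pmul2l _ (r ^+ k)%:E)//; apply: le_lt_trans Wle _.
  rewrite -EFinM lte_fin mulrC -mulrA mulrCA ltr_pM2l// gtr_pMl//.
  by rewrite invf_lt1// ltr1n.
have phiL s t : `|h (y + s *: axis j) - h (y + t *: axis j)| <= L * `|s - t|.
  apply: le_trans (hL _ _) _; rewrite opprD addrACA subrr add0r -scalerBl.
  by rewrite norm_axis.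
have [Z [mZ Z0 HZ]] := lipschitz_derivable_ae phiL.
have mW' : measurable (W `|` Z) by exact: measurableU.
have WZ : (mu (W `|` Z) < (r - 0)%:E)%E.
  by apply: le_lt_trans (measureU2 mu mW mZ) _; rewrite [X in (_ + X)%E]Z0 adde0.
have [t /andP[t0 tr] /not_orP[nW nZ]] := not_negligible_meets mW' WZ.
have dt : derivable (fun s : R => h (y + s *: axis j)) t 1.
  by apply: contrapT => nd; apply: nZ; apply: HZ.
have nN := derivable_slope_set dt (m := m).
apply: nW; apply: AW; first by rewrite t0.
split=> //; apply/cubeP => i; have := yx i; rewrite !mxE/= => /andP[y1 y2].
have ti (b : bool) : 0 <= t * b%:R <= r.
  by case: b; rewrite ?mulr1 ?mulr0 ?t0 ?tr ?lexx ?(ltW r_gt0).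
have /andP[] := ti (i == j); rewrite ler_norml; set u := t * _ => u0 ur.
by apply/andP; split; move: y1 y2 u0 ur; clear; lra.
Qed.

End partial_derivatives.

Section derivative_limit.
Context {R : realType} {k' : nat}.
Local Notation V := 'rV[R]_k'.+1.
Implicit Types (h : V -> R) (x y a D : V).

(** Affine approximations with relative errors tending to 0 have slopes that
    converge, and the limit is a derivative. *)
Lemma derivative_of_slopes h x (c : R) : 0 <= c ->
  (forall m : nat, exists a, exists2 r, 0 < r & forall y, `|y - x| < r ->
     `|h y - h x - linear_form a (y - x)| <= c * m.+1%:R^-1 * `|y - x|) ->
  exists D, forall e, 0 < e -> exists2 r, 0 < r & forall y, `|y - x| < r ->
     `|h y - h x - linear_form D (y - x)| <= e * `|y - x|.
Proof.
move=> c0 /choice[a aP]; pose err (m : nat) := c * m.+1%:R^-1.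
have close m p j : a m 0 j - err m <= a p 0 j + err p.
  have [r r0 Hr] := aP m; have [s s0 Hs] := aP p.
  pose t := Num.min r s / 2; have rs0 : 0 < Num.min r s by rewrite lt_min r0.
  have t0 : 0 < t by rewrite divr_gt0.
  have [tr ts] : t < r /\ t < s.
    have : t < Num.min r s by rewrite /t; lra.
    by rewrite lt_min => /andP[].
  pose y : V := x + t *: axis j.
  have yx : y - x = t *: axis j by rewrite /y addrAC subrr add0r.
  have yxn : `|y - x| = t by rewrite yx norm_axis gtr0_norm.
  have linE b : linear_form b (y - x) = t * b 0 j.
    rewrite yx linear_formZ /linear_form (bigD1 j)//= big1 => [|l lj].
      by rewrite addr0 mxE !eqxx mulr1.
    by rewrite mxE (negbTE lj) andbF mulr0.
  have := Hr y; have := Hs y; rewrite !linE yxn => /(_ ts) + /(_ tr).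
  rewrite -/(err m) -/(err p) !ler_norml => /andP[h1 h2] /andP[h3 h4].
  rewrite -(ler_pM2l t0); lra.
have S_sup j : has_sup [set a m 0 j - err m | m in setT].
  split; first by exists (a 0%N 0 j - err 0%N), 0%N.
  by exists (a 0%N 0 j + err 0%N) => _ [m _ <-]; exact: close.
(* the limit slope is the supremum of the lower bounds provided by the slopes *)
pose D : V := \row_j sup [set a m 0 j - err m | m in setT].
have Da m j : `|(D - a m) 0 j| <= err m.
  rewrite !mxE ler_distl; apply/andP; split.
    by apply: ub_le_sup; [exact: (S_sup j).2|exists m].
  apply: ge_sup; first exact: (S_sup j).1.
  by move=> _ [p _ <-]; exact: close.
exists D => e e0.
have [m me] : exists m : nat, err m + k'.+1%:R * err m <= e.
  pose b := c + k'.+1%:R * c; exists (Num.truncn (b / e)).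
  rewrite /err mulrA -mulrDl -/b ler_pdivrMr ?ltr0n// mulrC -ler_pdivrMr//.
  exact/ltW/truncnS_gt.
have [r r0 Hr] := aP m; exists r => // y yr.
have -> : h y - h x - linear_form D (y - x) = (h y - h x - linear_form (a m) (y - x)) -
    linear_form (D - a m) (y - x).
  have -> : linear_form (D - a m) (y - x) = linear_form D (y - x) - linear_form (a m) (y - x).
    by rewrite /linear_form -sumrB; apply: eq_bigr => j _; rewrite !mxE mulrBl.
  ring.
apply: le_trans (ler_normB _ _) _.
apply: (@le_trans _ _ ((err m + k'.+1%:R * err m) * `|y - x|)); last by rewrite ler_wpM2r.
rewrite mulrDl; apply: lerD; first exact: Hr.
apply: le_trans (linear_form_le _ (lexx _)) _; rewrite ler_wpM2r//.
apply: (@le_trans _ _ (\sum_(j < k'.+1) err m)); first by apply: ler_sum => j _; exact: Da.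
by rewrite sumr_const card_ord mulr_natl.
Qed.

Lemma derivative_ap_derivable (E : set V) (g h : V -> R) x D : E x ->
  (forall y, E y -> h y = g y) -> cube_density_point E x ->
  (forall e, 0 < e -> exists2 r, 0 < r & forall y, `|y - x| < r ->
     `|h y - h x - linear_form D (y - x)| <= e * `|y - x|) ->
  ap_derivable E g x.
Proof.
move=> Ex hg xE hD; exists D => e e0; have e20 : 0 < e / 2 by rewrite divr_gt0.
have [r r0 Hr] := hD _ e20.
apply: (density_point_of_cube r0 xE) => y Ey yr; split => //.
have := euclidean_norm_ge0 (y - x); rewrite le_eqVlt => /orP[/eqP <-|n0].
  by rewrite invr0 mulr0.
rewrite ltr_pdivrMr// -(hg _ Ey) -(hg _ Ex); apply: le_lt_trans (Hr _ yr) _.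
apply: (@le_lt_trans _ _ (e / 2 * euclidean_norm (y - x))).
  by rewrite ler_pM2l//; exact: norm_le_euclidean.
by rewrite ltr_pM2r//; lra.
Qed.

End derivative_limit.

Section rademacher.
Context {R : realType} {k' : nat}.
Local Notation k := k'.+1.
Local Notation V := 'rV[R]_k.
Local Notation leb := (@lebesgue_outer R k).
Variables (h : V -> R) (L : R).
Hypotheses (L0 : 0 <= L) (hL : forall x y, `|h x - h y| <= L * `|x - y|).

Definition slopes_set (m : nat) (z : {ffun 'I_k -> rat} * {ffun 'I_k -> nat}) : set V :=
  \big[setI/setT]_(j < k) slope_set h m j (z.1 j) (z.2 j).

Lemma measurable_slopes_set m z : lebesgue_measurable (slopes_set m z).
Proof. by apply: lebesgue_measurable_bigcap => j; exact: (measurable_slope_set hL). Qed.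

(** The increment from [x] to [y] is split along the axes. Each intermediate point
    is close to a point of the set, where the increment along the axis is known. *)
Lemma slopes_density m z x : slopes_set m z x ->
  cube_density_point (slopes_set m z) x -> exists2 r, 0 < r & forall y, `|y - x| < r ->
    `|h y - h x - linear_form (rational_point z.1) (y - x)| <=
      2 * k%:R * m.+1%:R^-1 * `|y - x|.
Proof.
move=> Tx xT; set T := slopes_set m z in Tx xT.
have Tslope u j : T u -> slope_set h m j (z.1 j) (z.2 j) u.
  by rewrite /T /slopes_set (bigD1 j)//= => -[].
have m0 : 0 < m.+1%:R^-1 :> R by rewrite invr_gt0.
pose e := Num.min 1 (m.+1%:R^-1 / (2 * (L + 1))).
have L10 : 0 < 2 * (L + 1) by rewrite mulr_gt0// ltr_wpDl.
have e01 : 0 < e <= 1 by rewrite lt_min ltr01 divr_gt0// ge_min lexx.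
have [/ltW e0 e1] := andP e01.
have Le : 2 * L * e <= m.+1%:R^-1.
  apply: (@le_trans _ _ (2 * (L + 1) * e)); first by rewrite ler_wpM2r//; lra.
  by rewrite mulrC -ler_pdivlMr// /e ge_min lexx orbT.
have xT' : density_point T x by apply: (density_point_of_cube ltr01 xT).
have [r1 r10 near] := density_point_near xT' e01.
pose r2 := \big[Num.min/1]_(j < k) (z.2 j).+1%:R^-1 : R.
have r20 : 0 < r2.
  by rewrite /r2; elim/big_ind : _ => // a b a0 b0; rewrite lt_min a0.
have r2j j : r2 <= (z.2 j).+1%:R^-1 by rewrite /r2 (bigD1 j)//= ge_min lexx.
exists (Num.min r1 r2); first by rewrite lt_min r10.
move=> y; rewrite lt_min => /andP[yr1 yr2]; set d := `|y - x| in yr1 yr2 *.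
have d0 : 0 <= d by exact: normr_ge0.
(* the path from [x] to [y] along the axes *)
pose p (i : nat) : V := \row_l if (l < i)%N then y 0 l else x 0 l.
have px i : `|p i - x| <= d.
  apply/row_norm_leP => [|l]; first exact: normr_ge0.
  rewrite !mxE; case: ifP => _; last by rewrite subrr normr0 normr_ge0.
  by have := coord_le_norm (y - x) l; rewrite !mxE.
have pS (i : 'I_k) : p i.+1 = p i + (y 0 i - x 0 i) *: axis i.
  apply/rowP => l; rewrite !mxE ltnS leq_eqVlt eqxx/=.
  have [->|li] := eqVneq l i; first by rewrite eqxx ltnn/= mulr1 addrC subrK.
  by rewrite (negbTE (_ : l != i :> nat))//= mulr0 addr0.
have vd i : `|y 0 i - x 0 i| <= d by have := coord_le_norm (y - x) i; rewrite !mxE.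
have step (i : 'I_k) :
    `|h (p i.+1) - h (p i) - (y 0 i - x 0 i) * ratr (z.1 i)| <= 2 * m.+1%:R^-1 * d.
  have [u Tu up] : exists2 u, T u & `|u - p i| <= e * d.
    have [pxi|pxi] := eqVneq (p i) x; first by exists x => //; rewrite pxi subrr normr0 mulr_ge0.
    have [u Tu up] := near _ pxi (le_lt_trans (px i) yr1).
    by exists u => //; apply: le_trans up _; rewrite ler_wpM2l.
  set t := y 0 i - x 0 i.
  have h1 : `|h (u + t *: axis i) - h u - t * ratr (z.1 i)| <= m.+1%:R^-1 * d.
    have tn : `|t| < (z.2 i).+1%:R^-1.
      by apply: le_lt_trans (vd i) _; exact: lt_le_trans yr2 (r2j i).
    by apply: le_trans (Tslope _ i Tu t tn) _; rewrite ler_wpM2l ?(ltW m0) ?vd.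
  have h2 : `|h (p i + t *: axis i) - h (u + t *: axis i)| <= L * (e * d).
    apply: le_trans (hL _ _) _; rewrite opprD addrACA subrr addr0 distrC.
    by rewrite ler_wpM2l.
  have h3 : `|h (p i) - h u| <= L * (e * d).
    by apply: le_trans (hL _ _) _; rewrite distrC ler_wpM2l.
  rewrite pS -/t.
  have -> : h (p i + t *: axis i) - h (p i) - t * ratr (z.1 i) =
    (h (u + t *: axis i) - h u - t * ratr (z.1 i)) +
    ((h (p i + t *: axis i) - h (u + t *: axis i)) - (h (p i) - h u)) by ring.
  apply: le_trans (ler_normD _ _) _; 
  have -> : 2 * m.+1%:R^-1 * d = m.+1%:R^-1 * d + m.+1%:R^-1 * d by rewrite -mulrA mulr_natl mulr2n.
  apply: lerD => //; apply: le_trans (ler_normB _ _) _; apply: le_trans (lerD h2 h3) _.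
  have -> : L * (e * d) + L * (e * d) = 2 * L * e * d by ring.
  by rewrite ler_wpM2r.
have -> : h y - h x = \sum_(i < k) (h (p i.+1) - h (p i)).
  rewrite -(big_mkord xpredT (fun i => h (p i.+1) - h (p i))) telescope_sumr//.
  congr (h _ - h _); apply/rowP => l; rewrite !mxE ?ltn_ord//.
rewrite /linear_form -sumrB; apply: le_trans (ler_norm_sum _ _ _) _.
apply: (@le_trans _ _ (\sum_(i < k) 2 * m.+1%:R^-1 * d)).
  by apply: ler_sum => i _; rewrite !mxE [ratr _ * _]mulrC; exact: step.
by rewrite sumr_const card_ord -mulr_natl le_eqVlt; apply/orP; left; apply/eqP; ring.
Qed.

(** The exceptional points have no slope along some axis at some precision, or are
    not density points of one of countably many sets containing them. *)
Lemma rademacher : leb [set x | ~ exists D, forall e, 0 < e ->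
  exists2 r, 0 < r & forall y, `|y - x| < r ->
    `|h y - h x - linear_form D (y - x)| <= e * `|y - x|] = 0%E.
Proof.
pose N1 (mj : nat * 'I_k) := no_slope h mj.1 mj.2.
pose N2 (mz : nat * ({ffun 'I_k -> rat} * {ffun 'I_k -> nat})) :=
  [set x | slopes_set mz.1 mz.2 x /\ ~ cube_density_point (slopes_set mz.1 mz.2) x].
pose N (s : (nat * 'I_k) + (nat * ({ffun 'I_k -> rat} * {ffun 'I_k -> nat}))) :=
  match s with inl mj => N1 mj | inr mz => N2 mz end.
apply: (@lebesgue_outer_subset0 _ _ _ (\bigcup_s N s)); last first.
  apply: lebesgue_outer_countable => -[mj|mz]; first exact: (no_slope_null hL).
  exact/cube_density_ae/measurable_slopes_set.
move=> x nx; apply: contrapT => xN; apply: nx.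
apply: (@derivative_of_slopes _ _ _ _ (2 * k%:R)) => [|m]; first exact: mulr_ge0.
have /choice[s sP] : forall j, exists s : rat * nat, slope_set h m j s.1 s.2 x.
  move=> j; have : ~ no_slope h m j x by move=> Nx; apply: xN; exists (inl (m, j)).
  by rewrite /no_slope => /contrapT[s _ Hs]; exists s.
pose z : {ffun 'I_k -> rat} * {ffun 'I_k -> nat} :=
  ([ffun j => (s j).1], [ffun j => (s j).2]).
have Tx : slopes_set m z x.
  by rewrite /slopes_set; elim/big_ind : _ => // j _; rewrite !ffunE.
exists (rational_point z.1); apply: slopes_density => //.
by apply: contrapT => nd; apply: xN; exists (inr (m, z)).
Qed.

End rademacher.

Lemma lipschitz_ap_derivable_ae {R : realType} {k' : nat} (E : set 'rV[R]_k'.+1)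
    (g : 'rV[R]_k'.+1 -> R) (L : R) : lebesgue_measurable E -> 0 <= L ->
  (forall x y, E x -> E y -> `|g x - g y| <= L * `|x - y|) ->
  lebesgue_outer [set x | E x /\ ~ ap_derivable E g x] = 0%E.
Proof.
move=> mE L0 gL; have [h [hg hL]] := mcshane_extension L0 gL.
have h0 := rademacher L0 hL; set N := [set x | _] in h0.
pose F (b : bool) := if b then N else [set x | E x /\ ~ cube_density_point E x].
apply: (@lebesgue_outer_subset0 _ _ _ (\bigcup_b F b)); last first.
  by apply: lebesgue_outer_countable => -[//|]; exact: cube_density_ae.
move=> x [Ex nx]; have [Nx|/contrapT[D hD]] := pselect (N x); first by exists true.
exists false => //; split => // xE; apply: nx.
exact: derivative_ap_derivable Ex hg xE hD.
Qed.

(** * The equivalence *)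

Lemma linfty_ap_derivable_ae {R : realType} {k' : nat} (E : set 'rV[R]_k'.+1)
    (g : 'rV[R]_k'.+1 -> linfty R) (L : R) : lebesgue_measurable E -> 0 <= L ->
  (forall i x y, E x -> E y -> `|val (g x) i - val (g y) i| <= L * `|x - y|) ->
  lebesgue_outer [set x | E x /\ ~ linfty_ap_derivable E g x] = 0%E.
Proof.
move=> mE L0 gL; pose N i := [set x | E x /\ ~ ap_derivable E (fun y => val (g y) i) x].
apply: (@lebesgue_outer_subset0 _ _ _ (\bigcup_i N i)); last first.
  by apply: lebesgue_outer_countable => i; exact: lipschitz_ap_derivable_ae mE L0 (gL i).
by move=> x [Ex /existsNP[i nd]]; exists i.
Qed.

Lemma lipschitz_map_on_max_norm {R : realType} {k : nat} {X : metricType R}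
    (E : set 'rV[R]_k) (f : 'rV[R]_k -> X) : lipschitz_map_on E f ->
  exists2 L, 0 < L & forall x y, E x -> E y -> mdist (f x) (f y) <= L * `|x - y|.
Proof.
move=> [L fL]; exists (`|L| * k%:R + 1); first by rewrite ltr_wpDl// mulr_ge0.
move=> x y Ex Ey; apply: le_trans (fL _ _ Ex Ey) _.
apply: (@le_trans _ _ (`|L| * (k%:R * `|x - y|))).
  apply: (@le_trans _ _ (`|L| * euclidean_norm (x - y))).
    by rewrite ler_wpM2r ?euclidean_norm_ge0// ler_norm.
  by rewrite ler_wpM2l//; exact: euclidean_le_norm.
by rewrite mulrA ler_wpM2r// lerDl.
Qed.

Theorem theorem1p2 (R : realType) (X : metricType R) (Phi : X -> linfty R)
    (X_complete : complete_space X) (X_quasiconvex : quasiconvex X)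
    (Phi_weak_BLD : weak_BLD Phi)
    (k : nat) (k_gt0 : (0 < k)%N)
    (E : set 'rV[R]_k) (E_measurable : lebesgue_measurable E)
    (f : 'rV[R]_k -> X) (f_lipschitz : lipschitz_map_on E f) :
  (hausdorff_measure k (f @` E) = 0%E <->
   hausdorff_measure k (Phi @` (f @` E)) = 0%E) /\
  (hausdorff_measure k (Phi @` (f @` E)) = 0%E <->
   ae_in E (fun x =>
     linfty_ap_derivable E (Phi \o f) x /\
     (rank_rows (linfty_ap_derivative E (Phi \o f) x) < k)%N)).
Proof.
case: k k_gt0 E E_measurable f f_lipschitz => // k' _ E mE f f_lip.
have [M [M1 Phi_BLD]] := Phi_weak_BLD; have [C [C1 X_quasi]] := X_quasiconvex.
have [L L0 fL] := lipschitz_map_on_max_norm f_lip.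
have MC0 : 0 < M * C by rewrite mulr_gt0// (lt_le_trans ltr01).
have compL := component_lipschitz C1 M1 X_quasi Phi_BLD fL.
have h12 : hausdorff_measure k'.+1 (f @` E) = 0%E ->
    hausdorff_measure k'.+1 (Phi @` (f @` E)) = 0%E.
  apply: (hausdorff_measure0_image MC0) => x y _ _.
  exact: (weak_BLD_lipschitz M1 X_quasi Phi_BLD).
have h23 : hausdorff_measure k'.+1 (Phi @` (f @` E)) = 0%E -> ae_in E (fun x =>
    linfty_ap_derivable E (Phi \o f) x /\
    (rank_rows (linfty_ap_derivative E (Phi \o f) x) < k'.+1)%N).
  rewrite image_comp => PhiE0; have L'0 : 0 < M * C * L by rewrite mulr_gt0.
  apply: (null_image_rank_ae L'0 compL) => //.
  exact: (linfty_ap_derivable_ae mE (ltW L'0) compL).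
have h31 := ae_degenerate_null X_complete C1 M1 X_quasi Phi_BLD mE L0 fL.
by split; split; [exact: h12|move=> /h23/h31|exact: h23|move=> /h31/h12].
Qed.
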